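(* Let $\mathrm{SL_{Gr}}(3,\mathbb C)$, $\widetilde{\mathrm{SL_{Gr}}}(3,\mathbb C)$, $Fl_2$, $\widetilde{Fl_2}$ be the $\mathrm{SU}_3$-spaces defined in the context, and let $\sigma(g)=P(g^T)^{-1}P$ on $\mathrm{SL}_3\mathbb C$. Then: (1) The spaces $\mathrm{SL_{Gr}}(3,\mathbb C)$ and $\widetilde{\mathrm{SL_{Gr}}}(3,\mathbb C)$ are naturally equivariantly diffeomorphic symmetric spaces relative to $\sigma^3$, and they are $5$-dimensional. (2) The spaces $Fl_2$ and $\widetilde{Fl_2}$ are naturally equivariantly diffeomorphic $3$-symmetric spaces relative to $\sigma^2$, and they are $6$-dimensional. (3) These homogeneous spaces can be represented as $$\mathrm{SL_{Gr}}(3,\mathbb C)=\mathrm{SU}_3/\mathrm{SO}_3,\quad \widetilde{\mathrm{SL_{Gr}}}(3,\mathbb C)=\mathrm{SU}_3/\mathrm{SO}_3,\quad Fl_2=\mathrm{SU}_3/\mathrm D_3,\quad \widetilde{Fl_2}=\mathrm{SU}_3/\mathrm D_3,$$ where $\mathrm D_3$ is the group of diagonal matrices in $\mathrm{SU}_3$ and $\mathrm{SO}_3$ is the connected subgroup of $\mathrm{SU}_3$ with Lie algebra $\left\{\begin{pmatrix} ia&0&y\\0&-ia&\bar y\\-\bar y&-y&0\end{pmatrix}: a\in\mathbb R,\,y\in\mathbb C\right\}$ (each being the stabilizer of a suitable point).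
   Context: $P=\begin{pmatrix}0&\epsilon^2&0\\ \epsilon^4&0&0\\0&0&1\end{pmatrix}$, $\epsilon=e^{\pi i/3}$. The automorphism $\sigma$ of $\mathrm{SL}_3\mathbb C$ has order $6$ and commutes with $\tau(g)=(\bar g^T)^{-1}$, whose fixed point group is $\mathrm{SU}_3$. $k$-symmetric space: for an automorphism $\kappa$ of $\mathrm{SL}_3\mathbb C$ of order $k\ge 2$ commuting with $\tau$, a homogeneous space $\mathrm{SU}_3/K$ is a $k$-symmetric space relative to $\kappa$ if $\mathrm{Fix}(\mathrm{SU}_3,\kappa)^\circ\subset K\subset\mathrm{Fix}(\mathrm{SU}_3,\kappa)$ ($^\circ$: identity component); for $k=2$ it is called symmetric. Let $e_1,e_2,e_3$ be the standard basis of $\mathbb C^3$, $\tilde e_1=(\frac{1+i}2,\frac{1-i}2,0)^T$, $\tilde e_2=(\frac{1-i}2,\frac{1+i}2,0)^T$, $V_0=\operatorname{span}_{\mathbb R}\{\tilde e_1,\tilde e_2,e_3\}$, an oriented real Lagrangian subspace of $\mathbb C^3$ for the symplectic form $\operatorname{Im}\langle\cdot,\cdot\rangle$. - $\mathrm{SL_{Gr}}(3,\mathbb C)$ (also written $\mathrm{SL_{Gr}}(3,\mathbb C^3)$): the $\mathrm{SU}_3$-orbit of $V_0$ in the set of oriented Lagrangian subspaces of $\mathbb C^3$. - $\widetilde{\mathrm{SL_{Gr}}}(3,\mathbb C)=\{U(PP^TP)U^T\mid U\in\mathrm{SU}_3\}$ with action $g.Q=gQg^T$. - $Fl_2$: the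 set of full flags $0\subset W_1\subset W_2\subset W_3=\mathbb C^3$ of complex subspaces, $\dim_{\mathbb C} W_j=j$, with the natural action. - $\widetilde{Fl_2}=\{U(PP^T)U^{-1}\mid U\in\mathrm{SU}_3\}$ with action $g.Q=gQg^{-1}$. ''Equivariantly diffeomorphic'' means there is a diffeomorphism commuting with the $\mathrm{SU}_3$-actions. *)

(* Defs.v *)
From HB Require Import structures.
From mathcomp Require Import all_boot all_order all_algebra.
From mathcomp Require Import all_classical all_reals all_analysis.
From mathcomp Require Import complex.

Set Implicit Arguments.
Unset Strict Implicit.
Unset Printing Implicit Defensive.

Import Order.TTheory GRing.Theory Num.Theory.
Import numFieldNormedType.Exports.

Local Open Scope classical_set_scope.
Local Open Scope ring_scope.
Local Open Scope sesquilinear_scope.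

(* Smooth maps between open subsets of normed spaces.  All models used below
   are finite-dimensional, so that "all directional derivatives are C^k"
   means "the derivative is C^k". *)

Fixpoint Ck (R : realType) (V W : normedModType R) (k : nat) (U : set V)
    (f : V -> W) : Prop :=
  match k with
  | 0 => forall x, U x -> {for x, continuous f}
  | k'.+1 => (forall x, U x -> differentiable f x)
             /\ forall v : V, Ck k' U (fun x => 'D_v f x)
  end.

Definition Cinfty (R : realType) (V W : normedModType R) (U : set V)
  (f : V -> W) : Prop := forall k, Ck k U f.

(* A smooth space is a set [par @` dom] of points together with a
   parametrization [par] of it by a subset [dom] of a normed space; it carries
   the quotient smooth structure.  When [dom] is open (or a submanifold) and
   [par] is the projection of a quotient manifold, such as frames -> flags or
   a Lie group -> its coset space, this is the quotient manifold structure: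
   smooth maps are the maps which lift locally to smooth maps of parameters.
   With [par] the identity, smooth maps between subsets X and Y are maps which
   extend locally to smooth maps of the ambient spaces (Milnor). *)

Record smooth_space (R : realType) := SmoothSpace {
  pt : Type;
  model : normedModType R;
  dom : set model;
  par : model -> pt }.

Arguments dom {R}.
Arguments par {R}.

Section SmoothSpaces.
Context {R : realType}.
Implicit Types S T : smooth_space R.

Definition smooth_map S T (X : set (pt S)) (f : pt S -> pt T) : Prop :=
  forall e, dom S e -> X (par S e) ->
  exists U : set (model S), exists F : model S -> model T,
    [/\ open U, U e, Cinfty U F &
        forall e', U e' -> dom S e' -> X (par S e') ->
          dom T (F e') /\ par T (F e') = f (par S e')].

Definition diffeomorphism S T (X : set (pt S)) (Y : set (pt T))
    (f : pt S -> pt T) : Prop :=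
  [/\ set_bij X Y f, smooth_map X f &
      exists g : pt T -> pt S,
        (forall x, X x -> g (f x) = x) /\ smooth_map Y g].

(* quotient topology of the parametrization, restricted to X *)
Definition open_in S (X O : set (pt S)) : Prop :=
  O `<=` X /\
  exists W : set (model S), open W /\
    forall e, dom S e -> X (par S e) -> (O (par S e) <-> W e).

Definition euclidean (n : nat) : smooth_space R :=
  @SmoothSpace R 'rV[R]_n 'rV[R]_n setT id.

Definition manifold_of_dim S (X : set (pt S)) (n : nat) : Prop :=
  forall x, X x ->
  exists O : set (pt S), exists V : set 'rV[R]_n,
  exists phi : 'rV[R]_n -> pt S,
    [/\ O x, open_in X O, open V &
        @diffeomorphism (euclidean n) S V O phi].

End SmoothSpaces.

Section Main.
Context (R : realType).

Local Notation C := R[i].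
Local Notation M3 := 'M[C]_3.

(* M_3(C) as a real normed space, A + i B being represented by (A, B) *)

Definition M3R : normedModType R := ('M[R]_3 * 'M[R]_3)%type.

Definition realify (g : M3) : M3R :=
  (map_mx (@complex.Re R) g, map_mx (@complex.Im R) g).

Definition complexify (e : M3R) : M3 :=
  \matrix_(i, j) Complex (e.1 i j) (e.2 i j).

Definition mxspace : smooth_space R :=
  @SmoothSpace R M3 M3R setT complexify.

Definition mx3 (rows : seq (seq C)) : M3 :=
  \matrix_(i < 3, j < 3) nth 0 (nth [::] rows i) j.

Definition SL3 : set M3 := [set g | \det g = 1].

Definition SU3 : set M3 := [set g | g \is unitarymx /\ \det g = 1].

Definition tau (g : M3) : M3 := invmx (g ^t*).

Definition epsilon : C := Complex (cos (pi / 3)) (sin (pi / 3)).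

Definition P : M3 := mx3
  [:: [:: 0;           epsilon ^+ 2; 0];
      [:: epsilon ^+ 4; 0;           0];
      [:: 0;           0;            1]].

Definition sigma (g : M3) : M3 := P *m invmx (g^T) *m P.

Definition closed_subgroup (K : set M3) : Prop :=
  [/\ K `<=` SU3, K 1%:M,
      forall g h, K g -> K h -> K (g *m h),
      forall g, K g -> K (invmx g) &
      closed (realify @` K)].

Record SU3_space := SU3Space {
  base_space : smooth_space R;
  carrier : set (pt base_space);
  act : M3 -> pt base_space -> pt base_space }.

Arguments carrier : clear implicits.
Arguments act : clear implicits.

Definition equivariant_diffeo (X Y : SU3_space)
    (f : pt (base_space X) -> pt (base_space Y)) : Prop :=
  diffeomorphism (carrier X) (carrier Y) f
  /\ forall g x, SU3 g -> carrier X x -> f (act X g x) = act Y g (f x).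

Definition stabilizer (X : SU3_space) (x : pt (base_space X)) : set M3 :=
  [set g | SU3 g /\ act X g x = x].

Definition has_dim (X : SU3_space) (n : nat) : Prop :=
  manifold_of_dim (carrier X) n.

Definition lcoset (K : set M3) (g : M3) : set M3 := [set g *m k | k in K].

Definition SU3_mod (K : set M3) : SU3_space :=
  @SU3Space
    (@SmoothSpace R (set M3) M3R [set e | SU3 (complexify e)]
       (fun e => lcoset K (complexify e)))
    [set lcoset K g | g in SU3]
    (fun g S => [set g *m s | s in S]).

(* X = SU_3 / K, the coset K corresponding to a point with stabilizer K *)
Definition represented_as (X : SU3_space) (K : set M3) : Prop :=
  closed_subgroup K /\
  exists f : set M3 -> pt (base_space X),
    @equivariant_diffeo (SU3_mod K) X f /\ stabilizer (f K) = K.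

(* Lie group automorphisms of SL_3(C) of exact order k commuting with tau *)
Definition automorphism_of_order (k : nat) (kappa : M3 -> M3) : Prop :=
  [/\ @diffeomorphism R mxspace mxspace SL3 SL3 kappa,
      forall g h, SL3 g -> SL3 h -> kappa (g *m h) = kappa g *m kappa h,
      forall g, SL3 g -> iter k kappa g = g,
      forall j, (0 < j < k)%N -> exists2 g, SL3 g & iter j kappa g <> g &
      forall g, SL3 g -> kappa (tau g) = tau (kappa g)].

Definition Fix (kappa : M3 -> M3) : set M3 :=
  [set g | SU3 g /\ kappa g = g].

Definition identity_component (H : set M3) : set M3 :=
  [set g | connected_component (realify @` H) (realify 1%:M) (realify g)].

Definition k_symmetric_space (k : nat) (kappa : M3 -> M3) (X : SU3_space)
    : Prop :=
  [/\ (2 <= k)%N, automorphism_of_order k kappa &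
      exists K : set M3,
        [/\ represented_as X K,
            identity_component (Fix kappa) `<=` K & K `<=` Fix kappa]].

Definition symmetric_space := k_symmetric_space 2.

(* Real subspaces of C^3 of real dimension 3.  A frame is a matrix whose
   columns form a real basis; an oriented subspace is the pair of its vectors
   and its positively oriented frames. *)

Definition real_frame (b : M3) : Prop :=
  forall x : 'cV[R]_3, b *m map_mx (real_complex R) x = 0 -> x = 0.

Definition oriented : Type := (set 'cV[C]_3 * set M3)%type.

Definition oriented_span (b : M3) : oriented :=
  ([set b *m map_mx (real_complex R) x | x in [set: 'cV[R]_3]],
   [set b *m map_mx (real_complex R) A | A in [set A : 'M[R]_3 | 0 < \det A]]).

Definition act_oriented (g : M3) (V : oriented) : oriented :=
  ([set g *m v | v in V.1], [set g *m b | b in V.2]).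

Definition herm (u v : 'cV[C]_3) : C := \sum_(i < 3) u i 0 * (v i 0)^*.

Definition oriented_lagrangian (V : oriented) : Prop :=
  (exists2 b, real_frame b & V = oriented_span b)
  /\ forall u v, V.1 u -> V.1 v -> complex.Im (herm u v) = 0.

(* the columns are the vectors e~1, e~2, e_3 *)
Definition frame0 : M3 := mx3
  [:: [:: Complex (1 / 2) (1 / 2);   Complex (1 / 2) (- (1 / 2)); 0];
      [:: Complex (1 / 2) (- (1 / 2)); Complex (1 / 2) (1 / 2);   0];
      [:: 0;                         0;                           1]].

Definition V0 : oriented := oriented_span frame0.

Definition SLGr : SU3_space :=
  @SU3Space
    (@SmoothSpace R oriented M3R [set e | real_frame (complexify e)]
       (fun e => oriented_span (complexify e)))
    [set V | oriented_lagrangian V /\ exists2 g, SU3 g & V = act_oriented g V0]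
    act_oriented.

Definition SLGr_tilde : SU3_space :=
  @SU3Space mxspace
    [set U *m (P *m P^T *m P) *m U^T | U in SU3]
    (fun g Q => g *m Q *m g^T).

(* A full flag is given by its terms W_1 and W_2. *)

Definition flag : Type := ({vspace 'cV[C]_3} * {vspace 'cV[C]_3})%type.

Definition flag_of (b : M3) : flag :=
  let b1 := col 0 b in let b2 := col 1 b in (<[b1]>%VS, (<[b1]> + <[b2]>)%VS).

Definition Fl2 : SU3_space :=
  @SU3Space
    (@SmoothSpace R flag M3R [set e | complexify e \in unitmx]
       (fun e => flag_of (complexify e)))
    [set W | [/\ \dim W.1 = 1%N, \dim W.2 = 2%N & (W.1 <= W.2)%VS]]
    (fun g W => ((linfun (mulmx g) @: W.1)%VS, (linfun (mulmx g) @: W.2)%VS)).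

Definition Fl2_tilde : SU3_space :=
  @SU3Space mxspace
    [set U *m (P *m P^T) *m invmx U | U in SU3]
    (fun g Q => g *m Q *m invmx g).

Definition D3 : set M3 := [set g | SU3 g /\ is_diag_mx g].

(* velocities of the one-parameter subgroups of K *)
Definition lie_algebra (K : set M3) : set M3 :=
  [set X | exists gamma : R -> M3,
     [/\ forall t, K (gamma t),
         forall s t, gamma (s + t) = gamma s *m gamma t &
         is_derive (0 : R) (1 : R) (realify \o gamma) (realify X)]].

Definition connected_subgroup_with_lie_algebra (K k : set M3) : Prop :=
  [/\ closed_subgroup K, connected (realify @` K) & lie_algebra K = k].

Definition so3 : set M3 :=
  [set X | exists (a : R) (y : C),
     X = mx3 [:: [:: Complex 0 a; 0;               y];
                 [:: 0;           Complex 0 (- a); y^*];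
                 [:: - y^*;       - y;             0]]].

End Main.

Arguments sigma : clear implicits.
Arguments D3 : clear implicits.
Arguments so3 : clear implicits.

(* Main.v *)
(* Each of the four spaces is parametrized by 3 x 3 matrices (frames), and
   Gram-Schmidt, normalized to determinant 1, turns a frame depending smoothly
   on a point into an element of SU_3 carrying the base point to that point.
   So the orbit map is smooth and has smooth local sections; such a space is
   SU_3 modulo the stabilizer of the base point, and two of them with the same
   stabilizer are equivariantly diffeomorphic.

   Let B be the frame of V_0 and S = P P^T P, the permutation matrix swapping
   e_1 and e_2.  Since B B^T = S, both V_0 and S have the stabilizer
   B SO(3) B^-1 = {g | g S g^T = S}, which is the fixed group of sigma^3, as
   sigma^3(g) = S g^-T S.  With D = P P^T, diagonal with distinct entries,
   sigma^2(g) = D g D^-1, so the stabilizers of D and of the standard flag, as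
   well as the fixed group of sigma^2, are the group of diagonal matrices.

   For the dimensions, Lagrangian subspaces near V_0 are graphs B(x + iHx) with
   H real symmetric, and such a graph is special iff tr H = det H, an equation
   which determines the last entry of H from the other five; flags are
   parametrized by the big cell.  B SO(3) B^-1 is connected because of Euler
   angles, and its Lie algebra is computed by differentiating the defining
   relations and, conversely, by Rodrigues' formula. *)

Require Import Defs.
From HB Require Import structures.
From mathcomp Require Import all_boot all_order all_algebra.
From mathcomp Require Import all_classical all_reals all_analysis.
From mathcomp Require Import complex ring lra.
Local Open Scope classical_set_scope.
Local Open Scope ring_scope.
Local Open Scope sesquilinear_scope.

Set Implicit Arguments.
Unset Strict Implicit.
Unset Printing Implicit Defensive.

Import Order.TTheory GRing.Theory Num.Theory.
Import numFieldNormedType.Exports.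

(** * Smooth maps *)

(** Smoothness is tested on lifts through the parametrizations, so every map must be given by a
    smooth formula in matrix entries; the work lies in the local sections. A frame hA of a
    Lagrangian subspace, with h unitary of determinant i and A real, has Gram-Schmidt frame h A'
    diag(1, 1, -i) with A' a rotation; the right factor [to_lagrangian] repairs the phase. The two
    matrix models offer no frame to start from: near a given point one is made by projecting a fixed
    frame, by v + Q conj(v) onto the Lagrangian subspace of Q, and by averaging powers of x onto the
    eigenspaces of x. Maps between homogeneous spaces may be twisted by a left translation c. This
    moves the base point anywhere, so one chart at one point serves all points of both models of a
    pair. The Lie algebra rests on linear forms of the group relations: along a one-parameter
    subgroup the adjoint of gamma(t) is gamma(-t), and S gamma(t)^T = gamma(-t) S. Conversely X^3 is
    a multiple of X, which makes the exponential a quadratic polynomial in X. *)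

Section ScaleBilinear.
Context {R : realType} {W : normedModType R}.

(** Scaling as a named function, so that a bilinear structure can be attached to it; the product
    rule is then the differential of a bilinear map. *)
Definition scale_fun (a : R) (w : W) : W := a *: w.

Lemma scale_fun_bilinear :
  bilinear_for (GRing.Scale.Law.clone _ _ *:%R _)
    (GRing.Scale.Law.clone _ _ *:%R _) scale_fun.
Proof.
split=> [w|a] k x y /=; first by rewrite /scale_fun scalerDl scalerA.
by rewrite /scale_fun scalerDr !scalerA mulrC.
Qed.

HB.instance Definition _ :=
  bilinear_isBilinear.Build R R W W _ _ scale_fun scale_fun_bilinear.

End ScaleBilinear.

Section Calculus.
Context {R : realType}.
Implicit Types V W Z : normedModType R.

Lemma is_diff_scale_fun V W (f : V -> R) (g : V -> W) x :
  differentiable f x -> differentiable g x ->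
  is_diff x (fun y => f y *: g y) (fun v => f x *: 'd g x v + 'd f x v *: g x).
Proof.
move=> df dg.
have sc : continuous (fun p : R * W => scale_fun p.1 p.2).
  by move=> p; exact: scale_continuous.
have h := @differentiable_bilin R R W W scale_fun (f x, g x) sc.
have hd : differentiable (fun y => (f y, g y)) x by exact: differentiable_pair.
apply: DiffDef.
  exact: (@differentiable_comp R V (R * W)%type W (fun y => (f y, g y)) _ x hd h).
have := @diff_comp R V (R * W)%type W (fun y => (f y, g y)) _ x hd h.
rewrite (@diff_pair R V R W f g x df dg).
by rewrite (@diff_bilin R R W W scale_fun (f x, g x) sc).
Qed.

(** The remainder estimate at [x] only sees values near [x], so ['d f x] is a differential of [g] as
    well. *)
Lemma differentiable_near_eq V W (f g : V -> W) x :
  (\forall y \near x, f y = g y) -> differentiable f x -> differentiable g x.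
Proof.
move=> fg df; have fx := nbhs_singleton fg.
have dfc : continuous ('d f x) by exact: diff_continuous.
have dg : g \o shift x = cst (g x) + 'd f x +o_ 0 id.
  apply/eqaddoE/eqaddoP => e e0.
  have /diff_locallyP [_ /eqaddoP /(_ e e0)] := df.
  have fg0 : \forall y \near (0 : V), f (y + x) = g (y + x).
    have := fg; rewrite (near_shift 0) subr0; apply: filterS => y /=.
    done.
  apply: filter_app; move: fg0; apply: filterS => y /=.
  by rewrite !fctE /= fx => ->.
apply/diff_locallyP; rewrite (diff_unique dfc dg); split => //.
Qed.

Lemma open_near_eq V W (U : set V) (f g : V -> W) x : open U ->
  (forall x, U x -> f x = g x) -> U x -> \forall y \near x, f y = g y.
Proof. by move=> oU fg Ux; near=> y; apply: fg; near: y; exact: open_nbhs_nbhs.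
Unshelve. all: by end_near. Qed.

(** Formulas for derivatives hold only on [U]. As [U] is open, functions equal on [U] have equal
    directional derivatives there, so the inductions below may replace a derivative by its
    formula. *)
Lemma Ck_ext V W k (U : set V) (f g : V -> W) : open U ->
  (forall x, U x -> f x = g x) -> Ck k U f -> Ck k U g.
Proof.
move=> oU; elim: k f g => [|k IH] f g fg /=.
  move=> cf x Ux; rewrite /prop_for /continuous_at -(fg _ Ux).
  by apply: cvg_trans (cf x Ux); apply: near_eq_cvg; exact: open_near_eq fg Ux.
move=> [df Df]; split=> [x Ux|v].
  by apply: differentiable_near_eq (df x Ux); exact: open_near_eq fg Ux.
apply: IH (Df v) => x Ux; apply: near_eq_derive; exact: open_near_eq fg Ux.
Qed.

Lemma CkW V W k (U : set V) (f : V -> W) : Ck k.+1 U f -> Ck k U f.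
Proof.
elim: k f => [|k IH] f [df Df]; first by move=> x Ux; exact/differentiable_continuous/df.
by split=> // v; apply: IH; exact: Df.
Qed.

Lemma Ck_sub V W k (U U' : set V) (f : V -> W) : U' `<=` U ->
  Ck k U f -> Ck k U' f.
Proof.
move=> UU; elim: k f => [|k IH] f /=; first by move=> cf x /UU; exact: cf.
by move=> [df Df]; split=> [x /UU|v]; [exact: df|exact: IH].
Qed.

Lemma Ck_cst V W k (U : set V) (a : W) : Ck k U (fun _ => a).
Proof.
elim: k a => [|k IH] a /=; first by move=> x _; exact: cst_continuous.
split=> [x _|v]; first exact: differentiable_cst.
have -> : (fun x => 'D_v (fun=> a) x) = (fun=> 0) :> (V -> W).
  by apply/funext => x; rewrite derive_cst.
exact: IH.
Qed.

Lemma Ck_linear V W k (U : set V) (f : {linear V -> W}) : continuous f -> Ck k U f.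
Proof.
move=> cf; case: k => [|k] /=; first by move=> x _; exact: cf.
split=> [x _|v]; first exact: linear_differentiable.
have -> : (fun x => 'D_v f x) = (fun=> f v) :> (V -> W).
  apply/funext => x; rewrite deriveE ?diff_lin//; exact: linear_differentiable.
exact: Ck_cst.
Qed.

Lemma Ck_add V W k (U : set V) (f g : V -> W) : open U ->
  Ck k U f -> Ck k U g -> Ck k U (fun x => f x + g x).
Proof.
move=> oU; elim: k f g => [|k IH] f g /=.
  by move=> cf cg x Ux; apply: continuousD; [exact: cf|exact: cg].
move=> [df Df] [dg Dg]; split=> [x Ux|v].
  by apply: differentiableD; [exact: df|exact: dg].
apply: Ck_ext (IH _ _ (Df v) (Dg v)) => // x Ux.
by rewrite (deriveD (f:=f) (g:=g)); first done; 
  apply: diff_derivable; [exact: df|exact: dg].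
Qed.

(** Leibniz rule: the undifferentiated factors are used one order lower, whence [CkW]. *)
Lemma Ck_scale V W k (U : set V) (f : V -> R) (g : V -> W) : open U ->
  Ck k U f -> Ck k U g -> Ck k U (fun x => f x *: g x).
Proof.
move=> oU; elim: k f g => [|k IH] f g.
  by move=> cf cg x Ux; apply: continuousZ; [exact: cf|exact: cg].
move=> Cf Cg; have [df Df] := Cf; have [dg Dg] := Cg; split=> [x Ux|v].
  by have [] := is_diff_scale_fun (df x Ux) (dg x Ux).
apply: Ck_ext (Ck_add oU (IH _ _ (CkW Cf) (Dg v)) (IH _ _ (Df v) (CkW Cg))) => // x Ux.
have [d e] := is_diff_scale_fun (df x Ux) (dg x Ux).
by rewrite [RHS]deriveE// e !deriveE//; [exact: df|exact: dg].
Qed.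

Lemma Ck_comp_linear V W Z k (U : set V) (f : V -> W) (L : {linear W -> Z}) :
  continuous L -> open U -> Ck k U f -> Ck k U (L \o f).
Proof.
move=> cL oU; elim: k f => [|k IH] f.
  by move=> cf x Ux; apply: continuous_comp; [exact: cf|exact: cL].
move=> [df Df]; split=> [x Ux|v].
  by apply: differentiable_comp; [exact: df|exact: linear_differentiable].
apply: Ck_ext (IH _ (Df v)) => // x Ux.
have dL : differentiable L (f x) by exact: linear_differentiable.
have dfx := df x Ux.
rewrite /= !deriveE//; last exact: differentiable_comp.
by rewrite [in RHS]diff_comp//= diff_lin.
Qed.

(** The derivative -f^-2 Df contains 1/f again, but only to one order less, so the induction
    closes. *)
Lemma Ck_inv V k (U : set V) (f : V -> R) : open U ->
  (forall x, U x -> f x != 0) -> Ck k U f -> Ck k U (fun x => (f x)^-1).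
Proof.
move=> oU f0; elim: k => [|k IH].
  by move=> cf x Ux; apply: cvgV; [exact: f0|exact: (cf x Ux)].
move=> Cf; have [df Df] := Cf; split=> [x Ux|v].
  by apply: differentiableV; [exact: df|exact: f0].
have Cg := IH (CkW Cf).
apply: Ck_ext (Ck_scale oU (Ck_scale oU (Ck_cst k U (-1 : R)) (Ck_scale oU Cg Cg))
  (Df v)) => // x Ux.
rewrite (deriveV (f:=f)); [|exact: f0|apply: diff_derivable; exact: df].
by rewrite /GRing.scale /= mulN1r -invfM -expr2.
Qed.

(** Same bootstrap as for the inverse, with derivative Df / (2 sqrt f); positivity keeps away from
    the point where the root is not differentiable. *)
Lemma Ck_sqrt V k (U : set V) (f : V -> R) : open U ->
  (forall x, U x -> 0 < f x) -> Ck k U f -> Ck k U (fun x => Num.sqrt (f x)).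
Proof.
move=> oU f0; elim: k => [|k IH].
  move=> cf x Ux; apply: (continuous_comp (f:=f)); [exact: cf|exact: sqrt_continuous].
move=> Cf; have [df Df] := Cf.
have ds x : U x -> differentiable (@Num.sqrt R) (f x).
  by move=> Ux; apply/derivable1_diffP; have [] := is_derive1_sqrt (f0 _ Ux).
split=> [x Ux|v].
  by apply: (differentiable_comp (f:=f)); [exact: df|exact: ds].
have Cg := IH (CkW Cf).
have Cg' : Ck k U (fun x => (2 *: Num.sqrt (f x))^-1).
  apply: Ck_inv; [exact: oU| |apply: Ck_scale => //; exact: Ck_cst].
  by move=> x Ux; rewrite gt_eqF// mulr_gt0// sqrtr_gt0 f0.
apply: Ck_ext (Ck_scale oU Cg' (Df v)) => // x Ux.
rewrite [RHS]deriveE; last by apply: (differentiable_comp (f:=f)); [exact: df|exact: ds].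
rewrite (@diff_comp _ _ _ _ f _ _ (df _ Ux) (ds _ Ux))/=.
rewrite diff1E; last exact: ds.
rewrite derive1E (@derive_val _ _ _ _ _ _ _ (is_derive1_sqrt (f0 _ Ux))).
rewrite deriveE; last exact: df.
by rewrite /GRing.scale /= mulrC.
Qed.

Lemma Ck_sum V W k (U : set V) (I : Type) (r : seq I) (P : pred I)
    (f : I -> V -> W) : open U ->
  (forall i, P i -> Ck k U (f i)) -> Ck k U (fun x => \sum_(i <- r | P i) f i x).
Proof.
move=> oU Cf; elim: r => [|i r IH].
  by apply: Ck_ext (Ck_cst k U 0) => // x _; rewrite big_nil.
case Pi : (P i); last by apply: Ck_ext IH => // x _; rewrite big_cons Pi.
by apply: Ck_ext (Ck_add oU (Cf i Pi) IH) => // x _; rewrite big_cons Pi.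
Qed.

(** Only the reproducing formula with continuous coordinates is asked, which is the form in which
    the chain rule uses it. *)
Definition finite_dimensional V := exists (I : finType) (b : I -> V)
  (c : I -> {linear V -> R}), (forall i, continuous (c i)) /\
  forall x, x = \sum_i c i x *: b i.

(** [Ck] controls derivatives in fixed directions, whereas the chain rule differentiates [g] in the
    direction ['D_v f x], which moves with [x]. Expanding that direction along [b] leaves a finite
    sum of fixed directional derivatives of [g] with smooth coefficients. *)
Lemma Ck_comp V W Z k (U : set V) (U' : set W) (f : V -> W) (g : W -> Z) :
  finite_dimensional W -> open U -> (forall x, U x -> U' (f x)) ->
  Ck k U f -> Ck k U' g -> Ck k U (g \o f).
Proof.
move=> [I [b [c [cc bc]]]] oU UU'; elim: k Z g => [|k IH] Z g.
  move=> cf cg x Ux; apply: continuous_comp; first exact: cf.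
  exact/cg/UU'.
move=> Cf [dg Dg]; have [df Df] := Cf; split=> [x Ux|v].
  by apply: differentiable_comp; [exact: df|exact/dg/UU'].
have Cs : Ck k U (fun x => \sum_i c i ('D_v f x) *: ('D_(b i) g \o f) x).
  apply: Ck_sum => // i _; apply: Ck_scale => //.
    exact: Ck_comp_linear (cc i) oU (Df v).
  by apply: IH; [exact: CkW|exact: Dg].
apply: Ck_ext Cs => // x Ux.
have d1 := df x Ux; have d2 := dg _ (UU' _ Ux).
rewrite [RHS]deriveE; last exact: differentiable_comp d1 d2.
rewrite diff_comp//= -(deriveE v d1) [in RHS](bc ('D_v f x)) linear_sum.
by apply: eq_bigr => i _; rewrite linearZ /= (deriveE (b i) d2).
Qed.

End Calculus.

(** * Real coordinates on spaces of matrices *)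

Section MatrixCoordinates.
Context {R : realType}.

Definition mx_coord m n i j (A : 'M[R]_(m, n)) : R := A i j.

Lemma mx_coord_linear m n i j : linear (@mx_coord m n i j).
Proof. by move=> a A B; rewrite /mx_coord !mxE. Qed.

HB.instance Definition _ m n i j :=
  GRing.isLinear.Build R 'M[R]_(m, n) R *:%R (@mx_coord m n i j)
    (@mx_coord_linear m n i j).

Lemma mx_coord_continuous m n i j : continuous (@mx_coord m n i j).
Proof. exact: coord_continuous. Qed.

Definition pair_coord (t : bool * 'I_3 * 'I_3) (e : M3R R) : R :=
  if t.1.1 then e.1 t.1.2 t.2 else e.2 t.1.2 t.2.

Lemma pair_coord_linear t : linear (pair_coord t).
Proof.
by move: t => [[[] i] j] a A B; rewrite /pair_coord /= !mxE.
Qed.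

HB.instance Definition _ t :=
  GRing.isLinear.Build R (M3R R) R *:%R (pair_coord t) (@pair_coord_linear t).

Lemma pair_coord_continuous t : continuous (pair_coord t).
Proof.
move: t => [[[] i] j] e; rewrite /pair_coord /=.
  apply: (@continuous_comp _ _ _ fst (fun A : 'M[R]_3 => A i j)).
    exact: cvg_fst.
  exact: coord_continuous.
apply: (@continuous_comp _ _ _ snd (fun A : 'M[R]_3 => A i j)).
  exact: cvg_snd.
exact: coord_continuous.
Qed.

Definition pair_delta (t : bool * 'I_3 * 'I_3) : M3R R :=
  if t.1.1 then (delta_mx t.1.2 t.2, 0) else (0, delta_mx t.1.2 t.2).

Lemma pair_coord_delta s t : pair_coord s (pair_delta t) = (s == t)%:R.
Proof.
move: s t => [[b i] j] [[c k] l]; rewrite /pair_coord /pair_delta !xpair_eqE /=.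
by case: b; case: c; rewrite !mxE.
Qed.

Lemma pair_coord_inj (e f : M3R R) :
  (forall t, pair_coord t e = pair_coord t f) -> e = f.
Proof.
case: e f => [A B] [A' B'] h; congr pair; apply/matrixP => i j.
  exact: (h (true, i, j)).
exact: (h (false, i, j)).
Qed.

Lemma pair_coordE (e : M3R R) : e = \sum_t pair_coord t e *: pair_delta t.
Proof.
apply: pair_coord_inj => s; rewrite linear_sum /= (bigD1 s) //= big1 ?addr0.
  by rewrite linearZ /= pair_coord_delta eqxx /GRing.scale /= mulr1.
move=> t ts; rewrite linearZ /= pair_coord_delta eq_sym (negbTE ts).
by rewrite /GRing.scale /= mulr0.
Qed.

Lemma finite_dimensional_M3R : finite_dimensional (M3R R).
Proof.
exists (bool * 'I_3 * 'I_3)%type, pair_delta.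
exists (fun t => [the {linear M3R R -> R} of pair_coord t]).
by split=> [t|e]; [exact: pair_coord_continuous|exact: pair_coordE].
Qed.

End MatrixCoordinates.

(** * Smooth maps with complex and matrix values *)

Section ComplexSmooth.
Context {R : realType}.
Local Notation C := R[i].
Implicit Types V W : normedModType R.

(** Stated on real and imaginary parts because [Cinfty] takes targets normed over [R]. *)
Definition csmooth V (U : set V) (h : V -> C) : Prop :=
  Cinfty U (fun x => complex.Re (h x)) /\ Cinfty U (fun x => complex.Im (h x)).

Definition mxsmooth V (U : set V) m n (h : V -> 'M[C]_(m, n)) : Prop :=
  forall i j, csmooth U (fun x => h x i j).

Lemma ReM (x y : C) :
  complex.Re (x * y) = complex.Re x * complex.Re y - complex.Im x * complex.Im y.
Proof. by case: x => a b; case: y. Qed.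

Lemma ImM (x y : C) :
  complex.Im (x * y) = complex.Re x * complex.Im y + complex.Im x * complex.Re y.
Proof. by case: x => a b; case: y. Qed.

Lemma ReD (x y : C) : complex.Re (x + y) = complex.Re x + complex.Re y.
Proof. by case: x => a b; case: y. Qed.

Lemma ImD (x y : C) : complex.Im (x + y) = complex.Im x + complex.Im y.
Proof. by case: x => a b; case: y. Qed.

Lemma Re_conj (x : C) : complex.Re x^* = complex.Re x.
Proof. by case: x. Qed.

Lemma Im_conj (x : C) : complex.Im x^* = - complex.Im x.
Proof. by case: x. Qed.

Section Fixed.
Context {V : normedModType R} (U : set V) (oU : open U).

Lemma csmooth_ext (f g : V -> C) : (forall x, U x -> f x = g x) ->
  csmooth U f -> csmooth U g.
Proof.
move=> fg [h1 h2]; split=> k.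
  by apply: Ck_ext (h1 k) => // x Ux; rewrite fg.
by apply: Ck_ext (h2 k) => // x Ux; rewrite fg.
Qed.

Lemma csmooth_cst (c : C) : csmooth U (fun _ => c).
Proof. by split=> k; exact: Ck_cst. Qed.

Lemma csmoothD (f g : V -> C) : csmooth U f -> csmooth U g ->
  csmooth U (fun x => f x + g x).
Proof.
move=> [f1 f2] [g1 g2]; split=> k.
  by apply: Ck_ext (Ck_add oU (f1 k) (g1 k)) => // x _; rewrite ReD.
by apply: Ck_ext (Ck_add oU (f2 k) (g2 k)) => // x _; rewrite ImD.
Qed.

Lemma csmooth_real (f : V -> R) : Cinfty U f -> csmooth U (fun x => (f x)%:C%C).
Proof. by move=> h; split=> k; [exact: h|exact: Ck_cst]. Qed.

Lemma csmoothM (f g : V -> C) : csmooth U f -> csmooth U g ->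
  csmooth U (fun x => f x * g x).
Proof.
move=> [f1 f2] [g1 g2]; split=> k.
  have h := Ck_scale oU (Ck_scale oU (Ck_cst k U (-1 : R)) (f2 k)) (g2 k).
  apply: Ck_ext (Ck_add oU (Ck_scale oU (f1 k) (g1 k)) h) => // x _.
  by rewrite ReM /GRing.scale /= mulN1r mulNr.
by apply: Ck_ext (Ck_add oU (Ck_scale oU (f1 k) (g2 k))
  (Ck_scale oU (f2 k) (g1 k))) => // x _; rewrite ImM.
Qed.

Lemma csmoothN (f : V -> C) : csmooth U f -> csmooth U (fun x => - f x).
Proof.
move=> h; apply: csmooth_ext (csmoothM (csmooth_cst (-1)) h) => x _.
by rewrite mulN1r.
Qed.

Lemma csmoothB (f g : V -> C) : csmooth U f -> csmooth U g ->
  csmooth U (fun x => f x - g x).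
Proof. by move=> hf hg; apply: csmoothD => //; exact: csmoothN. Qed.

Lemma csmooth_conj (f : V -> C) : csmooth U f -> csmooth U (fun x => (f x)^*).
Proof.
move=> [f1 f2]; split=> k.
  by apply: Ck_ext (f1 k) => // x _; rewrite Re_conj.
apply: Ck_ext (Ck_scale oU (Ck_cst k U (-1 : R)) (f2 k)) => // x _.
by rewrite Im_conj /GRing.scale /= mulN1r.
Qed.

Lemma Cinfty_normsq (f : V -> C) : csmooth U f ->
  Cinfty U (fun x => complex.Re (f x) ^+ 2 + complex.Im (f x) ^+ 2).
Proof.
move=> [f1 f2] k.
apply: Ck_ext (Ck_add oU (Ck_scale oU (f1 k) (f1 k)) (Ck_scale oU (f2 k) (f2 k))) => //.
Qed.

(** The inverse is conj(f) / |f|^2, whose denominator is a nonvanishing real function. *)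
Lemma csmoothV (f : V -> C) : (forall x, U x -> f x != 0) ->
  csmooth U f -> csmooth U (fun x => (f x)^-1).
Proof.
move=> f0 hf.
have n0 x : U x -> complex.Re (f x) ^+ 2 + complex.Im (f x) ^+ 2 != 0.
  move=> Ux; have := f0 x Ux; case: (f x) => a b /=.
  apply: contra; rewrite paddr_eq0 ?sqr_ge0// !sqrf_eq0 => /andP[/eqP -> /eqP ->].
  exact: eqxx.
have hinv : Cinfty U (fun x => (complex.Re (f x) ^+ 2 + complex.Im (f x) ^+ 2)^-1).
  by move=> k; apply: Ck_inv => //; exact: Cinfty_normsq.
apply: csmooth_ext (csmoothM (csmooth_conj hf) (csmooth_real hinv)) => x Ux.
have := n0 x Ux; have := f0 x Ux; case: (f x) => a b /= ab0 n.
apply: (mulfI ab0); rewrite divff// /=.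
apply/eqP; rewrite eq_complex /=; apply/andP; split; apply/eqP; first by field.
by field.
Qed.

Lemma csmooth_sum (I : Type) (r : seq I) (P : pred I) (f : I -> V -> C) :
  (forall i, P i -> csmooth U (f i)) -> csmooth U (fun x => \sum_(i <- r | P i) f i x).
Proof.
move=> Cf; elim: r => [|i r IH].
  by apply: csmooth_ext (csmooth_cst 0) => // x _; rewrite big_nil.
case Pi : (P i); last by apply: csmooth_ext IH => // x _; rewrite big_cons Pi.
by apply: csmooth_ext (csmoothD (Cf i Pi) IH) => // x _; rewrite big_cons Pi.
Qed.

Lemma csmooth_prod (I : Type) (r : seq I) (P : pred I) (f : I -> V -> C) :
  (forall i, P i -> csmooth U (f i)) -> csmooth U (fun x => \prod_(i <- r | P i) f i x).
Proof.
move=> Cf; elim: r => [|i r IH].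
  by apply: csmooth_ext (csmooth_cst 1) => // x _; rewrite big_nil.
case Pi : (P i); last by apply: csmooth_ext IH => // x _; rewrite big_cons Pi.
by apply: csmooth_ext (csmoothM (Cf i Pi) IH) => // x _; rewrite big_cons Pi.
Qed.

Lemma mxsmooth_ext m n (f g : V -> 'M[C]_(m, n)) : (forall x, U x -> f x = g x) ->
  mxsmooth U f -> mxsmooth U g.
Proof. by move=> fg h i j; apply: csmooth_ext (h i j) => x /fg ->. Qed.

Lemma mxsmooth_cst m n (A : 'M[C]_(m, n)) : mxsmooth U (fun _ => A).
Proof. by move=> i j; exact: csmooth_cst. Qed.

Lemma mxsmoothM m n p (f : V -> 'M[C]_(m, n)) (g : V -> 'M[C]_(n, p)) :
  mxsmooth U f -> mxsmooth U g -> mxsmooth U (fun x => f x *m g x).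
Proof.
move=> hf hg i j.
apply: (@csmooth_ext (fun x => \sum_k f x i k * g x k j)) => [x _|].
  by rewrite !mxE.
by apply: csmooth_sum => k _; exact: csmoothM.
Qed.

Lemma mxsmoothD m n (f g : V -> 'M[C]_(m, n)) :
  mxsmooth U f -> mxsmooth U g -> mxsmooth U (fun x => f x + g x).
Proof.
move=> hf hg i j; apply: csmooth_ext (csmoothD (hf i j) (hg i j)) => x _.
by rewrite !mxE.
Qed.

Lemma mxsmoothZ m n (a : V -> C) (f : V -> 'M[C]_(m, n)) :
  csmooth U a -> mxsmooth U f -> mxsmooth U (fun x => a x *: f x).
Proof.
move=> ha hf i j; apply: csmooth_ext (csmoothM ha (hf i j)) => x _.
by rewrite !mxE.
Qed.

Lemma mxsmooth_tr m n (f : V -> 'M[C]_(m, n)) :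
  mxsmooth U f -> mxsmooth U (fun x => (f x)^T).
Proof. by move=> hf i j; apply: csmooth_ext (hf j i) => x _; rewrite !mxE. Qed.

Lemma mxsmooth_conj m n (f : V -> 'M[C]_(m, n)) :
  mxsmooth U f -> mxsmooth U (fun x => map_mx Num.conj (f x)).
Proof.
by move=> hf i j; apply: csmooth_ext (csmooth_conj (hf i j)) => x _; rewrite !mxE.
Qed.

Lemma csmooth_det n (f : V -> 'M[C]_n) : mxsmooth U f ->
  csmooth U (fun x => \det (f x)).
Proof.
move=> hf; apply: csmooth_sum => s _; apply: csmoothM; first exact: csmooth_cst.
by apply: csmooth_prod => i _; exact: hf.
Qed.

Lemma mxsmooth_adj n (f : V -> 'M[C]_n) : mxsmooth U f ->
  mxsmooth U (fun x => \adj (f x)).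
Proof.
move=> hf i j; apply: (@csmooth_ext (fun x => cofactor (f x) j i)) => [x _|].
  by rewrite mxE.
apply: csmoothM; first exact: csmooth_cst.
apply: csmooth_det => k l; apply: csmooth_ext (hf (lift j k) (lift i l)) => x _.
by rewrite !mxE.
Qed.

Lemma mxsmoothV n (f : V -> 'M[C]_n) : (forall x, U x -> f x \in unitmx) ->
  mxsmooth U f -> mxsmooth U (fun x => invmx (f x)).
Proof.
move=> fu hf.
apply: (@mxsmooth_ext _ _ (fun x => (\det (f x))^-1 *: \adj (f x))) => [x Ux|].
  by rewrite /invmx fu.
apply: mxsmoothZ; last exact: mxsmooth_adj.
by apply: csmoothV (csmooth_det hf) => x /fu; rewrite unitmxE unitfE.
Qed.

Lemma Cinfty_realify (f : V -> 'M[C]_3) : mxsmooth U f ->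
  Cinfty U (@realify R \o f).
Proof.
move=> hf k.
apply: (@Ck_ext _ _ _ _ _ (fun x => \sum_t pair_coord t (realify (f x)) *: pair_delta t)) => //.
  by move=> x _; rewrite /= -pair_coordE.
apply: Ck_sum => // -[[b i] j] _; apply: Ck_scale => //; last exact: Ck_cst.
have [h1 h2] := hf i j; case: b; rewrite /pair_coord /=.
  by apply: Ck_ext (h1 k) => // x _; rewrite mxE.
by apply: Ck_ext (h2 k) => // x _; rewrite mxE.
Qed.

Lemma Cinfty_rV n (f : V -> 'rV[R]_n) : (forall i, Cinfty U (fun x => f x 0 i)) ->
  Cinfty U f.
Proof.
move=> hf k.
apply: (@Ck_ext _ _ _ _ _ (fun x => \sum_i f x 0 i *: delta_mx 0 i)) => //.
  by move=> x _; rewrite /= [RHS]row_sum_delta.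
by apply: Ck_sum => // i _; apply: Ck_scale; [|exact: hf|exact: Ck_cst].
Qed.

End Fixed.

Lemma csmooth_sub V (U U' : set V) (f : V -> C) : U' `<=` U ->
  csmooth U f -> csmooth U' f.
Proof. by move=> UU [h1 h2]; split=> k; [exact: Ck_sub UU (h1 k)|exact: Ck_sub UU (h2 k)]. Qed.

Lemma mxsmooth_sub V (U U' : set V) m n (f : V -> 'M[C]_(m, n)) : U' `<=` U ->
  mxsmooth U f -> mxsmooth U' f.
Proof. by move=> UU h i j; exact: csmooth_sub (h i j). Qed.

Lemma mxsmooth_complexify (U : set (M3R R)) : mxsmooth U (@complexify R).
Proof.
move=> i j; split=> k.
  have := @Ck_linear R _ _ k U (@pair_coord R (true, i, j)) (@pair_coord_continuous R _).
  by congr (Ck _ _ _); apply/funext => x; rewrite mxE.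
have := @Ck_linear R _ _ k U (@pair_coord R (false, i, j)) (@pair_coord_continuous R _).
by congr (Ck _ _ _); apply/funext => x; rewrite mxE.
Qed.

Lemma complexifyK : cancel (@complexify R) (@realify R).
Proof.
by move=> [A B]; congr pair; apply/matrixP => i j; rewrite !mxE.
Qed.

Lemma realifyK : cancel (@realify R) (@complexify R).
Proof. by move=> A; apply/matrixP => i j; rewrite !mxE; case: (A i j). Qed.

Lemma Cinfty_coord n (U : set 'rV[R]_n) i : Cinfty U (fun x : 'rV[R]_n => x 0 i).
Proof. by move=> k; exact: (Ck_linear _ _ (@mx_coord_continuous R 1 n 0 i)). Qed.

Lemma Cinfty_id V (U : set V) : Cinfty U (fun x : V => x).
Proof. by move=> k; apply: (@Ck_linear _ _ _ k U idfun) => x; exact: cvg_id. Qed.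

Lemma Cinfty_continuous V W (U : set V) (f : V -> W) x : Cinfty U f -> U x ->
  {for x, continuous f}.
Proof. by move=> /(_ 0%N); apply. Qed.

(** The set has the shape [U x /\ condition] so that such conditions can be stacked; this is why
    later domains start with a trivial [setT] clause. *)
Lemma open_Cinfty_gt0 V (U : set V) (f : V -> R) : open U -> Cinfty U f ->
  open [set x | U x /\ 0 < f x].
Proof.
move=> oU cf; rewrite openE => x [Ux fx] /=.
have h := Cinfty_continuous cf Ux.
near=> y; split; first by near: y; exact: open_nbhs_nbhs.
near: y; have : nbhs (f x) [set z | 0 < z].
  by apply: open_nbhs_nbhs; split => //; exact: open_gt.
exact: h.
Unshelve. all: by end_near. Qed.

Lemma open_csmooth_neq0 V (U : set V) (f : V -> C) : open U -> csmooth U f ->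
  open [set x | U x /\ f x != 0].
Proof.
move=> oU cf; have := open_Cinfty_gt0 oU (Cinfty_normsq oU cf).
congr open; apply/seteqP; split => x [Ux h]; split => //.
  apply: contraTneq h => ->; rewrite /= !expr0n/= addr0 ltxx//.
rewrite lt0r addr_ge0 ?sqr_ge0// andbT.
move: h; case: (f x) => a b /=; apply: contra.
by rewrite paddr_eq0 ?sqr_ge0// !sqrf_eq0 => /andP[/eqP -> /eqP ->].
Qed.

Lemma open_mxsmooth_unit V (U : set V) n (f : V -> 'M[C]_n) : open U ->
  mxsmooth U f -> open [set x | U x /\ f x \in unitmx].
Proof.
move=> oU cf; have := open_csmooth_neq0 oU (csmooth_det oU cf).
by congr open; apply/seteqP; split => x [Ux]; rewrite /= ?unitmxE unitfE.
Qed.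

End ComplexSmooth.

(** * Homogeneous spaces of SU_3 *)

Section SpecialUnitary.
Context {R : realType}.
Local Notation C := R[i].
Implicit Types g h : 'M[C]_3.

Lemma SU3_1 : SU3 (1%:M : 'M[C]_3).
Proof. by split; [apply/unitarymxP; rewrite trmx1 map_mx1 mulmx1|exact: det1]. Qed.

Lemma SU3_mul g h : SU3 g -> SU3 h -> SU3 (g *m h).
Proof.
move=> [g1 g2] [h1 h2]; split; first exact: mul_unitarymx.
by rewrite det_mulmx g2 h2 mulr1.
Qed.

Lemma SU3_unit g : SU3 g -> g \in unitmx.
Proof. by move=> [/unitarymx_unit]. Qed.

Lemma SU3_invE g : SU3 g -> invmx g = g^t*.
Proof. by move=> [/invmx_unitary]. Qed.

Lemma SU3_inv g : SU3 g -> SU3 (invmx g).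
Proof.
move=> gU; split; last by rewrite det_inv gU.2 invr1.
by rewrite (SU3_invE gU) trmxC_unitary; case: gU.
Qed.

Lemma SU3P g : SU3 g <-> g *m g^t* = 1%:M /\ \det g = 1.
Proof. by split=> -[/unitarymxP h1 h2]; split => //; apply/unitarymxP. Qed.

End SpecialUnitary.

Section Homogeneous.
Context {R : realType}.
Local Notation C := R[i].
Local Notation carr X := (@carrier R X).
Implicit Types (X Y : SU3_space R) (S T : smooth_space R).

(** [F] lifts the orbit map to parameters. It is smooth on the whole matrix space, since all orbit
    maps here are polynomial in the entries and their conjugates, but it is tied to the action only
    on [SU3]. *)
Definition smooth_orbit X (x0 : pt (base_space X)) : Prop :=
  exists F : M3R R -> model (base_space X), Cinfty setT F /\
    forall g, SU3 g -> dom (base_space X) (F (realify g)) /\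
      par (base_space X) (F (realify g)) = act g x0.

(** The section is a function of the parameter, not of the point: two parameters of one point may
    give different group elements. *)
Definition smooth_sections X (x0 : pt (base_space X)) : Prop :=
  forall e, dom (base_space X) e -> carr X (par (base_space X) e) ->
  exists U : set (model (base_space X)), exists G : model (base_space X) -> M3R R,
    [/\ open U, U e, Cinfty U G & forall e', U e' -> dom (base_space X) e' ->
      carr X (par (base_space X) e') ->
      SU3 (complexify (G e')) /\ act (complexify (G e')) x0 = par (base_space X) e'].

(* The data of the principal bundle SU_3 -> X, g |-> g.x0. *)
Record homogeneous X (x0 : pt (base_space X)) : Prop := Homogeneous {
  hom_carrier : forall x, carr X x <-> exists2 g, SU3 g & x = act g x0;
  hom_mul : forall g h, SU3 g -> SU3 h -> act g (act h x0) = act (g *m h) x0;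
  hom_one : act 1%:M x0 = x0;
  hom_orbit : smooth_orbit x0;
  hom_sections : smooth_sections x0 }.

Lemma hom_orbit_carrier X x0 g : @homogeneous X x0 -> SU3 g -> carr X (act g x0).
Proof. by move=> hX gU; apply/(hom_carrier hX); exists g. Qed.

(** The two orbit maps have the same fibres, so g.x0 |-> g.y0 is well defined and injective. *)
Definition same_isotropy X Y (x0 : pt (base_space X)) (y0 : pt (base_space Y)) :=
  forall g h, SU3 g -> SU3 h -> (act g x0 = act h x0 <-> act g y0 = act h y0).

Lemma stabilizer_act X x0 g h : @homogeneous X x0 -> SU3 g -> SU3 h ->
  act g x0 = act h x0 <-> stabilizer x0 (invmx h *m g).
Proof.
move=> hX gU hU; have hiU := SU3_inv hU.
have h1 : SU3 (invmx h *m g) by exact: SU3_mul.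
split=> [e|[_ e]].
  by split => //; rewrite -(hom_mul hX)// e (hom_mul hX)// mulVmx ?SU3_unit// (hom_one hX).
by rewrite -[in RHS]e (hom_mul hX)// mulKVmx// SU3_unit.
Qed.

Lemma same_isotropy_stabilizer X Y x0 y0 : @homogeneous X x0 -> @homogeneous Y y0 ->
  stabilizer x0 = stabilizer y0 -> same_isotropy x0 y0.
Proof.
move=> hX hY e g h gU hU.
by rewrite (stabilizer_act hX)// (stabilizer_act hY)// e.
Qed.

(** A lift of [f] is the composite of a local section of [X], left multiplication by [c], and the
    lifted orbit map of [Y]. *)
Lemma smooth_of_equivariant X Y x0 y0 (c : 'M[C]_3)
    (f : pt (base_space X) -> pt (base_space Y)) :
  @homogeneous X x0 -> @homogeneous Y y0 -> SU3 c ->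
  (forall g, SU3 g -> f (act g x0) = act (c *m g) y0) ->
  smooth_map (carr X) f.
Proof.
move=> hX hY cU fE e de ce.
have [U [G [oU Ue sG GP]]] := hom_sections hX de ce.
have [F [sF FP]] := hom_orbit hY.
pose L (m : M3R R) := realify (c *m complexify m).
have sL : Cinfty setT L.
  apply: (Cinfty_realify openT (f:=fun m => c *m complexify m)).
  by apply: mxsmoothM; [exact: openT|exact: mxsmooth_cst|exact: mxsmooth_complexify].
exists U, (F \o (L \o G)); split => //.
  move=> k; apply: (@Ck_comp _ _ _ _ k U setT) => //.
    exact: finite_dimensional_M3R.
  by apply: (@Ck_comp _ _ _ _ k U setT) => //; exact: finite_dimensional_M3R.
move=> e' Ue' de' ce'; have [gU gE] := GP e' Ue' de' ce'.
rewrite -gE fE// /L /=; apply: FP; exact: SU3_mul.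
Qed.

(** The value at a point uses any [g] carrying [x0] to it, and equal isotropy makes the choice
    harmless. The twist [c] sends [x0] to c.y0, an arbitrary point of [Y]; this is what later moves
    a chart away from the base point. *)
Lemma homogeneous_map X Y x0 y0 (c : 'M[C]_3) :
  @homogeneous X x0 -> @homogeneous Y y0 -> SU3 c -> same_isotropy x0 y0 ->
  exists f : pt (base_space X) -> pt (base_space Y),
    forall g, SU3 g -> f (act g x0) = act (c *m g) y0.
Proof.
move=> hX hY cU iso.
exists (fun x => act (c *m xget 1%:M [set g | SU3 g /\ x = act g x0]) y0).
move=> g gU; case: xgetP => [h _ [hU hE]|/(_ g)]; last by case.
by rewrite -!(hom_mul hY)//; congr act; apply/iso.
Qed.

Lemma homogeneous_diffeo X Y x0 y0 (c : 'M[C]_3) :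
  @homogeneous X x0 -> @homogeneous Y y0 -> SU3 c -> same_isotropy x0 y0 ->
  exists f : pt (base_space X) -> pt (base_space Y),
    diffeomorphism (carr X) (carr Y) f /\
    forall g, SU3 g -> f (act g x0) = act (c *m g) y0.
Proof.
move=> hX hY cU iso; have [f fE] := homogeneous_map hX hY cU iso.
have isoV : same_isotropy y0 x0 by move=> g h gU hU; apply: iff_sym; exact: iso.
have ciU := SU3_inv cU.
have [k kE] := homogeneous_map hY hX ciU isoV.
have fK x : carr X x -> k (f x) = x.
  move=> /(hom_carrier hX)[g gU ->]; rewrite fE// kE ?mulKmx ?SU3_unit//.
  exact: SU3_mul.
have kK y : carr Y y -> f (k y) = y.
  move=> /(hom_carrier hY)[g gU ->]; rewrite kE// fE ?mulKVmx ?SU3_unit//.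
  exact: SU3_mul.
have fC x : carr X x -> carr Y (f x).
  move=> /(hom_carrier hX)[g gU ->]; rewrite fE//.
  by apply: hom_orbit_carrier => //; exact: SU3_mul.
have kC y : carr Y y -> carr X (k y).
  move=> /(hom_carrier hY)[g gU ->]; rewrite kE//.
  by apply: hom_orbit_carrier => //; exact: SU3_mul.
exists f; split => //; split.
- split => [x|x y|y].
  + exact: fC.
  + by move=> /set_mem cx /set_mem cy e; rewrite -(fK x)// e fK.
  + by move=> cy; exists (k y); [exact: kC|exact: kK].
- exact: smooth_of_equivariant hX hY cU fE.
- by exists k; split => //; exact: smooth_of_equivariant hY hX ciU kE.
Qed.

(** The choice c = 1 makes the map commute with the actions and sends base point to base point. *)
Lemma homogeneous_equivariant_diffeo X Y x0 y0 :
  @homogeneous X x0 -> @homogeneous Y y0 -> stabilizer x0 = stabilizer y0 ->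
  exists f, @equivariant_diffeo R X Y f /\ f x0 = y0.
Proof.
move=> hX hY e; have iso := same_isotropy_stabilizer hX hY e.
have [f [df fE]] := homogeneous_diffeo hX hY SU3_1 iso.
exists f; split; last by rewrite -{1}(hom_one hX) fE ?mul1mx ?(hom_one hY)//; exact: SU3_1.
split => // g x gU /(hom_carrier hX)[h hU ->].
rewrite (hom_mul hX)// !fE//; last exact: SU3_mul.
by rewrite !mul1mx (hom_mul hY).
Qed.

Lemma lcoset_mul (K : set 'M[C]_3) g h :
  [set g *m s | s in lcoset K h] = lcoset K (g *m h).
Proof.
apply/seteqP; split=> [_ [_ [k Kk <-] <-]|_ [k Kk <-]].
  by exists k => //; rewrite mulmxA.
by exists (h *m k); [exists k|rewrite mulmxA].
Qed.

Lemma lcoset1 (K : set 'M[C]_3) : lcoset K 1%:M = K.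
Proof.
apply/seteqP; split=> [_ [k Kk <-]|k Kk]; first by rewrite mul1mx.
by exists k => //; rewrite mul1mx.
Qed.

(** Cosets are parametrized by group elements, so the identity is both the lifted orbit map and a
    global section. *)
Lemma homogeneous_SU3_mod (K : set 'M[C]_3) : @homogeneous (SU3_mod K) K.
Proof.
have actE g : [set g *m s | s in K] = lcoset K g by [].
split => /=.
- move=> S; split=> [[g gU <-]|[g gU ->]]; first by exists g.
  by exists g.
- move=> g h gU hU; exact: lcoset_mul.
- exact: lcoset1.
- exists id; split=> [|g gU]; last by rewrite /= realifyK.
  exact: Cinfty_id.
- move=> e eU eC; exists setT, id; split => //; first exact: openT.
  exact: Cinfty_id.
Qed.

Lemma stabilizer_SU3_mod (K : set 'M[C]_3) : closed_subgroup K ->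
  @stabilizer _ (SU3_mod K) K = K.
Proof.
move=> [KU K1 KM KV _]; apply/seteqP; split=> g /=.
  move=> [gU gK]; have : @act _ (SU3_mod K) g K (g *m 1%:M) by exists 1%:M.
  by rewrite gK mulmx1.
move=> Kg; split; first exact: KU.
apply/seteqP; split=> [_ [k Kk <-]|k Kk]; first exact: KM.
exists (invmx g *m k); first by apply: KM => //; exact: KV.
by rewrite mulKVmx// SU3_unit//; exact: KU.
Qed.

Lemma stabilizer_subgroup X x0 : @homogeneous X x0 ->
  closed (@realify R @` stabilizer x0) -> closed_subgroup (stabilizer x0).
Proof.
move=> hX cK; split => //.
- by move=> g [].
- by split; [exact: SU3_1|exact: hom_one].
- move=> g h [gU gE] [hU hE]; split; first exact: SU3_mul.
  by rewrite -(hom_mul hX)// hE.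
- move=> g [gU gE]; have giU := SU3_inv gU; split => //.
  by rewrite -{1}gE (hom_mul hX)// mulVmx ?SU3_unit// (hom_one hX).
Qed.

Lemma homogeneous_represented X x0 (K : set 'M[C]_3) : @homogeneous X x0 ->
  stabilizer x0 = K -> closed (@realify R @` K) -> represented_as X K.
Proof.
move=> hX eK cK; have sK : closed_subgroup K.
  by rewrite -eK; apply: stabilizer_subgroup => //; rewrite eK.
split => //.
have [f [fd f0]] := homogeneous_equivariant_diffeo (homogeneous_SU3_mod K) hX
  (etrans (stabilizer_SU3_mod sK) (esym eK)).
by exists f; split => //; rewrite f0.
Qed.

(** The condition of [manifold_of_dim] at a single point, so that it can be proved at one point and
    transported. *)
Definition chart_at S (X : set (pt S)) (x : pt S) n : Prop :=
  exists O : set (pt S), exists V : set 'rV[R]_n, exists phi : 'rV[R]_n -> pt S,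
    [/\ O x, open_in X O, open V & @diffeomorphism _ (euclidean n) S V O phi].

(** The chart phi becomes f o phi, with inverse psi o k for [k] the inverse of [f]. Both are lifted
    by composing local lifts through the model of [S], where the chain rule asks for finite
    dimension. *)
Lemma chart_at_diffeo S T (X : set (pt S)) (Y : set (pt T)) f x n :
  finite_dimensional (model S) -> diffeomorphism X Y f -> X x ->
  chart_at X x n -> chart_at Y (f x) n.
Proof.
move=> fS [ [fXY fI fSj] sf [k [kf sk] ] ] Xx [ O [V [phi [Ox OW oV] ] ] ].
have [OX' [W [oW WP] ] ] := OW.
have OX z : O z -> X z by exact: OX'.
move=> [ [phiV phiI phiS] sphi [psi [psiK spsi] ] ].
have fk y : Y y -> f (k y) = y by move=> /fSj [z Xz <-]; rewrite kf.
have kX y : Y y -> X (k y) by move=> /fSj [z Xz <-]; rewrite kf.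
have OYk y : Y y -> ((f @` O) y <-> O (k y)).
  move=> Yy; split=> [[z Oz <-]|Oy]; first by rewrite (kf _ (OX _ Oz)).
  by exists (k y) => //; exact: fk.
exists (f @` O), V, (f \o phi); split => //.
- split=> [_ [z Oz <-]|]; first exact: fXY (OX _ Oz).
  (* Openness of the image is witnessed by the union of all open parameter sets landing in it;
     around a given parameter, the preimage of [W] under a local lift of the inverse of [f] is such
     a set. *)
  pose good (U : set (model T)) := open U /\
    forall e, U e -> dom T e -> Y (par T e) -> O (k (par T e)).
  exists (\bigcup_(U in good) U); split; first by apply: bigcup_open => U [].
  move=> e de Ye; rewrite OYk//; split; last by move=> [U [oU UP] Ue]; exact: UP.
  move=> Oke; have [U [F [oU Ue sF FP]]] := sk e de Ye.
  exists (U `&` F @^-1` W); last first.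
    by split => //=; have [dF pF] := FP e Ue de Ye; apply/WP => //; rewrite pF//; exact: kX.
  split.
    rewrite openE => z [Uz Wz]; apply: filterI; first exact: open_nbhs_nbhs.
    by apply: (Cinfty_continuous sF Uz); exact: open_nbhs_nbhs.
  move=> e' [Ue' We'] de' Ye'; have [dF pF] := FP e' Ue' de' Ye'.
  rewrite -pF; apply/WP => //; rewrite pF; exact: kX.
- split; first split.
  + by move=> v Vv; exists (phi v) => //; exact: phiV.
  + move=> v w /set_mem Vv /set_mem Vw /= e; apply: phiI; rewrite ?inE//.
    by rewrite -(kf (phi v)) ?e ?kf//; apply: OX; exact: phiV.
  + by move=> _ [z Oz <-]; have [v Vv <-] := phiS z Oz; exists v.
  + move=> v dv Vv; have [U [F [oU Uv sF FP]]] := sphi v dv Vv.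
    have Xp w : V w -> X (phi w) by move=> Vw; apply: OX; exact: phiV.
    have [dF pF] := FP v Uv dv Vv.
    have [|U' [F' [oU' Uv' sF' FP']]] := sf (F v) dF; first by rewrite pF; exact: Xp.
    have oI : open (U `&` F @^-1` U').
      rewrite openE => z [Uz Wz]; apply: filterI; first exact: open_nbhs_nbhs.
      by apply: (Cinfty_continuous sF Uz); exact: open_nbhs_nbhs.
    exists (U `&` F @^-1` U'), (F' \o F); split => //.
      move=> m; apply: (@Ck_comp _ _ _ _ m _ U') => //; first by move=> z [].
      by apply: Ck_sub (sF m) => z [].
    move=> w [Uw Uw'] dw Vw; have [dFw pFw] := FP w Uw dw Vw.
    have [|dF'w pF'w] := FP' (F w) Uw' dFw; first by rewrite pFw; exact: Xp.
    by split => //; rewrite /= pF'w pFw.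
  + exists (psi \o k); split=> [v Vv|e de [z Oz ze]].
      by rewrite /= kf ?psiK//; apply: OX; exact: phiV.
    have Ye : Y (par T e) by rewrite -ze; apply: fXY; exact: OX.
    have [U [F [oU Ue sF FP]]] := sk e de Ye.
    have [dF pF] := FP e Ue de Ye.
    have [|U' [F' [oU' Uv' sF' FP']]] := spsi (F e) dF.
      by rewrite pF -ze kf//; exact: OX.
    have oI : open (U `&` F @^-1` U').
      rewrite openE => w [Uz Wz]; apply: filterI; first exact: open_nbhs_nbhs.
      by apply: (Cinfty_continuous sF Uz); exact: open_nbhs_nbhs.
    exists (U `&` F @^-1` U'), (F' \o F); split => //.
      move=> m; apply: (@Ck_comp _ _ _ _ m _ U') => //; first by move=> w [].
      by apply: Ck_sub (sF m) => w [].
    move=> e' [Ue' We'] de' [z' Oz' ze'].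
    have Ye' : Y (par T e') by rewrite -ze'; apply: fXY; exact: OX.
    have [dFw pFw] := FP e' Ue' de' Ye'.
    have [|dF'w pF'w] := FP' (F e') We' dFw.
      by rewrite pFw -ze' kf//; exact: OX.
    by split => //; exact: etrans pF'w (congr1 psi pFw).
Qed.

(** A point c.y0 of [Y] is the image of [x0] under the diffeomorphism twisted by [c], so the single
    chart at [x0] reaches all points of [Y]. *)
Lemma homogeneous_has_dim X Y x0 y0 n :
  finite_dimensional (model (base_space X)) ->
  @homogeneous X x0 -> @homogeneous Y y0 -> stabilizer x0 = stabilizer y0 ->
  chart_at (carr X) x0 n -> has_dim Y n.
Proof.
move=> fX hX hY e ch y /(hom_carrier hY)[c cU ->].
have [f [df fE]] := homogeneous_diffeo hX hY cU (same_isotropy_stabilizer hX hY e).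
have f0 : f x0 = act c y0.
  by rewrite -{1}(hom_one hX) fE ?mulmx1//; exact: SU3_1.
rewrite -f0; apply: chart_at_diffeo fX df _ ch.
by rewrite -(hom_one hX); apply: hom_orbit_carrier => //; exact: SU3_1.
Qed.

End Homogeneous.

(** * Orthonormalization of frames *)

Section ThreeByThree.

Lemma ord3P (P : 'I_3 -> Prop) : P 0 -> P 1 -> P 2%:R -> forall i, P i.
Proof.
move=> h0 h1 h2 [[|[|[|//]]] hi].
- by have -> : Ordinal hi = 0 by exact: val_inj.
- by have -> : Ordinal hi = 1 by exact: val_inj.
- by have -> : Ordinal hi = 2%:R by exact: val_inj.
Qed.

Lemma matrix3P (T : Type) (A B : 'M[T]_3) :
  A 0 0 = B 0 0 -> A 0 1 = B 0 1 -> A 0 2%:R = B 0 2%:R ->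
  A 1 0 = B 1 0 -> A 1 1 = B 1 1 -> A 1 2%:R = B 1 2%:R ->
  A 2%:R 0 = B 2%:R 0 -> A 2%:R 1 = B 2%:R 1 -> A 2%:R 2%:R = B 2%:R 2%:R -> A = B.
Proof.
by move=> *; apply/matrixP; apply: ord3P; apply: ord3P.
Qed.

Lemma sum3E (V : nmodType) (F : 'I_3 -> V) : \sum_i F i = F 0 + F 1 + F 2%:R.
Proof.
rewrite !big_ord_recl big_ord0 addr0 addrA.
by congr (F _ + F _ + F _); exact: val_inj.
Qed.

Lemma mulmx3E (K : pzSemiRingType) m n (A : 'M[K]_(m, 3)) (B : 'M[K]_(3, n)) i j :
  (A *m B) i j = A i 0 * B 0 j + A i 1 * B 1 j + A i 2%:R * B 2%:R j.
Proof. by rewrite mxE sum3E. Qed.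

Lemma det3E (K : comPzRingType) (A : 'M[K]_3) :
  \det A = A 0 0 * (A 1 1 * A 2%:R 2%:R - A 1 2%:R * A 2%:R 1)
         - A 0 1 * (A 1 0 * A 2%:R 2%:R - A 1 2%:R * A 2%:R 0)
         + A 0 2%:R * (A 1 0 * A 2%:R 1 - A 1 1 * A 2%:R 0).
Proof.
pose M2 (B : 'M[K]_2) := B 0 0 * B 1 1 - B 0 1 * B 1 0.
have det2 (B : 'M[K]_2) : \det B = M2 B.
  rewrite (expand_det_row _ 0) !big_ord_recl big_ord0 addr0 /cofactor !det_mx11 !mxE.
  rewrite /= expr0 expr1 mul1r mulN1r mulrN /M2.
  by congr (_ * B _ _ - B _ _ * B _ _); exact: val_inj.
rewrite (expand_det_row _ 0) sum3E /cofactor !det2 /M2 !mxE /=.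
have l00 : lift (0 : 'I_3) (0 : 'I_2) = 1 by exact: val_inj.
have l01 : lift (0 : 'I_3) (1 : 'I_2) = 2%:R by exact: val_inj.
have l10 : lift (1 : 'I_3) (0 : 'I_2) = 0 by exact: val_inj.
have l11 : lift (1 : 'I_3) (1 : 'I_2) = 2%:R by exact: val_inj.
have l20 : lift (2%:R : 'I_3) (0 : 'I_2) = 0 by exact: val_inj.
have l21 : lift (2%:R : 'I_3) (1 : 'I_2) = 1 by exact: val_inj.
rewrite l00 l01 l10 l11 l20 l21.
rewrite [(-1) ^+ (0 + 0)]expr0 [(-1) ^+ (0 + 1)]expr1 [(-1) ^+ (0 + 2)]sqrrN expr1n.
by rewrite !mul1r mulN1r mulrN.
Qed.

End ThreeByThree.

Section Mx3Entries.
Context {R : realType}.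
Variables a b c d e f g h k : R[i].
Local Notation A := (mx3 [:: [:: a; b; c]; [:: d; e; f]; [:: g; h; k]]).

Lemma mx3E : ((A 0 0 = a) * (A 0 1 = b) * (A 0 2%:R = c) *
  (A 1 0 = d) * (A 1 1 = e) * (A 1 2%:R = f) *
  (A 2%:R 0 = g) * (A 2%:R 1 = h) * (A 2%:R 2%:R = k))%type.
Proof. by do !split; rewrite mxE. Qed.

End Mx3Entries.

Section Orthonormalization.
Context {R : realType}.
Local Notation C := R[i].
Local Notation M3 := 'M[C]_3.
Implicit Types e h : M3.

Definition gram e : M3 := e^t* *m e.

Definition gram1 e : R := complex.Re (gram e 0 0).

Definition gram2 e : R :=
  complex.Re (gram e 0 0 * gram e 1 1 - gram e 0 1 * gram e 1 0).

(** Addition in ['I_3] is modulo 3, so this is the cross product of the first two columns. It is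
    bilinear, without conjugation; its conjugate is the vector orthogonal to both columns in the
    Hermitian sense. *)
Definition cross e : 'cV[C]_3 := \col_i
  (e (i + 1) 0 * e (i + 2%:R) 1 - e (i + 2%:R) 0 * e (i + 1) 1).

Lemma crossE e : ((cross e 0 0 = e 1 0 * e 2%:R 1 - e 2%:R 0 * e 1 1) *
  (cross e 1 0 = e 2%:R 0 * e 0 1 - e 0 0 * e 2%:R 1) *
  (cross e 2%:R 0 = e 0 0 * e 1 1 - e 1 0 * e 0 1))%type.
Proof.
have h1 : (1 + 1 : 'I_3) = 2%:R by exact: val_inj.
have h2 : (1 + 2%:R : 'I_3) = 0 by exact: val_inj.
have h3 : (2%:R + 1 : 'I_3) = 0 by exact: val_inj.
have h4 : (2%:R + 2%:R : 'I_3) = 1 by exact: val_inj.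
by do !split; rewrite mxE ?add0r ?h1 ?h2 ?h3 ?h4.
Qed.

(* Gram-Schmidt on the first two columns; the third is the one making the determinant 1. *)
Definition su_frame e : M3 :=
  let p : C := ((Num.sqrt (gram1 e))^-1)%:C%C in
  let r : C := ((Num.sqrt (gram2 e))^-1)%:C%C in
  let u i := p * e i 0 in
  let v i := p * r * (gram e 0 0 * e i 1 - gram e 0 1 * e i 0) in
  let w i := r * (cross e i 0)^* in
  mx3 [:: [:: u 0; v 0; w 0]; [:: u 1; v 1; w 1]; [:: u 2%:R; v 2%:R; w 2%:R]].

Lemma gramE e i j : gram e i j =
  (e 0 i)^* * e 0 j + (e 1 i)^* * e 1 j + (e 2%:R i)^* * e 2%:R j.
Proof. by rewrite mulmx3E !mxE. Qed.

Lemma gram00 e : gram e 0 0 = (gram1 e)%:C%C.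
Proof.
rewrite /gram1 gramE; apply/eqP; rewrite eq_complex eqxx /=.
case: (e 0 0) (e 1 0) (e 2%:R 0) => [a b] [c d] [x y] /=; apply/eqP; ring.
Qed.

Lemma gram_cross e : gram e 0 0 * gram e 1 1 - gram e 0 1 * gram e 1 0 =
  (cross e 0 0)^* * cross e 0 0 + (cross e 1 0)^* * cross e 1 0
   + (cross e 2%:R 0)^* * cross e 2%:R 0.
Proof.
rewrite !gramE !crossE !(rmorphB, rmorphM) /=.
move: (e 0 0) (e 1 0) (e 2%:R 0) (e 0 1) (e 1 1) (e 2%:R 1) => a b c d x y.
move: (a^*) (b^*) (c^*) (d^*) (x^*) (y^*) => a' b' c' d' x' y'; ring.
Qed.

Lemma gram2E e : (gram2 e)%:C%C =
  (cross e 0 0)^* * cross e 0 0 + (cross e 1 0)^* * cross e 1 0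
   + (cross e 2%:R 0)^* * cross e 2%:R 0.
Proof.
rewrite /gram2 gram_cross.
move: (cross e 0 0) (cross e 1 0) (cross e 2%:R 0) => [a b] [c d] [x y].
by apply/eqP; rewrite eq_complex eqxx /=; apply/eqP; ring.
Qed.

Lemma det_cross e : \det e = e 0 2%:R * cross e 0 0 + e 1 2%:R * cross e 1 0
  + e 2%:R 2%:R * cross e 2%:R 0.
Proof. rewrite det3E !crossE; ring. Qed.

Lemma normsq_sum3_gt0 (x y z : C) (n : R) :
  n%:C%C = x^* * x + y^* * y + z^* * z -> [|| x != 0, y != 0 | z != 0] -> 0 < n.
Proof.
move=> nE h; rewrite lt0r; apply/andP.
have n0 : 0 <= n.
  rewrite -ler0c nE !addr_ge0// mulrC mul_conjC_ge0//.
split => //; apply/eqP => nz; move: nE; rewrite nz => /esym /eqP.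
have p (t : C) : 0 <= t^* * t by rewrite mulrC mul_conjC_ge0.
rewrite paddr_eq0 ?addr_ge0// paddr_eq0//.
rewrite ![_^* * _]mulrC !mul_conjC_eq0 => /andP[/andP[/eqP x0 /eqP y0] /eqP z0].
by move: h; rewrite x0 y0 z0 !eqxx.
Qed.

Lemma gram1_gt0 e : e \in unitmx -> 0 < gram1 e.
Proof.
rewrite unitmxE unitfE => de.
apply: (@normsq_sum3_gt0 (e 0 0) (e 1 0) (e 2%:R 0)); first by rewrite -gram00 gramE.
apply: contraTT de; rewrite !negb_or !negbK => /and3P[/eqP x0 /eqP y0 /eqP z0].
by rewrite det_cross !crossE x0 y0 z0 !(mul0r, mulr0, subrr, addr0).
Qed.

Lemma gram2_gt0 e : e \in unitmx -> 0 < gram2 e.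
Proof.
rewrite unitmxE unitfE => de.
apply: normsq_sum3_gt0 (gram2E e) _.
apply: contraTT de; rewrite !negb_or !negbK => /and3P[/eqP x0 /eqP y0 /eqP z0].
by rewrite det_cross x0 y0 z0 !(mulr0, addr0).
Qed.

Lemma sqrtV_sq (x : R) : 0 < x -> ((Num.sqrt x)^-1)%:C%C ^+ 2 * x%:C%C = 1 :> C.
Proof.
move=> x0; rewrite -rmorphXn -rmorphM /= exprVn sqr_sqrtr ?ltW// mulVf ?gt_eqF//.
Qed.

Lemma conj_realC (x : R) : (x%:C%C)^* = x%:C%C :> C.
Proof. exact: conjc_real. Qed.

Lemma SU3_of_gram g : gram g = 1%:M -> \det g = 1 -> SU3 g.
Proof. by move=> /mulmx1C g1 dg; split => //; apply/unitarymxP. Qed.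

Lemma gram2_gram e : (gram2 e)%:C%C = gram e 0 0 * gram e 1 1 - gram e 0 1 * gram e 1 0.
Proof. by rewrite gram2E gram_cross. Qed.

Lemma conj_gram e i j : (gram e i j)^* = gram e j i.
Proof.
by rewrite !gramE !rmorphD !rmorphM /= !conjCK; congr (_ + _ + _); rewrite mulrC.
Qed.

Lemma su_frame_col e k : let p : C := ((Num.sqrt (gram1 e))^-1)%:C%C in
  let r : C := ((Num.sqrt (gram2 e))^-1)%:C%C in
  [/\ su_frame e k 0 = p * e k 0,
      su_frame e k 1 = p * r * (gram e 0 0 * e k 1 - gram e 0 1 * e k 0) &
      su_frame e k 2%:R = r * (cross e k 0)^*].
Proof. by move: k; apply: ord3P; split; rewrite /su_frame mx3E. Qed.

Lemma su_frameE e : exists p r : C,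
  [/\ p^* = p, r^* = r, e \in unitmx -> p ^+ 2 * gram e 0 0 = 1,
      e \in unitmx ->
      r ^+ 2 * (gram e 0 0 * gram e 1 1 - gram e 0 1 * gram e 1 0) = 1 & forall k,
  [/\ su_frame e k 0 = p * e k 0,
      su_frame e k 1 = p * r * (gram e 0 0 * e k 1 - gram e 0 1 * e k 0) &
      su_frame e k 2%:R = r * (cross e k 0)^*]].
Proof.
exists ((Num.sqrt (gram1 e))^-1)%:C%C, ((Num.sqrt (gram2 e))^-1)%:C%C.
split; [exact: conj_realC|exact: conj_realC| | |exact: su_frame_col].
- by move=> eu; rewrite gram00 sqrtV_sq// gram1_gt0.
- by move=> eu; rewrite -gram2_gram sqrtV_sq// gram2_gt0.
Qed.

(* [A], [B] stand for the conjugates of [a], [b]; [n g h m] is the Gram matrix. *)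
Lemma gram_schmidt_identities (K : comPzRingType) (a b A B : 'I_3 -> K) (n g h m p r : K) :
  let dot (f1 f2 : 'I_3 -> K) := f1 0 * f2 0 + f1 1 * f2 1 + f1 2%:R * f2 2%:R in
  let crs (f1 f2 : 'I_3 -> K) i := f1 (i + 1) * f2 (i + 2%:R) - f1 (i + 2%:R) * f2 (i + 1) in
  let u k := p * a k in let u' k := p * A k in
  let v k := p * r * (n * b k - g * a k) in let v' k := p * r * (n * B k - h * A k) in
  let w k := r * crs A B k in let w' k := r * crs a b k in
  dot A a = n -> dot A b = g -> dot B a = h -> dot B b = m ->
  p ^+ 2 * n = 1 -> r ^+ 2 * (n * m - g * h) = 1 ->
  [/\ [/\ dot u' u = 1, dot u' v = 0 & dot u' w = 0],
      [/\ dot v' u = 0, dot v' v = 1 & dot v' w = 0],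
      [/\ dot w' u = 0, dot w' v = 0 & dot w' w = 1] &
      dot (crs u v) w = 1].
Proof.
rewrite /=.
have -> : (0 + 1 : 'I_3) = 1 by exact: val_inj.
have -> : (0 + 2%:R : 'I_3) = 2%:R by exact: val_inj.
have -> : (1 + 1 : 'I_3) = 2%:R by exact: val_inj.
have -> : (1 + 2%:R : 'I_3) = 0 by exact: val_inj.
have -> : (2%:R + 1 : 'I_3) = 0 by exact: val_inj.
have -> : (2%:R + 2%:R : 'I_3) = 1 by exact: val_inj.
move: (a 0) (a 1) (a 2%:R) (b 0) (b 1) (b 2%:R) => a0 a1 a2 b0 b1 b2.
move: (A 0) (A 1) (A 2%:R) (B 0) (B 1) (B 2%:R) => A0 A1 A2 B0 B1 B2.
move=> <- <- <- <- P Q; have PQ := etrans (congr2 *%R P Q) (mulr1 1).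
do !split; [rewrite -[RHS]P; ring|ring|ring|ring|rewrite -[RHS]PQ; ring|ring|ring|ring|
  rewrite -[RHS]Q; ring|rewrite -[RHS]PQ; ring].
Qed.

(** The vector n b - g a has squared length n (nm - gh), which explains the factor p r of the second
    column. The third, the normalized conjugate cross product, completes an orthonormal basis of
    determinant 1. *)
Lemma su_frame_SU3 e : e \in unitmx -> SU3 (su_frame e).
Proof.
move=> eu; have [p [r [pc rc /(_ eu) P /(_ eu) Q sE]]] := su_frameE e.
have s0 k := let: And3 x _ _ := sE k in x.
have s1 k := let: And3 _ x _ := sE k in x.
have s2 k : su_frame e k 2%:R = r * ((e (k + 1) 0)^* * (e (k + 2%:R) 1)^* -
    (e (k + 2%:R) 0)^* * (e (k + 1) 1)^*).
  have [_ _ ->] := sE k; congr (_ * _).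
  by rewrite mxE rmorphB; congr (_ - _); exact: rmorphM.
have c0 k : (su_frame e k 0)^* = p * (e k 0)^* by rewrite s0 rmorphM /= pc.
have c1 k : (su_frame e k 1)^* =
    p * r * (gram e 0 0 * (e k 1)^* - gram e 1 0 * (e k 0)^*).
  by rewrite s1 !(rmorphM, rmorphB) /= pc rc !conj_gram.
have c2 k : (su_frame e k 2%:R)^* =
    r * (e (k + 1) 0 * e (k + 2%:R) 1 - e (k + 2%:R) 0 * e (k + 1) 1).
  by have [_ _ ->] := sE k; rewrite rmorphM /= rc conjCK mxE.
have [[uu uv uw] [vu vv vw] [wu wv ww] d] :=
  @gram_schmidt_identities _ (e ^~ 0) (e ^~ 1) (fun k => (e k 0)^*)
    (fun k => (e k 1)^*) _ _ _ _ p r (esym (gramE e 0 0)) (esym (gramE e 0 1))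
    (esym (gramE e 1 0)) (esym (gramE e 1 1)) P Q.
apply: SU3_of_gram.
  by apply: matrix3P; rewrite gramE ?c0 ?c1 ?c2 ?s0 ?s1 ?s2 [RHS]mxE.
have cE f k : cross f k 0 = f (k + 1) 0 * f (k + 2%:R) 1 - f (k + 2%:R) 0 * f (k + 1) 1.
  by rewrite mxE.
rewrite det_cross !cE !s0 !s1 !s2 -[RHS]d.
by congr (_ + _ + _); exact: mulrC.
Qed.

Lemma gram_unitary h e : h^t* *m h = 1%:M -> gram (h *m e) = gram e.
Proof.
by move=> hU; rewrite /gram trmx_mul map_mxM !mulmxA -[_ *m _ *m h]mulmxA hU mulmx1.
Qed.

(** The cofactor rule for cross products: ha x hb is the cofactor matrix of h applied to a x b. *)
Lemma cofactor_cross h e : h^T *m cross (h *m e) = \det h *: cross e.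
Proof.
apply/matrixP => i j; rewrite (ord1 j) {j}; move: i.
by apply: ord3P; rewrite mulmx3E [RHS]mxE !crossE !mulmx3E !mxE det3E; ring.
Qed.

Lemma cross_unitary h e : h^t* *m h = 1%:M ->
  map_mx Num.conj (cross (h *m e)) = (\det h)^* *: (h *m map_mx Num.conj (cross e)).
Proof.
move=> hU; have hU' : h *m h^t* = 1%:M by exact: mulmx1C.
have /(congr1 (fun A => h *m map_mx Num.conj A)) := cofactor_cross h e.
rewrite map_mxM mulmxA hU' mul1mx => ->.
by rewrite map_mxZ scalemxAr.
Qed.

Definition diag3 (a b c : C) : M3 :=
  mx3 [:: [:: a; 0; 0]; [:: 0; b; 0]; [:: 0; 0; c]].

Lemma mul_diag3 e a b c : e *m diag3 a b c =
  \matrix_(i, j) (e i j * (if j == 0 then a else if j == 1 then b else c)).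
Proof.
by apply: matrix3P; rewrite mulmx3E !mx3E [RHS]mxE /= !(mulr0, addr0, add0r).
Qed.

Lemma diag3M a b c a' b' c' :
  diag3 a b c *m diag3 a' b' c' = diag3 (a * a') (b * b') (c * c').
Proof.
by rewrite mul_diag3; apply: matrix3P; rewrite !mxE /= ?mul0r.
Qed.

Lemma diag3_1 : diag3 1 1 1 = 1%:M.
Proof. by apply: matrix3P; rewrite !mxE. Qed.

(** A unitary factor leaves the Gram matrix unchanged, so the first two columns are simply
    multiplied by [h]; the cross product, being conjugated, acquires the conjugate of det h. This
    phase in the last column is the only failure of equivariance. *)
Lemma su_frame_unitary h e : h^t* *m h = 1%:M ->
  su_frame (h *m e) = h *m su_frame e *m diag3 1 1 (\det h)^*.
Proof.
move=> hU; apply/matrixP => k j; rewrite mul_diag3 [RHS]mxE mulmx3E.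
have [s0 s1 s2] := su_frame_col (h *m e) k; move: s0 s1 s2.
rewrite /gram1 /gram2 !(gram_unitary _ hU) -/(gram1 e) -/(gram2 e).
have -> : (cross (h *m e) k 0)^* = (\det h)^* *
    (h k 0 * (cross e 0 0)^* + h k 1 * (cross e 1 0)^* + h k 2%:R * (cross e 2%:R 0)^*).
  have /matrixP/(_ k 0) := cross_unitary e hU.
  by rewrite mxE => ->; rewrite mxE mulmx3E !mxE.
have t0 i := let: And3 x _ _ := su_frame_col e i in x.
have t1 i := let: And3 _ x _ := su_frame_col e i in x.
have t2 i := let: And3 _ _ x := su_frame_col e i in x.
rewrite !(mulmx3E h e) => s0 s1 s2; move: j; apply: ord3P => /=.
- by rewrite s0 !t0; ring.
- by rewrite s1 !t1; ring.
- by rewrite s2 !t2; ring.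
Qed.

Lemma map_real_mul m n p (A : 'M[R]_(m, n)) (B : 'M[R]_(n, p)) :
  map_mx (real_complex R) (A *m B) =
  map_mx (real_complex R) A *m map_mx (real_complex R) B.
Proof. exact: map_mxM. Qed.

Lemma map_conj_real m n (A : 'M[R]_(m, n)) :
  map_mx Num.conj (map_mx (real_complex R) A) = map_mx (real_complex R) A.
Proof. by apply/matrixP => i j; rewrite !mxE conj_realC. Qed.

Lemma real_mxP m n (A : 'M[C]_(m, n)) : map_mx Num.conj A = A ->
  A = map_mx (real_complex R) (map_mx (@complex.Re R) A).
Proof.
move=> /matrixP Ar; apply/matrixP => i j; have := Ar i j; rewrite !mxE.
case: (A i j) => a b /= [/eqP]; rewrite eqNr => /eqP ->.
by rewrite complexr0.
Qed.

(** Gram-Schmidt of a real matrix stays real, which keeps orthonormalized frames inside a given real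
    subspace. *)
Lemma su_frame_real (A : 'M[R]_3) :
  map_mx Num.conj (su_frame (map_mx (real_complex R) A)) =
  su_frame (map_mx (real_complex R) A).
Proof.
set e := map_mx (real_complex R) A.
have ac i j : (e i j)^* = e i j by rewrite mxE conj_realC.
have cc i : (cross e i 0)^* = cross e i 0.
  by rewrite mxE rmorphB; congr (_ - _); rewrite rmorphM; congr (_ * _); exact: ac.
have gc i j : (gram e i j)^* = gram e i j.
  by rewrite gramE !(rmorphD, rmorphM, conjCK) /= !ac.
have [p [r [pc rc _ _ sE]]] := su_frameE e.
apply/matrixP => k j; rewrite mxE.
have [s0 s1 s2] := sE k; move: j; apply: ord3P.
- by rewrite s0 rmorphM /= pc ac.
- by rewrite s1 !(rmorphM, rmorphB) /= pc rc !ac !gc.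
- by rewrite s2 rmorphM /= rc !cc.
Qed.

Section Smoothness.
Context {V : normedModType R} (U : set V) (oU : open U).

Lemma mxsmooth_mx3 (a b c d e f g h k : V -> C) :
  csmooth U a -> csmooth U b -> csmooth U c -> csmooth U d -> csmooth U e ->
  csmooth U f -> csmooth U g -> csmooth U h -> csmooth U k ->
  mxsmooth U (fun x => mx3 [:: [:: a x; b x; c x]; [:: d x; e x; f x];
                              [:: g x; h x; k x]]).
Proof.
move=> *; apply: ord3P; apply: ord3P;
  (match goal with H : csmooth U ?f |- _ =>
    by apply: (@csmooth_ext _ _ U oU f) => // x _; rewrite mx3E end).
Qed.

Lemma mxsmooth_su_frame (f : V -> M3) : (forall x, U x -> f x \in unitmx) ->
  mxsmooth U f -> mxsmooth U (fun x => su_frame (f x)).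
Proof.
move=> fu sf.
have sg : mxsmooth U (fun x => gram (f x)).
  apply: mxsmoothM => //; apply: mxsmooth_conj => //; exact: mxsmooth_tr.
have sc i : csmooth U (fun x => (cross (f x) i 0)^*).
  apply: csmooth_conj => //.
  apply: (@csmooth_ext _ _ U oU (fun x => f x (i + 1) 0 * f x (i + 2%:R) 1
    - f x (i + 2%:R) 0 * f x (i + 1) 1)) => [x _|]; first by rewrite mxE.
  by apply: csmoothB => //; apply: csmoothM => //; exact: sf.
have sp : csmooth U (fun x => ((Num.sqrt (gram1 (f x)))^-1)%:C%C).
  apply: csmooth_real => k; apply: Ck_inv => //.
    by move=> x /fu/gram1_gt0 h; rewrite gt_eqF// sqrtr_gt0.
  apply: Ck_sqrt => //; first by move=> x /fu/gram1_gt0.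
  exact: (sg 0 0).1.
have sr : csmooth U (fun x => ((Num.sqrt (gram2 (f x)))^-1)%:C%C).
  apply: csmooth_real => k; apply: Ck_inv => //.
    by move=> x /fu/gram2_gt0 h; rewrite gt_eqF// sqrtr_gt0.
  apply: Ck_sqrt => //; first by move=> x /fu/gram2_gt0.
  have h : csmooth U (fun x => gram (f x) 0 0 * gram (f x) 1 1 - gram (f x) 0 1 * gram (f x) 1 0).
    by apply: csmoothB => //; apply: csmoothM => //; exact: sg.
  exact: h.1.
have su i : csmooth U (fun x => ((Num.sqrt (gram1 (f x)))^-1)%:C%C * f x i 0).
  by apply: csmoothM => //; exact: sf.
have sv i : csmooth U (fun x => ((Num.sqrt (gram1 (f x)))^-1)%:C%C *
    ((Num.sqrt (gram2 (f x)))^-1)%:C%C *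
    (gram (f x) 0 0 * f x i 1 - gram (f x) 0 1 * f x i 0)).
  apply: csmoothM => //; first exact: csmoothM.
  by apply: csmoothB => //; apply: csmoothM => //.
have sw i : csmooth U (fun x => ((Num.sqrt (gram2 (f x)))^-1)%:C%C * (cross (f x) i 0)^*).
  exact: csmoothM.
by apply: mxsmooth_mx3.
Qed.

End Smoothness.

End Orthonormalization.

(** * Special Lagrangian subspaces *)

Section Constants.
Context {R : realType}.
Local Notation C := R[i].
Local Notation M3 := 'M[C]_3.
Local Notation B := (frame0 R).

Definition imC : C := Complex 0 1.

Definition omega : C := epsilon R ^+ 2.

Lemma epsilon3 : epsilon R ^+ 3 = -1.
Proof.
have h2 : epsilon R * epsilon R = Complex (cos (pi / 3 + pi / 3)) (sin (pi / 3 + pi / 3)).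
  by rewrite cosD sinD /epsilon; apply/eqP; rewrite eq_complex /=; apply/andP; split; apply/eqP; ring.
have h3 : epsilon R * epsilon R * epsilon R =
    Complex (cos (pi / 3 + pi / 3 + pi / 3)) (sin (pi / 3 + pi / 3 + pi / 3)).
  rewrite h2 (cosD (pi / 3 + pi / 3)) (sinD (pi / 3 + pi / 3)).
  apply/eqP; rewrite /epsilon eq_complex /=.
  by apply/andP; split; apply/eqP; ring.
have e3 : pi / 3 + pi / 3 + pi / 3 = pi :> R by field.
rewrite !exprS expr0 mulr1 mulrA h3 e3 cospi sinpi.
by apply/eqP; rewrite eq_complex /= ?oppr0 ?eqxx.
Qed.

Lemma omega3 : omega ^+ 3 = 1.
Proof. by rewrite /omega -exprM mulnC exprM epsilon3 sqrrN expr1n. Qed.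

(** The imaginary part is 2 cos(pi/3) sin(pi/3), which is positive. *)
Lemma omega_neq1 : omega != 1.
Proof.
have : 0 < sin (pi / 3 : R).
  apply: sin_gt0_pi; rewrite divr_gt0 ?pi_gt0//=.
  by rewrite ltr_pdivrMr// ltr_pMr ?pi_gt0// ltr1n.
have : 0 < cos (pi / 3 : R).
  apply: cos_gt0_pihalf; have := pi_gt0 R => p; apply/andP; split; lra.
move=> c0 s0; rewrite /omega /epsilon expr2 eq_complex negb_and; apply/orP; right.
by rewrite /= mulrC -mulr2n mulrn_eq0 /= mulf_neq0// gt_eqF.
Qed.

Lemma epsilon4 : epsilon R ^+ 4 = omega ^+ 2.
Proof. by rewrite /omega -exprM. Qed.

Definition swapmx : M3 := mx3 [:: [:: 0; 1; 0]; [:: 1; 0; 0]; [:: 0; 0; 1]].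

Lemma PE : P R = mx3 [:: [:: 0; omega; 0]; [:: omega ^+ 2; 0; 0]; [:: 0; 0; 1]].
Proof. by rewrite /P epsilon4. Qed.

Lemma P_mul_tr : P R *m (P R)^T = diag3 (omega ^+ 2) omega 1.
Proof.
rewrite PE; apply: matrix3P; rewrite mulmx3E !mxE /= ?(mulr0, mul0r, addr0, add0r, mulr1)//.
by rewrite -exprD (exprD _ 3 1) omega3 mul1r.
Qed.

Lemma P_tr_P : P R *m (P R)^T *m P R = swapmx.
Proof.
rewrite P_mul_tr PE; apply: matrix3P; rewrite mulmx3E !mx3E;
  rewrite ?(mulr0, mul0r, addr0, add0r, mulr1)//.
  by rewrite -exprSr omega3.
by rewrite -exprS omega3.
Qed.

Definition unitary_gram (h : M3) : Prop := h^t* *m h = 1%:M.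

(** The value i is the determinant of [frame0]; these frames are exactly the matrices g B with g in
    [SU3]. *)
Definition lagrangian_frame (h : M3) : Prop := unitary_gram h /\ \det h = imC.

Lemma frame0_swap : B *m B^T = swapmx.
Proof.
apply: matrix3P; rewrite mulmx3E !mxE /=; apply/eqP; rewrite eq_complex /=;
  apply/andP; split; apply/eqP; by field.
Qed.

Lemma frame0_lagrangian : lagrangian_frame B.
Proof.
split.
  apply: matrix3P; rewrite mulmx3E !mxE /=; apply/eqP; rewrite eq_complex /=;
    apply/andP; split; apply/eqP; by field.
rewrite det3E !mx3E; apply/eqP; rewrite eq_complex /=; apply/andP; split; apply/eqP; by field.
Qed.

End Constants.

Section Lagrangian.
Context {R : realType}.
Local Notation C := R[i].
Local Notation M3 := 'M[C]_3.
Local Notation B := (frame0 R).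
Local Notation toC := (map_mx (real_complex R)).

Lemma SU3_unitary (g : M3) : SU3 g -> unitary_gram g.
Proof. by move=> /SU3P [/mulmx1C]. Qed.

Lemma unitary_gramC (h : M3) : unitary_gram h -> h *m h^t* = 1%:M.
Proof. exact: mulmx1C. Qed.

Lemma mul_adjK n (h : M3) (b : 'M[C]_(3, n)) : unitary_gram h -> h *m (h^t* *m b) = b.
Proof. by move=> hU; rewrite mulmxA (unitary_gramC hU) mul1mx. Qed.

Lemma unitary_gram_mul (g h : M3) : unitary_gram g -> unitary_gram h -> unitary_gram (g *m h).
Proof. by move=> gU hU; rewrite /unitary_gram -/(gram (g *m h)) gram_unitary. Qed.

Lemma unitary_gram_unit (h : M3) : unitary_gram h -> h \in unitmx.
Proof. by move=> /mulmx1_unit []. Qed.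

Lemma adjmx_mul (g h : M3) : (g *m h)^t* = (h^t*) *m (g^t*).
Proof. by rewrite trmx_mul map_mxM. Qed.

Lemma adjmxK (g : M3) : (g^t*)^t* = g.
Proof. exact: trmxCK. Qed.

Lemma conjmx_mul m n p (g : 'M[C]_(m, n)) (h : 'M[C]_(n, p)) :
  map_mx Num.conj (g *m h) = map_mx Num.conj g *m map_mx Num.conj h.
Proof. exact: map_mxM. Qed.

Lemma conjmxK m n (g : 'M[C]_(m, n)) : map_mx Num.conj (map_mx Num.conj g) = g.
Proof. by apply/matrixP => i j; rewrite !mxE conjCK. Qed.

Lemma unitary_gram_tr (h : M3) : unitary_gram h -> h^T *m map_mx Num.conj h = 1%:M.
Proof.
move=> /(congr1 (fun A => map_mx Num.conj A)).
by rewrite conjmx_mul conjmxK map_mx1.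
Qed.

Lemma unitary_gram_adj (h : M3) : unitary_gram h -> unitary_gram (h^t*).
Proof. by move=> hU; rewrite /unitary_gram adjmxK; exact: unitary_gramC. Qed.

Lemma det_adj (h : M3) : \det (h^t*) = (\det h)^*.
Proof. by rewrite (det_map_mx Num.conj) det_tr. Qed.

Lemma SU3_of_unitary (h : M3) : unitary_gram h -> \det h = 1 -> SU3 h.
Proof. exact: SU3_of_gram. Qed.

Lemma lagrangian_frame_mul (g h : M3) : SU3 g -> lagrangian_frame h ->
  lagrangian_frame (g *m h).
Proof.
move=> gU [hU dh]; split; first by apply: unitary_gram_mul => //; exact: SU3_unitary.
by rewrite det_mulmx gU.2 mul1r.
Qed.

Lemma lagrangian_frame_SU3 (h : M3) : lagrangian_frame h -> SU3 (h *m B^t*).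
Proof.
move=> [hU dh]; have [BU dB] := @frame0_lagrangian R.
apply: SU3_of_unitary.
  by apply: unitary_gram_mul; [exact: hU|exact: unitary_gram_adj].
rewrite det_mulmx det_adj dh dB; apply/eqP; rewrite eq_complex /=.
by apply/andP; split; apply/eqP; ring.
Qed.

Lemma frame0K n (X : 'M[C]_(n, 3)) : X *m B^t* *m B = X.
Proof. by have [BU _] := @frame0_lagrangian R; rewrite -mulmxA BU mulmx1. Qed.

Lemma frame0_adjK n (X : 'M[C]_(n, 3)) : X *m B *m B^t* = X.
Proof.
by have [BU _] := @frame0_lagrangian R; rewrite -mulmxA (unitary_gramC BU) mulmx1.
Qed.

Lemma toC_inj m n : injective (fun A : 'M[R]_(m, n) => toC A).
Proof.
by move=> A A' /matrixP e; apply/matrixP => i j; have := e i j; rewrite !mxE => /complexI.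
Qed.

Lemma det_toC (A : 'M[R]_3) : \det (toC A) = (\det A)%:C%C.
Proof. exact: (det_map_mx (real_complex R)). Qed.

Lemma trmx_toC m n (A : 'M[R]_(m, n)) : (toC A)^T = toC A^T.
Proof. by apply/matrixP => i j; rewrite !mxE. Qed.

Lemma toC_unit (A : 'M[R]_3) : (toC A \in unitmx) = (A \in unitmx).
Proof.
by rewrite !unitmxE !unitfE det_toC (fmorph_eq0 (real_complex R)).
Qed.

Lemma real_unitary (A : 'M[R]_3) : unitary_gram (toC A) -> A *m A^T = 1%:M.
Proof.
move=> /unitary_gramC; rewrite trmx_toC map_conj_real -map_real_mul => e.
by apply: toC_inj; rewrite e map_mx1.
Qed.

(** [su_frame] forces determinant 1 and so puts a factor conj(i) in the last column when applied to
    a frame h A with det h = i and A real. The diagonal factor cancels it, and the inverse of B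
    turns the resulting frame into a group element acting on [V0]. *)
Definition to_lagrangian : M3 := diag3 1 1 imC *m B^t*.

Lemma unitary_gram_diag3 (a b c : C) : a^* * a = 1 -> b^* * b = 1 -> c^* * c = 1 ->
  unitary_gram (diag3 a b c).
Proof.
move=> ha hb hc.
by apply: matrix3P; rewrite gramE !mx3E [RHS]mxE ?(rmorph0, mul0r, mulr0, addr0, add0r).
Qed.

Lemma det_diag3 (a b c : C) : \det (diag3 a b c) = a * b * c.
Proof. rewrite det3E !mx3E; ring. Qed.

Lemma to_lagrangian_SU3 : SU3 to_lagrangian.
Proof.
apply: lagrangian_frame_SU3; split; last by rewrite det_diag3 !mul1r.
apply: unitary_gram_diag3; rewrite ?rmorph1 ?mul1r//.
by apply/eqP; rewrite eq_complex /=; apply/andP; split; apply/eqP; ring.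
Qed.

(* Orthonormalizing another frame of a Lagrangian subspace stays in that subspace. *)
Lemma su_frame_lagrangian (h : M3) (A : 'M[R]_3) : lagrangian_frame h ->
  A \in unitmx -> exists A' : 'M[R]_3, [/\ A' *m A'^T = 1%:M, \det A' = 1 &
    su_frame (h *m toC A) *m to_lagrangian = h *m toC A' *m B^t*].
Proof.
move=> [hU dh] Au; have Su : SU3 (su_frame (toC A)).
  by apply: su_frame_SU3; rewrite toC_unit.
have E := real_mxP (su_frame_real A).
exists (map_mx (@complex.Re R) (su_frame (toC A))); split.
- by apply: real_unitary; rewrite -E; exact: SU3_unitary.
- by apply: complexI; rewrite -det_toC -E Su.2.
- rewrite -E su_frame_unitary// dh /to_lagrangian !mulmxA; congr (_ *m _).
  rewrite -!mulmxA; congr (_ *m _); rewrite -[RHS]mulmx1; congr (_ *m _).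
  have i2 : (@imC R)^* * imC = 1.
    by apply/eqP; rewrite eq_complex /=; apply/andP; split; apply/eqP; ring.
  by apply: matrix3P; rewrite mulmx3E !mx3E [RHS]mxE
    ?(mul0r, mulr0, addr0, add0r, mulr1, i2).
Qed.

Lemma act_oriented_span (g b : M3) :
  act_oriented g (oriented_span b) = oriented_span (g *m b).
Proof.
congr pair; apply/seteqP; split=> [_ [_ [x px <-] <-]|_ [x px <-]].
- by exists x => //; rewrite mulmxA.
- by exists (b *m toC x); [exists x|rewrite mulmxA].
- by exists x => //; rewrite mulmxA.
- by exists (b *m toC x); [exists x|rewrite mulmxA].
Qed.

Lemma oriented_span_mulr (b : M3) (A : 'M[R]_3) : 0 < \det A ->
  oriented_span (b *m toC A) = oriented_span b.
Proof.
move=> dA; have Au : A \in unitmx by rewrite unitmxE unitfE gt_eqF.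
congr pair; apply/seteqP; split=> [_ [x px <-]|_ [x px <-]].
- by exists (A *m x) => //; rewrite map_real_mul mulmxA.
- exists (invmx A *m x) => //.
  by rewrite -mulmxA -map_real_mul mulKVmx.
- exists (A *m x); last by rewrite map_real_mul mulmxA.
  by rewrite /= det_mulmx mulr_gt0.
- exists (invmx A *m x); last by rewrite -mulmxA -map_real_mul mulKVmx.
  by rewrite /= det_mulmx det_inv mulr_gt0// invr_gt0.
Qed.

(** [b'] is a positive frame of its own span, so equality of the frame components already yields
    [A]. *)
Lemma oriented_spanP (b b' : M3) : oriented_span b' = oriented_span b ->
  exists2 A : 'M[R]_3, 0 < \det A & b' = b *m toC A.
Proof.
move=> e; have : (oriented_span b').2 b'.
  by exists 1%:M; rewrite /= ?det1// map_mx1 mulmx1.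
by rewrite e => -[A dA <-]; exists A.
Qed.

Lemma real_frame_unit (b : M3) : b \in unitmx -> real_frame b.
Proof.
move=> bu x /(congr1 (fun y => invmx b *m y)); rewrite mulKmx// mulmx0 => e.
by apply: toC_inj; rewrite e; apply/matrixP => i j; rewrite !mxE.
Qed.

Lemma lagrangian_frame_unit (h : M3) : lagrangian_frame h -> h \in unitmx.
Proof. by move=> [/unitary_gram_unit]. Qed.

Lemma hermE (u v : 'cV[C]_3) : herm u v = (u^T *m map_mx Num.conj v) 0 0.
Proof. by rewrite mulmx3E /herm sum3E !mxE. Qed.

Lemma oriented_lagrangian_span (h : M3) : lagrangian_frame h ->
  oriented_lagrangian (oriented_span h).
Proof.
move=> hL; split; first by exists h => //; apply: real_frame_unit; exact: lagrangian_frame_unit.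
move=> _ _ [x _ <-] [y _ <-]; rewrite hermE conjmx_mul map_conj_real trmx_mul -mulmxA.
rewrite [h^T *m _]mulmxA (unitary_gram_tr hL.1) mul1mx trmx_toC -map_real_mul mxE.
done.
Qed.

Definition SO_group : set M3 := [set g | SU3 g /\ g *m swapmx *m g^T = swapmx].

Lemma adj_conj (g : M3) : map_mx Num.conj g = (g^t*)^T.
Proof. by rewrite map_trmx trmxK. Qed.

(* A matrix [A = h^* g] with [h h^T = g g^T] is real because [A A^T = 1 = A A^*]. *)
Lemma real_transition (g h : M3) : lagrangian_frame g -> lagrangian_frame h ->
  g *m g^T = h *m h^T ->
  exists A : 'M[R]_3, [/\ A *m A^T = 1%:M, \det A = 1 & g = h *m toC A].
Proof.
move=> [gU dg] [hU dh] e; pose A := h^t* *m g.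
have AU : unitary_gram A by apply: unitary_gram_mul => //; exact: unitary_gram_adj.
have AT : A *m A^T = 1%:M.
  rewrite /A trmx_mul mulmxA -[_ *m g *m _]mulmxA e mulmxA hU mul1mx.
  by rewrite -adj_conj unitary_gram_tr.
have Ar : map_mx Num.conj A = A.
  rewrite adj_conj -[RHS]trmxK; congr (_^T).
  rewrite -[LHS]mulmx1 -AT mulmxA -[RHS]mul1mx; congr (_ *m _).
  exact: AU.
have E := real_mxP Ar.
exists (map_mx (@complex.Re R) A); split.
- by apply: real_unitary; rewrite -E.
- apply: complexI; rewrite -det_toC -E det_mulmx det_adj dg dh.
  by apply/eqP; rewrite eq_complex /=; apply/andP; split; apply/eqP; ring.
- by rewrite -E mul_adjK.
Qed.

Lemma frame_square (h : M3) (A : 'M[R]_3) : A *m A^T = 1%:M ->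
  (h *m toC A) *m (h *m toC A)^T = h *m h^T.
Proof.
move=> AA; rewrite trmx_mul mulmxA -[_ *m _ *m (toC A)^T]mulmxA trmx_toC.
by rewrite -map_real_mul AA map_mx1 mulmx1.
Qed.

Lemma act_swap (g : M3) : g *m swapmx *m g^T = (g *m B) *m (g *m B)^T.
Proof. by rewrite -frame0_swap trmx_mul !mulmxA. Qed.

(** If g B and B span the same space, the transition matrix is real and also unitary, hence
    orthogonal, and the squares h h^T agree. Conversely [real_transition] gives a real transition of
    determinant 1, which preserves the orientation. *)
Lemma stabilizer_SLGr : @stabilizer R (SLGr R) (V0 R) = SO_group.
Proof.
have BL := @frame0_lagrangian R.
apply/seteqP; split=> g [gU]; rewrite /= ?/V0 ?act_oriented_span => gE; split => //.
  have [A dA gA] := oriented_spanP gE.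
  have gL := lagrangian_frame_mul gU BL.
  have AU : unitary_gram (toC A).
    have -> : toC A = B^t* *m (g *m B) by rewrite gA mulmxA BL.1 mul1mx.
    by apply: unitary_gram_mul; [apply: unitary_gram_adj; exact: BL.1|exact: gL.1].
  by rewrite act_swap gA frame_square ?frame0_swap//; exact: real_unitary.
have [A [AA dA gA]] : exists A : 'M[R]_3,
    [/\ A *m A^T = 1%:M, \det A = 1 & g *m B = B *m toC A].
  apply: real_transition => //; first exact: lagrangian_frame_mul.
  by rewrite -act_swap gE frame0_swap.
by rewrite /= /V0 act_oriented_span gA oriented_span_mulr// dA.
Qed.

Lemma stabilizer_SLGr_tilde :
  @stabilizer R (SLGr_tilde R) (P R *m (P R)^T *m P R) = SO_group.
Proof. by rewrite P_tr_P. Qed.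

Lemma mxsmooth_complexify_mull (U : set (M3R R)) (A : M3) : open U ->
  mxsmooth U (fun e => complexify e *m A).
Proof.
by move=> oU; apply: mxsmoothM => //; [exact: mxsmooth_complexify|exact: mxsmooth_cst].
Qed.

Lemma homogeneous_SLGr : @homogeneous R (SLGr R) (V0 R).
Proof.
have BL := @frame0_lagrangian R.
split => /=.
- move=> V; split=> [[_ [g gU ->]]|[g gU ->]]; first by exists g.
  split; last by exists g.
  by rewrite /V0 act_oriented_span; apply: oriented_lagrangian_span; exact: lagrangian_frame_mul.
- by move=> g h _ _; rewrite /V0 !act_oriented_span mulmxA.
- by rewrite /V0 act_oriented_span mul1mx.
- exists (fun e => realify (complexify e *m B)); split.
    by apply: (Cinfty_realify openT (f:=fun e => complexify e *m B)); exact: mxsmooth_complexify_mull openT.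
  move=> g gU /=; rewrite !realifyK /V0 act_oriented_span; split => //.
  by apply: real_frame_unit; apply: lagrangian_frame_unit; exact: lagrangian_frame_mul.
- move=> e /= _ [_ [g gU]]; rewrite /V0 act_oriented_span => eg.
  have unitP e' h : SU3 h -> oriented_span (complexify e') = oriented_span (h *m B) ->
    exists A : 'M[R]_3, [/\ 0 < \det A, A \in unitmx & complexify e' = h *m B *m toC A].
    move=> hU /oriented_spanP [A dA eA]; exists A; split => //.
    by rewrite unitmxE unitfE gt_eqF.
  (* A real frame may be singular over C, but one spanning a point of the orbit is not;
     invertibility cuts out an open neighbourhood on which Gram-Schmidt is smooth. *)
  pose U := [set e : M3R R | setT e /\ complexify e \in unitmx].
  have oU : open U by apply: open_mxsmooth_unit openT _; exact: mxsmooth_complexify.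
  exists U, (fun e => realify (su_frame (complexify e) *m to_lagrangian)); split.
  + exact: oU.
  + split => //=; have [A [_ Au ->]] := unitP _ _ gU eg.
    by rewrite unitmx_mul toC_unit Au andbT lagrangian_frame_unit//; exact: lagrangian_frame_mul.
  + apply: (Cinfty_realify oU (f:=fun e => su_frame (complexify e) *m to_lagrangian)).
    apply: mxsmoothM; [exact: oU| |exact: mxsmooth_cst].
    apply: mxsmooth_su_frame; [exact: oU|by move=> x []|exact: mxsmooth_complexify].
  + move=> e' [_ e'u] _ [_ [h hU]]; rewrite /= !realifyK /V0 !act_oriented_span => eh.
    split; first by apply: SU3_mul; [exact: su_frame_SU3|exact: to_lagrangian_SU3].
    have [A [dA Au hA]] := unitP _ _ hU eh.
    have hL := lagrangian_frame_mul hU BL.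
    have [A' [A1 A2 A3]] := su_frame_lagrangian hL Au.
    have dA' : 0 < \det A' by rewrite A2 ltr01.
    by rewrite eh hA A3 frame0K (oriented_span_mulr _ dA').
Qed.

(** Since h is unitary, the product is the sum of [h^t* *m b] and its conjugate. *)
Lemma real_projection (h b : M3) : unitary_gram h ->
  map_mx Num.conj (h^t* *m (b + h *m h^T *m map_mx Num.conj b)) =
  h^t* *m (b + h *m h^T *m map_mx Num.conj b).
Proof.
move=> hU; rewrite mulmxDr !mulmxA hU mul1mx.
by rewrite map_mxD !conjmx_mul !conjmxK addrC.
Qed.

Lemma homogeneous_SLGr_tilde :
  @homogeneous R (SLGr_tilde R) (P R *m (P R)^T *m P R).
Proof.
have BL := @frame0_lagrangian R; rewrite P_tr_P.
split => /=.
- move=> Q; rewrite P_tr_P; split=> [[g gU <-]|[g gU ->]]; by exists g.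
- by move=> g h _ _; rewrite trmx_mul !mulmxA.
- by rewrite trmx1 mul1mx mulmx1.
- exists (fun e => realify (complexify e *m swapmx *m (complexify e)^T)); split.
    apply: (Cinfty_realify openT (f:=fun e => complexify e *m swapmx *m (complexify e)^T)).
    apply: mxsmoothM; first exact: openT.
      exact: mxsmooth_complexify_mull openT.
    by apply: mxsmooth_tr; [exact: openT|exact: mxsmooth_complexify].
  by move=> g gU /=; rewrite !realifyK.
- move=> e _ /= [g1 g1U]; rewrite P_tr_P => e1.
  pose b := g1 *m B; have bL : lagrangian_frame b by exact: lagrangian_frame_mul.
  (* The real-linear projection [v |-> (v + Q conj(v)) / 2] onto the Lagrangian
     subspace attached to [Q], applied to the columns of [b]. *)
  pose F (x : M3R R) : M3 := 2^-1 *: (b + complexify x *m map_mx Num.conj b).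
  have sF : mxsmooth setT F.
    apply: mxsmoothZ; [exact: openT|exact: csmooth_cst|].
    apply: mxsmoothD; [exact: openT|exact: mxsmooth_cst|].
    exact: mxsmooth_complexify_mull openT.
  (* For x in the orbit, F x = g B A with A real, of determinant i det A, so [dF x] is det A. Its
     positivity is an open condition making F x invertible. *)
  pose dF x := complex.Re (- imC * \det (F x)).
  pose U := [set x : M3R R | setT x /\ 0 < dF x].
  have oU : open U.
    apply: open_Cinfty_gt0 openT _.
    have := csmoothM openT (csmooth_cst setT (- imC)) (csmooth_det openT sF).
    by case.
  have iN : - (@imC R) * imC = 1.
    by apply/eqP; rewrite eq_complex /=; apply/andP; split; apply/eqP; ring.
  have two : (2 : C) != 0 by rewrite pnatr_eq0.
  have FE g x : SU3 g -> complexify x = g *m swapmx *m g^T ->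
      exists2 A : 'M[R]_3, F x = g *m B *m toC A & dF x = \det A.
    move=> gU xE; pose h := g *m B.
    have [hU dh] : lagrangian_frame h by exact: lagrangian_frame_mul.
    pose A := h^t* *m F x.
    have hA : F x = h *m A by rewrite mul_adjK.
    have Ar : map_mx Num.conj A = A.
      rewrite /A /F xE act_swap -/h -scalemxAr map_mxZ /= fmorphV rmorph_nat.
      by congr (_ *: _); exact: real_projection.
    have E := real_mxP Ar.
    exists (map_mx (@complex.Re R) A).
      by rewrite hA; congr (_ *m _); exact: E.
    by rewrite /dF hA det_mulmx dh mulrA iN mul1r {1}E det_toC.
  have posE : forall g x, SU3 g -> complexify x = g *m swapmx *m g^T -> 0 < dF x ->
      exists A : 'M[R]_3, [/\ F x = g *m B *m toC A, 0 < \det A & A \in unitmx].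
    move=> g x gU xE; have [A FA ->] := FE g x gU xE => dA.
    by exists A; split => //; rewrite unitmxE unitfE gt_eqF.
  exists U, (fun x => realify (su_frame (F x) *m to_lagrangian)); split.
  + exact: oU.
  (* At the starting point Q = b b^T fixes b under v |-> Q conj(v), so F e = b and [dF e] is 1. *)
  + split => //=; rewrite /dF /F -e1 act_swap -/b -mulmxA (unitary_gram_tr bL.1) mulmx1.
    have -> : b + b = (2 : C) *: b by rewrite scaler_nat mulr2n.
    by rewrite scalerA mulVf// scale1r bL.2 iN /= ltr01.
  + apply: (Cinfty_realify oU (f:=fun x => su_frame (F x) *m to_lagrangian)).
    apply: mxsmoothM => //; last exact: mxsmooth_cst.
    apply: mxsmooth_su_frame => //.
      move=> x [_ dx]; rewrite unitmxE unitfE; apply: contraTneq dx => d0.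
      by rewrite /dF d0 mulr0 /= ltxx.
    by apply: mxsmooth_sub sF.
  + move=> x [_ dx] _ [g gU] /= /esym xE.
    have [A [FA dA Au]] := posE g x gU xE dx.
    have gL := lagrangian_frame_mul gU BL.
    have [A' [A1 A2 A3]] := su_frame_lagrangian gL Au.
    rewrite realifyK FA; split.
      apply: SU3_mul; last exact: to_lagrangian_SU3.
      apply: su_frame_SU3; rewrite unitmx_mul toC_unit Au andbT.
      exact: lagrangian_frame_unit.
    by rewrite A3 act_swap frame0K (frame_square _ A1) -act_swap xE.
Qed.

End Lagrangian.

(** * Flags *)

Section Flags.
Context {R : realType}.
Local Notation C := R[i].
Local Notation M3 := 'M[C]_3.
Implicit Types b g T : M3.

Definition upper3 T : Prop := [/\ T 1 0 = 0, T 2%:R 0 = 0 & T 2%:R 1 = 0].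

Lemma col_mulmx (K : pzSemiRingType) m n p (A : 'M[K]_(m, n)) (B : 'M[K]_(n, p)) j :
  col j (A *m B) = A *m col j B.
Proof. by apply/matrixP => i k; rewrite !mxE; apply: eq_bigr => l _; rewrite mxE. Qed.

Lemma mulVmx_col (K : comUnitRingType) n (b : 'M[K]_n) i (x : K) : b \in unitmx ->
  invmx b *m (x *: col i b) = x *: delta_mx i 0.
Proof.
move=> bu; rewrite -scalemxAr; congr (_ *: _).
by rewrite -col_mulmx mulVmx//; apply/matrixP => k l; rewrite !mxE (ord1 l) eqxx andbT.
Qed.

Lemma mulVmx_col2 (K : comUnitRingType) n (b : 'M[K]_n) i j (x y : K) : b \in unitmx ->
  invmx b *m (x *: col i b + y *: col j b) = x *: delta_mx i 0 + y *: delta_mx j 0.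
Proof. by move=> bu; rewrite mulmxDr !mulVmx_col. Qed.

Lemma act_flag g b :
  @act R (Fl2 R) g (flag_of b) = flag_of (g *m b).
Proof.
have c j : linfun (mulmx g) (col j b) = col j (g *m b).
  by rewrite lfunE /= -col_mulmx.
by congr pair; rewrite /= ?limgD !limg_line !c.
Qed.

Lemma flag_of_cols b b' (x y z : C) : x != 0 -> z != 0 ->
  col 0 b' = x *: col 0 b -> col 1 b' = y *: col 0 b + z *: col 1 b ->
  flag_of b' = flag_of b.
Proof.
move=> x0 z0 c0 c1; rewrite /flag_of c0 c1.
have l0 : <[(x *: col 0 b)%R]>%VS = <[col 0%R b]>%VS.
  apply/eqP; rewrite eqEsubv -!memvE memvZ ?memv_line//=.
  by rewrite -[X in X \in _](scalerK x0) memvZ ?memv_line.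
rewrite l0; congr pair; apply/eqP; rewrite eqEsubv !subv_add !addvSl /= -!memvE.
apply/andP; split.
  apply: memvD; apply: memvZ; [apply: (subvP (addvSl _ _))|apply: (subvP (addvSr _ _))];
    exact: memv_line.
have e : col 1 b = z^-1 *: ((y *: col 0 b + z *: col 1 b) - y *: col 0 b).
  by rewrite addrC addKr scalerA mulVf// scale1r.
rewrite [X in X \in _]e; apply/memvZ/memvB.
  by apply: (subvP (addvSr _ _)); exact: memv_line.
by apply/memvZ/(subvP (addvSl _ _)); exact: memv_line.
Qed.

Lemma upper3_unit T : upper3 T -> T \in unitmx -> T 0 0 != 0 /\ T 1 1 != 0.
Proof.
move=> [h1 h2 h3]; rewrite unitmxE unitfE det3E h1 h2 h3 => d0.
by split; apply: contraNneq d0 => ->; apply/eqP; ring.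
Qed.

Lemma flag_of_upper b T : upper3 T -> T \in unitmx -> flag_of (b *m T) = flag_of b.
Proof.
move=> uT Tu; have [t0 t1] := upper3_unit uT Tu; have [h1 h2 h3] := uT.
apply: (flag_of_cols t0 t1 (y := T 0 1)).
  apply/matrixP => i j; rewrite mxE mulmx3E h1 h2 !mxE; ring.
apply/matrixP => i j; rewrite mxE mulmx3E h3 !mxE; ring.
Qed.

(** The columns of the product are the coordinates of the columns of [b'] in the basis [b];
    membership in the lines and planes of the flag kills those below the diagonal. *)
Lemma flag_of_eq b b' : b \in unitmx -> flag_of b' = flag_of b ->
  upper3 (invmx b *m b').
Proof.
move=> bu e.
have e1 : <[col 0%R b']>%VS = <[col 0%R b]>%VS := congr1 fst e.
have e2 : (<[col 0%R b']> + <[col 1%R b']>)%VS = (<[col 0%R b]> + <[col 1%R b]>)%VS :=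
  congr1 snd e.
have c0 : col 0 b' \in <[col 0%R b]>%VS by rewrite -e1 memv_line.
have c1 : col 1 b' \in (<[col 0%R b]> + <[col 1%R b]>)%VS.
  by rewrite -e2; apply: (subvP (addvSr _ _)); exact: memv_line.
have [x cx] := vlineP _ _ c0.
have [u /vlineP [y ->] [v /vlineP [z ->] cy]] := memv_addP c1.
have E j k : (invmx b *m b') k j = (invmx b *m col j b') k 0.
  by rewrite -col_mulmx [RHS]mxE.
by split; rewrite E ?cx ?cy ?(mulVmx_col2 _ _ _ _ bu) ?(mulVmx_col _ _ bu) !mxE /= !mulr0 ?addr0.
Qed.

Lemma flag_of_su_frame b : b \in unitmx -> flag_of (su_frame b) = flag_of b.
Proof.
move=> bu; have h1 := gram1_gt0 bu; have h2 := gram2_gt0 bu.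
have p0 (x : R) : 0 < x -> ((Num.sqrt x)^-1)%:C%C != 0 :> C.
  by move=> x0; rewrite (fmorph_eq0 (real_complex R)) invr_eq0 gt_eqF// sqrtr_gt0.
have q0 : (gram1 b)%:C%C != 0 :> C by rewrite (fmorph_eq0 (real_complex R)) gt_eqF.
set p := ((Num.sqrt (gram1 b))^-1)%:C%C.
set r := ((Num.sqrt (gram2 b))^-1)%:C%C.
apply: (@flag_of_cols _ _ p (- (p * r * gram b 0 1)) (p * r * gram b 0 0)).
- exact: p0.
- by rewrite gram00 !mulf_neq0 ?p0.
- apply/matrixP => i j; rewrite !mxE; move: i; apply: ord3P; rewrite /= //.
- apply/matrixP => i j; rewrite !mxE; move: i; apply: ord3P; rewrite /= -/p -/r; ring.
Qed.

Lemma su_frame_unit b : b \in unitmx -> su_frame b \in unitmx.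
Proof. by move=> bu; apply: SU3_unit; exact: su_frame_SU3. Qed.

Lemma unitmx_ker b : (forall x : 'cV[C]_3, b *m x = 0 -> x = 0) -> b \in unitmx.
Proof.
move=> h; rewrite unitmxE unitfE -det_tr; apply/det0P => -[v v0 vb].
have /h e : b *m v^T = 0 by rewrite -[b]trmxK -trmx_mul vb trmx0.
by move: v0; rewrite -[v]trmxK e trmx0 eqxx.
Qed.

(** Take w1 in W1, w2 in W2 outside W1, and w3 outside W2. In a linear relation the last nonzero
    coefficient would put its vector into the smaller space, so the three are independent. *)
Lemma flag_frame (W : flag R) : \dim W.1 = 1%N -> \dim W.2 = 2%N ->
  (W.1 <= W.2)%VS -> exists2 b, b \in unitmx & W = flag_of b.
Proof.
case: W => W1 W2 /= d1 d2 W12.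
pose w1 := vpick W1.
have w10 : w1 != 0 by rewrite vpick0 -dimv_eq0 d1.
have W1E : W1 = <[w1]>%VS.
  by apply/esym/eqP; rewrite eqEdim -memvE memv_pick d1 dim_vline w10.
have [w2 w2W w2N] : exists2 w, w \in W2 & w \notin W1.
  by apply/subvPn; apply/negP => /dimvS; rewrite d1 d2.
have [w3 _ w3N] : exists2 w, w \in fullv & w \notin W2.
  by apply/subvPn; apply/negP => /dimvS; rewrite d2 dimvf /dim /= .
have W2E : W2 = (<[w1]> + <[w2]>)%VS.
  apply/esym/eqP; rewrite eqEdim subv_add -[(<[w2]> <= W2)%VS]memvE w2W -W1E W12 d2 /=.
  rewrite ltnNge; apply/negP => h.
  have /eqP e : W1 == (W1 + <[w2]>)%VS by rewrite eqEdim addvSl d1.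
  by move: w2N; rewrite e (subvP (addvSr _ _)) ?memv_line.
pose b : M3 := \matrix_(i, j) (if j == 0 then w1 else if j == 1 then w2 else w3) i 0.
have c0 : col 0 b = w1 by apply/matrixP => i j; rewrite !mxE /= (ord1 j).
have c1 : col 1 b = w2 by apply/matrixP => i j; rewrite !mxE /= (ord1 j).
have bE x : b *m x = x 0 0 *: w1 + x 1 0 *: w2 + x 2%:R 0 *: w3.
  by apply/matrixP => i j; rewrite mulmx3E !mxE /= (ord1 j); ring.
exists b; last by rewrite /flag_of c0 c1 -W2E -W1E.
apply: unitmx_ker => x; rewrite bE => e.
have x2 : x 2%:R 0 = 0.
  apply/eqP; apply: contraNT w3N => n.
  have -> : w3 = - (x 2%:R 0)^-1 *: (x 0 0 *: w1 + x 1 0 *: w2).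
    have -> : x 0 0 *: w1 + x 1 0 *: w2 = - (x 2%:R 0 *: w3).
      by apply/eqP; rewrite -addr_eq0 e.
    by rewrite scaleNr scalerN opprK scalerA mulVf// scale1r.
  rewrite memvZ// memvD// memvZ//; apply: (subvP W12); exact: memv_pick.
have x1 : x 1 0 = 0.
  apply/eqP; apply: contraNT w2N => n.
  have -> : w2 = - (x 1 0)^-1 *: (x 0 0 *: w1).
    have -> : x 0 0 *: w1 = - (x 1 0 *: w2).
      by apply/eqP; rewrite -addr_eq0; apply/eqP; rewrite -[RHS]e x2 scale0r addr0.
    by rewrite scaleNr scalerN opprK scalerA mulVf// scale1r.
  by rewrite !memvZ//; exact: memv_pick.
have x0 : x 0 0 = 0.
  apply/eqP; move/eqP: e; rewrite x1 x2 !scale0r !addr0 scaler_eq0.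
  by rewrite (negbTE w10) orbF.
by apply/matrixP => i j; rewrite (ord1 j) mxE; move: i; apply: ord3P.
Qed.

Lemma flag_dims b : b \in unitmx ->
  [/\ \dim (flag_of b).1 = 1%N, \dim (flag_of b).2 = 2%N &
      ((flag_of b).1 <= (flag_of b).2)%VS].
Proof.
move=> bu; rewrite /flag_of /=.
have n j : col j b != 0.
  apply/eqP => /(congr1 (fun u => (invmx b *m (1 *: u)) j 0)).
  rewrite (mulVmx_col _ _ bu) scaler0 mulmx0 !mxE !eqxx mulr1 => /eqP.
  by rewrite oner_eq0.
split; [by rewrite dim_vline n| |exact: addvSl].
rewrite dimv_disjoint_sum ?dim_vline ?n//.
apply/eqP; rewrite -subv0; apply/subvP => v; rewrite memv_cap memv0.
move=> /andP[/vlineP [x ->] /vlineP [y e]].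
move: e => /(congr1 (fun u => (invmx b *m u) 0 0)).
rewrite !(mulVmx_col _ _ bu) !mxE /= mulr1 mulr0 => ->.
by rewrite scale0r.
Qed.

(** Orthogonality to the first column clears the rest of the first row, then orthogonality to the
    second column clears the second row. *)
Lemma unitary_upper3_diag g : unitary_gram g -> upper3 g -> is_diag_mx g.
Proof.
move=> gU [h1 h2 h3].
have G i j : gram g i j = (i == j)%:R by rewrite /gram gU mxE.
have n0 : g 0 0 != 0.
  apply/eqP => e; have /eqP := G 0 0.
  by rewrite gramE h1 h2 e !mulr0 !addr0 eq_sym oner_eq0.
have g01 : g 0 1 = 0.
  have /eqP := G 0 1; rewrite gramE h1 h2 !rmorph0 !mul0r !addr0 mulf_eq0 conjC_eq0.
  by rewrite (negbTE n0) => /eqP.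
have g02 : g 0 2%:R = 0.
  have /eqP := G 0 2%:R; rewrite gramE h1 h2 !rmorph0 !mul0r !addr0 mulf_eq0 conjC_eq0.
  by rewrite (negbTE n0) => /eqP.
have n1 : g 1 1 != 0.
  apply/eqP => e; have /eqP := G 1 1.
  by rewrite gramE h3 g01 e !mulr0 !addr0 eq_sym oner_eq0.
have g12 : g 1 2%:R = 0.
  have /eqP := G 1 2%:R.
  rewrite gramE h3 g01 !rmorph0 !mul0r !addr0 add0r mulf_eq0 conjC_eq0.
  by rewrite (negbTE n1) => /eqP.
by apply/is_diag_mxP; apply: ord3P; apply: ord3P.
Qed.

Lemma diag_upper3 g : is_diag_mx g -> upper3 g.
Proof. by move=> /is_diag_mxP h; split; apply: h. Qed.

Lemma stabilizer_Fl2 : @stabilizer R (Fl2 R) (flag_of 1%:M) = D3 R.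
Proof.
apply/seteqP; split=> g [gU].
  rewrite act_flag mulmx1 => /flag_of_eq.
  rewrite unitmx1 invmx1 mul1mx => /(_ isT) h; split => //.
  by apply: unitary_upper3_diag => //; exact: SU3_unitary.
move=> gd; split => //; rewrite act_flag mulmx1.
rewrite -[in LHS](mul1mx g); apply: flag_of_upper; first exact: diag_upper3.
exact: SU3_unit.
Qed.

Lemma homogeneous_Fl2 : @homogeneous R (Fl2 R) (flag_of 1%:M).
Proof.
split.
- move=> W; split=> [[d1 d2 d3]|[g gU ->]].
    have [b bu ->] := flag_frame d1 d2 d3.
    exists (su_frame b); first exact: su_frame_SU3.
    by rewrite act_flag mulmx1 flag_of_su_frame.
  by rewrite act_flag mulmx1; apply: flag_dims; exact: SU3_unit.
- by move=> g h _ _; rewrite !act_flag mulmxA.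
- by rewrite act_flag mul1mx.
- exists id; split; first exact: Cinfty_id.
  move=> g gU; rewrite act_flag mulmx1 /= realifyK; split => //.
  exact: SU3_unit.
- move=> e /= eu _.
  pose U := [set e : M3R R | setT e /\ complexify e \in unitmx].
  have oU : open U by apply: open_mxsmooth_unit openT _; exact: mxsmooth_complexify.
  exists U, (fun e => realify (su_frame (complexify e))); split => //.
  + apply: (Cinfty_realify oU (f:=fun e => su_frame (complexify e))).
    apply: mxsmooth_su_frame; [exact: oU|by move=> x []|exact: mxsmooth_complexify].
  + move=> e' [_ e'u] _ _; rewrite realifyK; split; first exact: su_frame_SU3.
    transitivity (flag_of (su_frame (complexify e') *m 1%:M)); first exact: act_flag.
    by rewrite mulmx1 flag_of_su_frame.
Qed.

Lemma omega_neq : [/\ @omega R != 0, @omega R ^+ 2 != 1 & @omega R ^+ 2 != omega].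
Proof.
have w1 := @omega_neq1 R; have w3 := @omega3 R.
have w0 : @omega R != 0.
  by apply/eqP => e; move: w3; rewrite e expr0n /= => /eqP; rewrite eq_sym oner_eq0.
split => //; apply: contraNneq w1 => e.
  by rewrite -w3 exprS e mulr1.
by apply/eqP; apply: (mulfI w0); rewrite -expr2 e mulr1.
Qed.

Definition Dmx : M3 := diag3 (omega ^+ 2) omega 1.

Lemma Dmx_unit : Dmx \in unitmx.
Proof.
have [w0 _ _] := omega_neq.
by rewrite unitmxE unitfE det_diag3 mulr1 mulf_neq0// expf_neq0.
Qed.

Lemma commute_Dmx g : g *m Dmx = Dmx *m g <-> is_diag_mx g.
Proof.
have [w0 w21 w2] := omega_neq; have w1 := @omega_neq1 R.
split=> [/matrixP e|/is_diag_mxP h].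
  have k i j (x y : C) : x != y -> x * g i j = y * g i j -> g i j = 0.
    move=> xy /eqP; rewrite -subr_eq0 -mulrBl mulf_eq0 subr_eq0 (negbTE xy).
    by move=> /eqP.
  have E i j : g i j * Dmx j j = Dmx i i * g i j.
    have := e i j; rewrite !mulmx3E /Dmx /diag3.
    move: i j; apply: ord3P; apply: ord3P;
      by rewrite !mx3E !(mul0r, mulr0, addr0, add0r).
  have d0 : Dmx 0 0 = omega ^+ 2 by rewrite mx3E.
  have d1 : Dmx 1 1 = omega by rewrite mx3E.
  have d2 : Dmx 2%:R 2%:R = 1 by rewrite mx3E.
  apply/is_diag_mxP; apply: ord3P; apply: ord3P => //= _.
  - by apply: k w2 _; have := E 0 1; rewrite ?d0 ?d1 ?d2 => <-; rewrite mulrC.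
  - by apply: k w21 _; have := E 0 2%:R; rewrite ?d0 ?d1 ?d2 => <-; rewrite mulrC.
  - by apply: k w2 _; have := E 1 0; rewrite ?d0 ?d1 ?d2 => <-; rewrite mulrC.
  - by apply: k w1 _; have := E 1 2%:R; rewrite ?d0 ?d1 ?d2 => <-; rewrite mulrC.
  - by apply: k w21 _; have := E 2%:R 0; rewrite ?d0 ?d1 ?d2 => <-; rewrite mulrC.
  - by apply: k w1 _; have := E 2%:R 1; rewrite ?d0 ?d1 ?d2 => <-; rewrite mulrC.
have h' (i j : 'I_3) : (i != j :> nat) -> g i j = 0 by exact: h.
have g01 := h' 0 1 isT; have g02 := h' 0 2%:R isT; have g10 := h' 1 0 isT.
have g12 := h' 1 2%:R isT; have g20 := h' 2%:R 0 isT; have g21 := h' 2%:R 1 isT.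
apply: matrix3P; rewrite !mulmx3E !mx3E ?g01 ?g02 ?g10 ?g12 ?g20 ?g21; ring.
Qed.

Lemma stabilizer_Fl2_tilde :
  @stabilizer R (Fl2_tilde R) (P R *m (P R)^T) = D3 R.
Proof.
have -> : P R *m (P R)^T = Dmx by exact: P_mul_tr.
apply/seteqP; split=> g [gU] h; split => //.
  by apply/commute_Dmx; rewrite -[in RHS]h /= mulmxKV// SU3_unit.
by move/commute_Dmx: h => /= ->; rewrite mulmxK// SU3_unit.
Qed.

(** Frames of the same eigenlines differ by a diagonal factor; after orthonormalization this factor
    must still commute with [Dmx]. *)
Lemma su_frame_diag b : is_diag_mx b -> is_diag_mx (su_frame b).
Proof.
move=> /is_diag_mxP h'; have h (i j : 'I_3) : (i != j :> nat) -> b i j = 0 by exact: h'.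
have g01 := h 0 1 isT; have g02 := h 0 2%:R isT; have g10 := h 1 0 isT.
have g12 := h 1 2%:R isT; have g20 := h 2%:R 0 isT; have g21 := h 2%:R 1 isT.
have G : gram b 0 1 = 0 by rewrite gramE g01 g10 g20 g21 !(mulr0, mul0r, rmorph0, addr0).
apply/is_diag_mxP; apply: ord3P; apply: ord3P => //= _; rewrite /su_frame mx3E ?G ?crossE
  ?g01 ?g02 ?g10 ?g12 ?g20 ?g21 ?(mulr0, mul0r, addr0, subr0, rmorph0) //.
Qed.

(* Averaging over the cyclic group generated by [Dmx] projects onto diagonal matrices. *)
Lemma average_diag (w : C) b : 1 + w + w ^+ 2 = 0 ->
  is_diag_mx (b + diag3 (w ^+ 2) w 1 *m b *m diag3 w (w ^+ 2) 1
    + diag3 (w ^+ 2) w 1 *m (diag3 (w ^+ 2) w 1 *m b) *m diag3 (w ^+ 2) w 1).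
Proof.
move=> s; have k (x c : C) : x * c * (1 + w + w ^+ 2) = 0 by rewrite s mulr0.
(* Cofactors in 1 + w^4 + w^5 = (1 + w + w^2)(1 - w + w^3) and 1 + w^2 + w^4 = (1 + w + w^2)(1 - w +
   w^2), the factors multiplying the off-diagonal entries. *)
pose c01 : C := 1 - w + w ^+ 3; pose c02 : C := 1 - w + w ^+ 2.
rewrite !mul_diag3; apply/is_diag_mxP; apply: ord3P; apply: ord3P => //= _;
  rewrite !(mxE, sum3E) /=.
- rewrite -[RHS](k (b 0 1) c01) /c01; ring.
- rewrite -[RHS](k (b 0 2%:R) c02) /c02; ring.
- rewrite -[RHS](k (b 1 0) c02) /c02; ring.
- rewrite -[RHS](k (b 1 2%:R) 1); ring.
- rewrite -[RHS](k (b 2%:R 0) 1); ring.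
- rewrite -[RHS](k (b 2%:R 1) 1); ring.
Qed.

Lemma omega_sum : 1 + omega + omega ^+ 2 = 0 :> C.
Proof.
have : (omega - 1) * (1 + omega + omega ^+ 2) = 0 :> C.
  by transitivity (@omega R ^+ 3 - 1); [ring|rewrite omega3 subrr].
by move/eqP; rewrite mulf_eq0 subr_eq0 (negbTE (@omega_neq1 R)) => /eqP.
Qed.

Lemma average_Dmx_diag b :
  is_diag_mx (b + Dmx *m b *m diag3 omega (omega ^+ 2) 1
    + Dmx *m (Dmx *m b) *m diag3 (omega ^+ 2) omega 1).
Proof. exact: average_diag omega_sum. Qed.

End Flags.

Lemma invmx_mul (K : comUnitRingType) n (g h : 'M[K]_n) :
  g \in unitmx -> h \in unitmx -> invmx (g *m h) = invmx h *m invmx g.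
Proof.
move=> gu hu; have u : g *m h \in unitmx by rewrite unitmx_mul gu.
rewrite -[RHS]mul1mx -(mulVmx u) -!mulmxA (mulmxA h) (mulmxV hu) mul1mx.
by rewrite (mulmxV gu) mulmx1.
Qed.

Lemma conj_average (K : comUnitRingType) n (g g1 D A A' : 'M[K]_n) : g \in unitmx ->
  g1 + g *m D *m invmx g *m g1 *m A
    + g *m D *m invmx g *m (g *m D *m invmx g *m g1) *m A' =
  g *m (invmx g *m g1 + D *m (invmx g *m g1) *m A + D *m (D *m (invmx g *m g1)) *m A').
Proof.
move=> gu; have gg := mulmxV gu; have gi := mulVmx gu.
rewrite !mulmxDr !mulmxA gg mul1mx; congr (_ + _ + _ *m _).
by rewrite -(mulmxA (g *m D) (invmx g) g) gi mulmx1.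
Qed.

(** Averaging the frame that diagonalizes g D g^-1 gives three equal terms. The sum 3g is
    invertible, so the starting parameter lies in the domain of the section. *)
Lemma conj_average_self (K : comUnitRingType) n (g D A A' : 'M[K]_n) :
  g \in unitmx -> D \in unitmx -> D *m D = invmx D -> A = invmx D -> A' = D ->
  g + g *m D *m invmx g *m g *m A
    + g *m D *m invmx g *m (g *m D *m invmx g *m g) *m A' = 3 *: g.
Proof.
move=> gu Du DD -> ->; have gi := mulVmx gu; have Di := mulmxV Du; have Di' := mulVmx Du.
rewrite !mulmxA -!(mulmxA _ (invmx g) g) gi !mulmx1 -(mulmxA g D (invmx D)) Di mulmx1.
rewrite -(mulmxA g D D) DD -(mulmxA g (invmx D) D) Di' mulmx1.
by rewrite scaler_nat mulrS mulr2n addrA.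
Qed.

Lemma conj_commute (K : comUnitRingType) n (g s D : 'M[K]_n) : s \in unitmx ->
  s *m D = D *m s -> g *m s *m D *m (invmx s *m invmx g) = g *m D *m invmx g.
Proof.
move=> su sD; have ss := mulmxV su.
by rewrite !mulmxA -(mulmxA g s D) sD mulmxA -(mulmxA (g *m D) s) ss mulmx1.
Qed.

Section FlagOrbit.
Context {R : realType}.
Local Notation C := R[i].
Local Notation M3 := 'M[C]_3.
Local Notation Dmx := (@Dmx R).

Lemma Dmx_adj : Dmx^t* = diag3 omega (omega ^+ 2) 1.
Proof.
have w3 := @omega3 R.
have wc : (omega : C)^* = omega ^+ 2.
  have h : (omega : C)^* * omega = 1.
    have n1 : `|omega : C| = 1.
      have /eqP : `|omega : C| ^+ 3 = 1 by rewrite -normrX w3 normr1.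
      by rewrite pexpr_eq1// => /eqP.
    by rewrite mulrC -normCK n1 expr1n.
  by rewrite -[LHS]mulr1 -w3 [omega ^+ 3]exprS mulrA h mul1r.
have wc2 : (omega ^+ 2 : C)^* = omega by rewrite -wc conjCK.
by apply: matrix3P; rewrite /Dmx /diag3 !mxE /= ?rmorph0 ?rmorph1 ?wc2 ?wc.
Qed.

Lemma Dmx_unitary : unitary_gram Dmx.
Proof.
have w3 := @omega3 R.
by rewrite /unitary_gram Dmx_adj /Dmx diag3M -exprS -exprSr w3 mulr1 diag3_1.
Qed.

Lemma homogeneous_Fl2_tilde : @homogeneous R (Fl2_tilde R) (P R *m (P R)^T).
Proof.
have PD : P R *m (P R)^T = Dmx by exact: P_mul_tr.
have DU := Dmx_unitary; have Du := @Dmx_unit R.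
have DV : invmx Dmx = diag3 omega (omega ^+ 2) 1.
  by rewrite -Dmx_adj -[LHS]mul1mx -DU mulmxK.
have DD : Dmx *m Dmx = invmx Dmx.
  rewrite DV /Dmx; have w3 := @omega3 R.
  have w4 : omega ^+ 4 = omega :> C by rewrite (exprD _ 3 1) w3 mul1r.
  by rewrite diag3M -exprD -expr2 w4 mulr1.
rewrite PD; split => /=.
- move=> Q; rewrite PD; split=> [[g gU <-]|[g gU ->]]; by exists g.
- by move=> g h gU hU; rewrite (invmx_mul (SU3_unit gU) (SU3_unit hU)) !mulmxA.
- by rewrite invmx1 mul1mx mulmx1.
(* On [SU3] the inverse is the adjoint, which is smooth on all matrices. *)
- exists (fun e => realify (complexify e *m Dmx *m (complexify e)^t*)); split.
    apply: (Cinfty_realify openT (f:=fun e => complexify e *m Dmx *m (complexify e)^t*)).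
    apply: mxsmoothM; first exact: openT.
      exact: mxsmooth_complexify_mull openT.
    apply: mxsmooth_conj; first exact: openT.
    by apply: mxsmooth_tr; [exact: openT|exact: mxsmooth_complexify].
  by move=> g gU /=; rewrite !realifyK (SU3_invE gU).
- move=> e _ /= [g1 g1U]; rewrite PD => e1.
  (* The columns of [F x] are the projections of the columns of [g1] onto the
     eigenspaces of [x], up to the factor 3. *)
  pose F (x : M3R R) : M3 := g1 + complexify x *m g1 *m diag3 omega (omega ^+ 2) 1
    + complexify x *m (complexify x *m g1) *m diag3 (omega ^+ 2) omega 1.
  have sX (A : M3) : mxsmooth setT (fun x : M3R R => complexify x *m A) by exact: mxsmooth_complexify_mull openT.
  have sF : mxsmooth setT F.
    apply: mxsmoothD; first exact: openT.
      apply: mxsmoothD; [exact: openT|exact: mxsmooth_cst|].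
      by apply: mxsmoothM; [exact: openT|exact: sX|exact: mxsmooth_cst].
    apply: mxsmoothM; [exact: openT| |exact: mxsmooth_cst].
    by apply: mxsmoothM; [exact: openT|exact: mxsmooth_complexify|exact: sX].
  pose U := [set x : M3R R | setT x /\ F x \in unitmx].
  have oU : open U by exact: open_mxsmooth_unit openT sF.
  have FE g x : SU3 g -> complexify x = g *m Dmx *m invmx g ->
      exists2 b, is_diag_mx b & F x = g *m b.
    move=> gU xE; have gu := SU3_unit gU.
    exists (invmx g *m g1 + Dmx *m (invmx g *m g1) *m diag3 omega (omega ^+ 2) 1
      + Dmx *m (Dmx *m (invmx g *m g1)) *m diag3 (omega ^+ 2) omega 1).
      exact: average_Dmx_diag.
    by rewrite /F xE; exact: conj_average.
  exists U, (fun x => realify (su_frame (F x))); split.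
  + exact: oU.
  + split; [by []|rewrite /=]; have -> : F e = 3 *: g1.
      rewrite /F -e1; exact: (conj_average_self (SU3_unit g1U) Du DD (esym DV) erefl).
    by rewrite unitmxZ ?unitfE ?pnatr_eq0//; exact: SU3_unit.
  + apply: (Cinfty_realify oU (f:=fun x => su_frame (F x))).
    apply: mxsmooth_su_frame; [exact: oU|by move=> x []|exact: mxsmooth_sub sF].
  + move=> x [_ Fu] _ [g gU]; rewrite ?PD => /esym xE; rewrite realifyK.
    have [b bd FE'] := FE g x gU xE; have gu := SU3_unit gU.
    split; first exact: su_frame_SU3.
    have sd := su_frame_diag bd.
    have bu : b \in unitmx by move: Fu; rewrite FE' unitmx_mul => /andP[].
    have su := su_frame_unit bu.
    rewrite FE' su_frame_unitary; last exact: SU3_unitary.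
    rewrite gU.2 rmorph1 diag3_1 mulmx1 (invmx_mul gu su).
    (* The diagonal factor commutes with [Dmx] and disappears from the conjugation. *)
    by rewrite xE; apply: (conj_commute _ su); exact/commute_Dmx.
Qed.

End FlagOrbit.

(** * Charts *)

Section SpecialLagrangianFrames.
Context {R : realType}.
Local Notation C := R[i].
Local Notation M3 := 'M[C]_3.
Local Notation B := (frame0 R).
Local Notation toC := (map_mx (real_complex R)).

Lemma complexify_mulr (X Y A : 'M[R]_3) :
  complexify (X, Y) *m toC A = complexify (X *m A, Y *m A).
Proof.
apply/matrixP => i j; rewrite mulmx3E !mxE !sum3E; apply/eqP; rewrite eq_complex /=.
by apply/andP; split; apply/eqP; ring.
Qed.

Lemma complexify_inj : injective (@complexify R).
Proof. exact: can_inj (@complexifyK R). Qed.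

Lemma gram_complexify (X Y : 'M[R]_3) : gram (complexify (X, Y)) =
  complexify (X^T *m X + Y^T *m Y, X^T *m Y - Y^T *m X).
Proof.
apply/matrixP => i j; rewrite gramE ![complexify _ _ _]mxE /=.
rewrite [(X^T *m X + _) i j]mxE [(X^T *m Y - _) i j]mxE [(- (Y^T *m X)) i j]mxE.
rewrite !mulmx3E !mxE; apply/eqP; rewrite eq_complex /=.
by apply/andP; split; apply/eqP; ring.
Qed.

Lemma toC_complexify (X : 'M[R]_3) : toC X = complexify (X, 0).
Proof. by apply/matrixP => i j; rewrite !mxE complexr0. Qed.

Lemma adj_mulmx3E (h b : M3) i j : (h^t* *m b) i j =
  (h 0 i)^* * b 0 j + (h 1 i)^* * b 1 j + (h 2%:R i)^* * b 2%:R j.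
Proof. by rewrite mulmx3E !mxE. Qed.

(* [gram b] real: the columns of [b] span a Lagrangian subspace; the phase of the
   determinant singles out the special ones, and its sign the orientation. *)
Lemma special_lagrangian_span (b : M3) (rho : R) : map_mx Num.conj (gram b) = gram b ->
  \det b = imC * rho%:C%C -> 0 < rho ->
  exists2 g, SU3 g & oriented_span b = act_oriented g (V0 R).
Proof.
move=> bR db rho0.
have i0 : (@imC R) != 0 by rewrite eq_complex negb_and /= oner_neq0 orbT.
have bu : b \in unitmx.
  by rewrite unitmxE unitfE db mulf_neq0// (fmorph_eq0 (real_complex R)) gt_eqF.
have SL := to_lagrangian_SU3 (R := R).
have [BU dB] := @frame0_lagrangian R.
pose g := su_frame b *m to_lagrangian.
have gU : SU3 g by apply: SU3_mul; [exact: su_frame_SU3|exact: SL].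
exists g; first exact: gU.
have [hU dh] := lagrangian_frame_mul gU (@frame0_lagrangian R).
have gB : g *m B = su_frame b *m diag3 1 1 imC by rewrite -!mulmxA BU mulmx1.
pose A := (g *m B)^t* *m b.
have gA : b = g *m B *m A by rewrite mul_adjK.
(* The first two rows of the transition are polynomials in real Gram entries. The last row pairs the
   columns with the cross product: it vanishes on the first two columns, and on the third gives -i r
   det b = r rho, which is real. *)
have Ar : map_mx Num.conj A = A.
  have [p [r [pc rc _ _ sE]]] := su_frameE b.
  have gc i j : (gram b i j)^* = gram b i j.
    by move/matrixP: bR => /(_ i j); rewrite mxE.
  have AE i j : A i j = ((g *m B) 0 i)^* * b 0 j + ((g *m B) 1 i)^* * b 1 j
      + ((g *m B) 2%:R i)^* * b 2%:R j by exact: adj_mulmx3E.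
  have s0 k := let: And3 h _ _ := sE k in h.
  have s1 k := let: And3 _ h _ := sE k in h.
  have s2 k := let: And3 _ _ h := sE k in h.
  have gBE k i : (g *m B) k i =
      su_frame b k i * (if i == 0 then 1 else if i == 1 then 1 else imC).
    by rewrite gB mul_diag3 mxE.
  have A0 j : A 0 j = p * gram b 0 j.
    rewrite AE !gBE /= !mulr1 !(s0 _) gramE !rmorphM /= pc; ring.
  have A1 j : A 1 j = p * r * (gram b 0 0 * gram b 1 j - gram b 0 1 * gram b 0 j).
    rewrite AE !gBE /= !mulr1 !(s1 _).
    rewrite !(rmorphM, rmorphB) /= pc rc !gc (gramE _ 1 j) (gramE _ 0 j); ring.
  have A2 j : A 2%:R j = - imC * r * (cross b 0 0 * b 0 j + cross b 1 0 * b 1 j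
      + cross b 2%:R 0 * b 2%:R j).
    rewrite AE !gBE /= !(s2 _).
    have ic : imC^* = - (@imC R) by apply/eqP; rewrite eq_complex /= oppr0 !eqxx.
    by rewrite !rmorphM /= rc ic !conjCK; ring.
  have c0 : cross b 0 0 * b 0 0 + cross b 1 0 * b 1 0 + cross b 2%:R 0 * b 2%:R 0 = 0.
    by rewrite !crossE; ring.
  have c1 : cross b 0 0 * b 0 1 + cross b 1 0 * b 1 1 + cross b 2%:R 0 * b 2%:R 1 = 0.
    by rewrite !crossE; ring.
  have c2 : cross b 0 0 * b 0 2%:R + cross b 1 0 * b 1 2%:R
      + cross b 2%:R 0 * b 2%:R 2%:R = imC * rho%:C%C.
    by rewrite -db det_cross; ring.
  have iN : - (@imC R) * imC = 1.
    by apply/eqP; rewrite eq_complex /=; apply/andP; split; apply/eqP; ring.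
  have A22 : A 2%:R 2%:R = r * rho%:C%C.
    by rewrite A2 c2 -[RHS]mul1r -iN; ring.
  have A20 : A 2%:R 0 = 0 by rewrite A2 c0 mulr0.
  have A21 : A 2%:R 1 = 0 by rewrite A2 c1 mulr0.
  have Ac0 j : (A 0 j)^* = A 0 j by rewrite A0 rmorphM /= pc gc.
  have Ac1 j : (A 1 j)^* = A 1 j.
    by rewrite A1 !(rmorphM, rmorphB) /= pc rc !gc.
  have Ac2 : (A 2%:R 2%:R)^* = A 2%:R 2%:R by rewrite A22 rmorphM /= rc conj_realC.
  by clearbody A; apply: matrix3P; rewrite [LHS]mxE ?A20 ?A21 ?rmorph0.
have E := real_mxP Ar.
rewrite /V0 act_oriented_span [in LHS]gA E oriented_span_mulr//.
rewrite -ltcR -det_toC -E; move: db; rewrite gA det_mulmx dh => /(mulfI i0) ->.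
by rewrite ltcR.
Qed.

Definition symm3 (a b c d e f : R) : 'M[R]_3 := \matrix_(i, j)
  nth 0 (nth [::] [:: [:: a; b; c]; [:: b; d; e]; [:: c; e; f]] i) j.

Lemma symm3_tr a b c d e f : (symm3 a b c d e f)^T = symm3 a b c d e f.
Proof. by apply: matrix3P; rewrite !mxE. Qed.

Lemma symm3P (H : 'M[R]_3) : H^T = H ->
  H = symm3 (H 0 0) (H 0 1) (H 0 2%:R) (H 1 1) (H 1 2%:R) (H 2%:R 2%:R).
Proof.
move=> /matrixP h; apply: matrix3P; rewrite [RHS]mxE //=.
- by have := h 0 1; rewrite mxE.
- by have := h 0 2%:R; rewrite mxE.
- by have := h 1 2%:R; rewrite mxE.
Qed.

Definition graph_mx (H : 'M[R]_3) : M3 := complexify (1%:M, H).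

(** The real part is 1 - e2(H) and the imaginary part tr H - det H, grouped so as to be linear in
    the last entry [f]. *)
Lemma det_graph_symm3 a b c d e f : \det (graph_mx (symm3 a b c d e f)) =
  Complex (1 - (a * d - b ^+ 2) - (a * f - c ^+ 2) - (d * f - e ^+ 2))
    (a + d + f * (1 - (a * d - b ^+ 2)) + a * e ^+ 2 - 2 * b * c * e + c ^+ 2 * d).
Proof.
rewrite det3E !mxE /=; apply/eqP; rewrite eq_complex /=.
by apply/andP; split; apply/eqP; ring.
Qed.

(** The imaginary part of the Gram matrix of 1 + iH is H - H^T. *)
Lemma gram_graph_symm (H : 'M[R]_3) : H^T = H ->
  map_mx Num.conj (gram (B *m graph_mx H)) = gram (B *m graph_mx H).
Proof.
move=> HT; have [BU _] := @frame0_lagrangian R.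
rewrite gram_unitary// gram_complexify trmx1 !mul1mx HT mulmx1 subrr -toC_complexify.
exact: map_conj_real.
Qed.

Local Notation x_ x k := (x 0 (inord k)).

(** The coefficient of the last entry of H in tr H - det H; where it is nonzero the equation can be
    solved for that entry. *)
Definition chart_den (x : 'rV[R]_5) : R := 1 - (x_ x 0 * x_ x 3 - x_ x 1 ^+ 2).

Definition chart_last (x : 'rV[R]_5) : R :=
  - (x_ x 0 + x_ x 3 + x_ x 0 * x_ x 4 ^+ 2 - 2 * x_ x 1 * x_ x 2 * x_ x 4
     + x_ x 2 ^+ 2 * x_ x 3) / chart_den x.

(* [tr H = det H], i.e. [Im det (1 + i H) = 0], is linear in the last entry of [H]. *)
Definition chart_symm (x : 'rV[R]_5) : 'M[R]_3 :=
  symm3 (x_ x 0) (x_ x 1) (x_ x 2) (x_ x 3) (x_ x 4) (chart_last x).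

(** The real part of det(1 + iH). Its sign must be positive for B(1 + iH) to have the phase i rather
    than -i, which would be the opposite orientation. *)
Definition chart_rho (x : 'rV[R]_5) : R :=
  1 - (x_ x 0 * x_ x 3 - x_ x 1 ^+ 2) - (x_ x 0 * chart_last x - x_ x 2 ^+ 2)
  - (x_ x 3 * chart_last x - x_ x 4 ^+ 2).

Definition chart_row (H : 'M[R]_3) : 'rV[R]_5 := \row_j
  nth 0 [:: H 0 0; H 0 1; H 0 2%:R; H 1 1; H 1 2%:R] j.

Lemma chart_symmK (x : 'rV[R]_5) : chart_row (chart_symm x) = x.
Proof.
apply/rowP => -[[|[|[|[|[|//]]]]] hj]; rewrite mxE /= mxE /=; congr (x 0 _);
  by apply: val_inj; rewrite /= inordK.
Qed.

Lemma det_chart_symm x : chart_den x != 0 ->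
  \det (graph_mx (chart_symm x)) = (chart_rho x)%:C%C.
Proof.
move=> d0; rewrite /chart_symm det_graph_symm3; apply/eqP; rewrite eq_complex eqxx /=.
by move: d0; rewrite /chart_last /chart_den => d0; apply/eqP; field.
Qed.

(** Reality of the determinant is a linear equation for the last entry, and [chart_last] is its only
    solution. *)
Lemma chart_rowK (H : 'M[R]_3) (rho : R) : H^T = H ->
  \det (graph_mx H) = rho%:C%C -> 0 < 1 - (H 0 0 * H 1 1 - H 0 1 ^+ 2) ->
  chart_symm (chart_row H) = H /\ chart_rho (chart_row H) = rho.
Proof.
move=> HT dH d0; have nd : 1 - (H 0 0 * H 1 1 - H 0 1 ^+ 2) != 0 by rewrite gt_eqF.
have e k (hk : (k < 5)%N) : chart_row H 0 (inord k) =
    nth 0 [:: H 0 0; H 0 1; H 0 2%:R; H 1 1; H 1 2%:R] k by rewrite mxE inordK.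
have e0 := e 0 isT; have e1 := e 1 isT; have e2 := e 2 isT; have e3 := e 3 isT.
have e4 := e 4 isT.
move: dH; rewrite {1}(symm3P HT) det_graph_symm3 => -[dr di].
have l : chart_last (chart_row H) = H 2%:R 2%:R.
  rewrite /chart_last /chart_den e0 e1 e2 e3 e4 /=; apply: (mulIf nd).
  rewrite divfK//; apply/eqP; rewrite -subr_eq0 -oppr_eq0 -[X in _ == X]di; apply/eqP; ring.
split; last by rewrite /chart_rho l e0 e1 e2 e3 e4.
by rewrite /chart_symm l e0 e1 e2 e3 e4 /= -symm3P.
Qed.

(** Reality of the Gram matrix of X + iY says X^T Y = Y^T X, which is symmetry of Y X^-1. *)
Lemma lagrangian_graph (X Y : 'M[R]_3) (rho : R) :
  map_mx Num.conj (gram (complexify (X, Y))) = gram (complexify (X, Y)) ->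
  \det (complexify (X, Y)) = rho%:C%C -> 0 < rho -> 0 < \det X ->
  let H := Y *m invmx X in
  [/\ H^T = H, complexify (X, Y) = graph_mx H *m toC X &
      \det (graph_mx H) = (rho / \det X)%:C%C].
Proof.
move=> G dM r0 dX H; have Xu : X \in unitmx by rewrite unitmxE unitfE gt_eqF.
have YE : Y = H *m X by rewrite mulmxKV.
have ME : complexify (X, Y) = graph_mx H *m toC X by rewrite complexify_mulr mul1mx -YE.
have XY : X^T *m Y = Y^T *m X.
  have /matrixP g := G; apply/matrixP => i j; have := g i j.
  rewrite gram_complexify mxE [complexify _ i j]mxE /= => -[].
  move=> /eqP; rewrite eqNr [X in X == 0]mxE [X in _ + X]mxE subr_eq0 => /eqP.
  done.
have XTu : X^T \in unitmx by rewrite unitmx_tr.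
split => //.
  rewrite /H trmx_mul trmx_inv; apply: (can_inj (mulKmx XTu)).
  rewrite mulKVmx// mulmxA XY mulmxK//.
apply: (mulIf (x := (\det X)%:C%C)); first by rewrite (fmorph_eq0 (real_complex R)) gt_eqF.
by rewrite -[in LHS]det_toC -det_mulmx -ME dM -rmorphM /= divfK// gt_eqF.
Qed.

End SpecialLagrangianFrames.

Section RealSmooth.
Context {R : realType} {V : normedModType R} (U : set V) (oU : open U).
Implicit Types f g : V -> R.

Lemma Cinfty_cst (c : R) : Cinfty U (fun _ => c).
Proof. by move=> k; exact: Ck_cst. Qed.

Lemma CinftyD f g : Cinfty U f -> Cinfty U g -> Cinfty U (fun x => f x + g x).
Proof. by move=> hf hg k; exact: Ck_add. Qed.

Lemma CinftyM f g : Cinfty U f -> Cinfty U g -> Cinfty U (fun x => f x * g x).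
Proof. by move=> hf hg k; exact: (Ck_scale oU (hf k) (hg k)). Qed.

Lemma CinftyN f : Cinfty U f -> Cinfty U (fun x => - f x).
Proof.
move=> hf k; apply: Ck_ext (CinftyM (Cinfty_cst (-1)) hf k) => // x _.
by rewrite mulN1r.
Qed.

Lemma CinftyB f g : Cinfty U f -> Cinfty U g -> Cinfty U (fun x => f x - g x).
Proof. by move=> hf hg; apply: CinftyD => //; exact: CinftyN. Qed.

Lemma CinftyX2 f : Cinfty U f -> Cinfty U (fun x => f x ^+ 2).
Proof. by move=> hf; exact: CinftyM. Qed.

Lemma CinftyV f : (forall x, U x -> f x != 0) -> Cinfty U f ->
  Cinfty U (fun x => (f x)^-1).
Proof. by move=> f0 hf k; apply: Ck_inv. Qed.

Lemma mxsmooth_Re m n (f : V -> 'M[R[i]]_(m, n)) : mxsmooth U f ->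
  mxsmooth U (fun x => map_mx (real_complex R) (map_mx (@complex.Re R) (f x))).
Proof.
move=> hf i j; apply: csmooth_ext (csmooth_real (hf i j).1) => // x _.
by rewrite !mxE.
Qed.

Lemma mxsmooth_Im m n (f : V -> 'M[R[i]]_(m, n)) : mxsmooth U f ->
  mxsmooth U (fun x => map_mx (real_complex R) (map_mx (@complex.Im R) (f x))).
Proof.
move=> hf i j; apply: csmooth_ext (csmooth_real (hf i j).2) => // x _.
by rewrite !mxE.
Qed.

End RealSmooth.

(** * The chart of special Lagrangian subspaces by graphs *)

Section LagrangianChart.
Context {R : realType}.
Local Notation C := R[i].
Local Notation M3 := 'M[C]_3.
Local Notation B := (frame0 R).
Local Notation toC := (map_mx (real_complex R)).

(** The adjoint of B is its inverse, so the frame is read in coordinates in which [V0] becomes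
    R^3. *)
Definition lag_re (e : M3R R) : 'M[R]_3 :=
  map_mx (@complex.Re R) (B^t* *m complexify e).
Definition lag_im (e : M3R R) : 'M[R]_3 :=
  map_mx (@complex.Im R) (B^t* *m complexify e).

(* [H] such that the subspace framed by [e] is the graph [B (x + i H x)]. *)
Definition lag_slope (e : M3R R) : 'M[R]_3 := lag_im e *m invmx (lag_re e).

Definition slope_den (H : 'M[R]_3) : R := 1 - (H 0 0 * H 1 1 - H 0 1 ^+ 2).

Definition chart_domain : set 'rV[R]_5 := [set x | (setT x /\ 0 < chart_den x) /\ 0 < chart_rho x].

(** The sign of the determinant, not just its nonvanishing, is prescribed: projection to [V0] along
    i V0 must preserve orientation. *)
Definition graph_domain1 : set (M3R R) := [set e | setT e /\ 0 < \det (lag_re e)].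
Definition graph_domain : set (M3R R) :=
  [set e | graph_domain1 e /\ 0 < slope_den (lag_slope e)].

Definition lag_chart (x : 'rV[R]_5) : oriented R := oriented_span (B *m graph_mx (chart_symm x)).

Lemma chart_den_row (H : 'M[R]_3) : chart_den (chart_row H) = slope_den H.
Proof. by rewrite /chart_den /slope_den !mxE !inordK. Qed.

Lemma slope_den_symm x : slope_den (chart_symm x) = chart_den x.
Proof. by rewrite /slope_den /chart_den !mxE. Qed.

Lemma lag_partsE e : B^t* *m complexify e = complexify (lag_re e, lag_im e).
Proof. by rewrite -[LHS]realifyK. Qed.

Lemma mulmx_adj_frame0 (b : M3) : B^t* *m (B *m b) = b.
Proof. by have [BU _] := @frame0_lagrangian R; rewrite mulmxA BU mul1mx. Qed.

Lemma lag_chart_carrier x : chart_domain x -> @carrier R (SLGr R) (lag_chart x).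
Proof.
move=> [[_ d0] r0]; have [_ dB] := @frame0_lagrangian R.
apply/(hom_carrier (homogeneous_SLGr (R := R))).
have [||//|g gU gE] := @special_lagrangian_span R (B *m graph_mx (chart_symm x)) (chart_rho x).
- by apply: gram_graph_symm; exact: symm3_tr.
- by rewrite det_mulmx dB det_chart_symm// gt_eqF.
by exists g.
Qed.

(** Any frame of the graph is B(1 + iH)A with A real, so its parts are A and HA and the slope HA
    A^-1 does not depend on the frame. *)
Lemma lag_chart_span e x : oriented_span (complexify e) = lag_chart x ->
  [/\ 0 < \det (lag_re e), lag_slope e = chart_symm x &
      graph_domain1 e].
Proof.
move=> /oriented_spanP [A dA eA].
have Au : A \in unitmx by rewrite unitmxE unitfE gt_eqF.
have := lag_partsE e; rewrite eA -mulmxA mulmx_adj_frame0 complexify_mulr mul1mx.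
move=> /complexify_inj [AX AY].
by rewrite /graph_domain1 /= /lag_slope -AX -AY mulmxK.
Qed.

Lemma lag_chart_inj : injective lag_chart.
Proof.
move=> x y h; have [_ hx _] := @lag_chart_span (realify (B *m graph_mx (chart_symm x))) x
  (congr1 _ (realifyK _)).
have [_ hy _] := @lag_chart_span (realify (B *m graph_mx (chart_symm x))) y
  (etrans (congr1 _ (realifyK _)) h).
by rewrite -(chart_symmK x) -hx hy chart_symmK.
Qed.

(** A frame of a point of the orbit is g B A. Hence B^-1 applied to it has a real Gram matrix and
    the determinant conj(i) i det A, which is positive, and its slope satisfies the equations of the
    chart. *)
Lemma lag_chart_surj e : @carrier R (SLGr R) (oriented_span (complexify e)) ->
  graph_domain e -> chart_domain (chart_row (lag_slope e)) /\
    lag_chart (chart_row (lag_slope e)) = oriented_span (complexify e).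
Proof.
have BL := @frame0_lagrangian R.
move=> /(hom_carrier (homogeneous_SLGr (R := R))) [g gU]; rewrite /= /V0 act_oriented_span.
move=> /oriented_spanP [A dA eA] [[_ dX] dd].
have gL := lagrangian_frame_mul gU BL.
have BaU := unitary_gram_adj BL.1.
have G : gram (complexify (lag_re e, lag_im e)) = gram (toC A).
  by rewrite -lag_partsE (gram_unitary _ BaU) eA (gram_unitary _ gL.1).
have GR : map_mx Num.conj (gram (complexify (lag_re e, lag_im e))) =
    gram (complexify (lag_re e, lag_im e)).
  rewrite G toC_complexify gram_complexify !trmx0 !(mulmx0, mul0mx) subrr -toC_complexify.
  exact: map_conj_real.
have dM : \det (complexify (lag_re e, lag_im e)) = (\det A)%:C%C.
  rewrite -lag_partsE det_mulmx det_adj BL.2 eA det_mulmx gL.2 det_toC mulrA.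
  rewrite [X in X * _](_ : _ = 1) ?mul1r//.
  by apply/eqP; rewrite eq_complex /=; apply/andP; split; apply/eqP; ring.
have [HT ME dH] := lagrangian_graph GR dM dA dX.
have [sE rE] := chart_rowK HT dH dd.
split; first by split; [split => //; rewrite chart_den_row|rewrite rE divr_gt0].
rewrite /lag_chart sE -(oriented_span_mulr _ dX) -mulmxA -ME -lag_partsE.
by rewrite (mul_adjK _ BL.1).
Qed.

Lemma mxsmooth_lag (U : set (M3R R)) : open U ->
  mxsmooth U (fun e => B^t* *m complexify e).
Proof.
by move=> oU; apply: mxsmoothM => //; [exact: mxsmooth_cst|exact: mxsmooth_complexify].
Qed.

Lemma open_graph_domain1 : open graph_domain1.
Proof.
apply: open_Cinfty_gt0 openT _ => k.
have := (csmooth_det openT (mxsmooth_Re openT (mxsmooth_lag openT))).1 k.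
by apply: Ck_ext openT _ => x _; rewrite det_toC.
Qed.

Lemma Cinfty_lag_slope i j : Cinfty graph_domain1 (fun e => lag_slope e i j).
Proof.
have o1 := open_graph_domain1.
have s : mxsmooth graph_domain1 (fun e => toC (lag_im e) *m invmx (toC (lag_re e))).
  apply: mxsmoothM => //; first exact: (mxsmooth_Im o1 (mxsmooth_lag o1)).
  apply: mxsmoothV => //; last exact: (mxsmooth_Re o1 (mxsmooth_lag o1)).
  by move=> e [_ d]; rewrite toC_unit unitmxE unitfE gt_eqF.
move=> k; apply: Ck_ext o1 _ ((s i j).1 k) => e _.
by rewrite -map_invmx -map_real_mul mxE.
Qed.

Lemma open_graph_domain : open graph_domain.
Proof.
have o1 := open_graph_domain1; apply: (open_Cinfty_gt0 o1).
apply: CinftyB => //; first exact: Cinfty_cst.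
apply: CinftyB => //; last by apply: CinftyX2 => //; exact: Cinfty_lag_slope.
by apply: CinftyM => //; exact: Cinfty_lag_slope.
Qed.

Let dom1 : set 'rV[R]_5 := [set x | setT x /\ 0 < chart_den x].

Lemma Cinfty_chart_den (U : set 'rV[R]_5) : open U -> Cinfty U chart_den.
Proof.
move=> oU; apply: CinftyB => //; first exact: Cinfty_cst.
apply: CinftyB => //; last by apply: CinftyX2 => //; exact: Cinfty_coord.
by apply: CinftyM => //; exact: Cinfty_coord.
Qed.

Let open_dom1 : open dom1.
Proof. exact: open_Cinfty_gt0 openT (Cinfty_chart_den openT). Qed.

Let Cinfty_chart_last : Cinfty dom1 chart_last.
Proof.
have o1 := open_dom1.
have c k : Cinfty dom1 (fun x => x 0 (inord k)) by exact: Cinfty_coord.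
apply: CinftyM => //; last first.
  by apply: CinftyV => //; [move=> x [_]; exact: lt0r_neq0|exact: Cinfty_chart_den].
apply: CinftyN => //; apply: CinftyD => //; last first.
  by apply: CinftyM => //; exact: CinftyX2.
apply: CinftyB => //; last first.
  by do 3! (apply: CinftyM => //); exact: Cinfty_cst.
apply: CinftyD => //; first exact: CinftyD.
by apply: CinftyM => //; exact: CinftyX2.
Qed.

Lemma open_chart_domain : open chart_domain.
Proof.
have o1 := open_dom1; apply: (open_Cinfty_gt0 o1).
have c k : Cinfty dom1 (fun x => x 0 (inord k)) by exact: Cinfty_coord.
have l := Cinfty_chart_last.
apply: CinftyB => //; last by apply: CinftyB => //; [exact: CinftyM|exact: CinftyX2].
apply: CinftyB => //; last by apply: CinftyB => //; [exact: CinftyM|exact: CinftyX2].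
apply: CinftyB => //; first exact: Cinfty_cst.
by apply: CinftyB => //; [exact: CinftyM|exact: CinftyX2].
Qed.

Lemma mxsmooth_graph_chart : mxsmooth chart_domain (fun x => B *m graph_mx (chart_symm x)).
Proof.
have oV := open_chart_domain.
apply: mxsmoothM => //; first exact: mxsmooth_cst.
have c k : Cinfty chart_domain (fun x => x 0 (inord k)) by exact: Cinfty_coord.
have l : Cinfty chart_domain chart_last.
  by move=> k; apply: Ck_sub (Cinfty_chart_last k) => x [].
have cs (d : R) h : Cinfty chart_domain h -> csmooth chart_domain (fun x => Complex d (h x)).
  by move=> hs; split; [exact: Cinfty_cst|exact: hs].
apply: ord3P; apply: ord3P.
- by apply: (csmooth_ext oV _ (cs 1 _ (c 0%N))) => x _; rewrite !mxE.
- by apply: (csmooth_ext oV _ (cs 0 _ (c 1%N))) => x _; rewrite !mxE.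
- by apply: (csmooth_ext oV _ (cs 0 _ (c 2%N))) => x _; rewrite !mxE.
- by apply: (csmooth_ext oV _ (cs 0 _ (c 1%N))) => x _; rewrite !mxE.
- by apply: (csmooth_ext oV _ (cs 1 _ (c 3%N))) => x _; rewrite !mxE.
- by apply: (csmooth_ext oV _ (cs 0 _ (c 4%N))) => x _; rewrite !mxE.
- by apply: (csmooth_ext oV _ (cs 0 _ (c 2%N))) => x _; rewrite !mxE.
- by apply: (csmooth_ext oV _ (cs 0 _ (c 4%N))) => x _; rewrite !mxE.
- by apply: (csmooth_ext oV _ (cs 1 _ l)) => x _; rewrite !mxE.
Qed.

Lemma chart_SLGr : @chart_at R (base_space (SLGr R)) (@carrier R (SLGr R)) (V0 R) 5.
Proof.
have oV := open_chart_domain.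
have z k : (0 : 'rV[R]_5) 0 k = 0 by rewrite mxE.
have l0 : chart_last (0 : 'rV[R]_5) = 0.
  by rewrite /chart_last !z !(mul0r, mulr0, addr0, subr0, oppr0).
have sym0 : chart_symm (0 : 'rV[R]_5) = 0.
  by rewrite /chart_symm l0; apply: matrix3P; rewrite !mxE.
have phi0 : lag_chart 0 = V0 R.
  rewrite /lag_chart sym0 /V0; congr oriented_span; rewrite -[RHS]mulmx1; congr (_ *m _).
  by apply: matrix3P; rewrite !mxE.
have V_0 : chart_domain 0.
  rewrite /chart_domain /= /chart_rho /chart_den l0 !z.
  by rewrite !(expr0n, mul0r, mulr0, addr0, subr0, oppr0) /= ?subr0 ltr01.
(* Every frame of a point of the chart lies in [graph_domain] and returns the same coordinates; this
   gives both the openness of the image and the smooth inverse. *)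
have OE e v : chart_domain v -> lag_chart v = oriented_span (complexify e) ->
    graph_domain e /\ chart_row (lag_slope e) = v.
  move=> [[_ d0] r0] /esym /lag_chart_span [dX sE g1].
  by rewrite /graph_domain /= sE slope_den_symm chart_symmK.
exists (lag_chart @` chart_domain), chart_domain, lag_chart; split.
- by exists 0.
- split=> [_ [v Vv <-]|]; first exact: lag_chart_carrier.
  exists graph_domain; split; first exact: open_graph_domain.
  move=> e _ ce; split=> [[v Vv h]|h]; first by case: (OE e v Vv h).
  have [dc h'] := lag_chart_surj ce h.
  by exists (chart_row (lag_slope e)).
- exact: oV.
- split.
  + by split => [v Vv|v w _ _|_ [v Vv <-]]; [exists v|exact: lag_chart_inj|exists v].
  + move=> v _ Vv; exists chart_domain, (fun x => realify (B *m graph_mx (chart_symm x))).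
    split; [exact: oV|exact: Vv|exact: (Cinfty_realify oV mxsmooth_graph_chart)|].
    move=> w Vw _ _; rewrite /= realifyK; split => //; apply: real_frame_unit.
    have [_ dB] := @frame0_lagrangian R.
    have [[_ d0] r0] := Vw.
    rewrite unitmx_mul (lagrangian_frame_unit (@frame0_lagrangian R)) unitmxE unitfE.
    by rewrite det_chart_symm ?(fmorph_eq0 (real_complex R)) gt_eqF.
  + pose psi F := xget 0 [set v | chart_domain v /\ lag_chart v = F].
    have psiK v : chart_domain v -> psi (lag_chart v) = v.
      move=> Vv; rewrite /psi; case: xgetP => [w _ [_ /lag_chart_inj]//|h].
      by case: (h v).
    exists psi; split=> [v Vv|e _ [v Vv h]]; first exact: psiK.
    exists graph_domain, (fun e => chart_row (lag_slope e)); split.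
    * exact: open_graph_domain.
    * by case: (OE e v Vv h).
    * apply: Cinfty_rV; first exact: open_graph_domain.
      have s i j : Cinfty graph_domain (fun e => lag_slope e i j).
        by move=> k; apply: Ck_sub (Cinfty_lag_slope i j k) => x [].
      move=> [[|[|[|[|[|//]]]]] hj] k;
        [have := s 0 0 k|have := s 0 1 k|have := s 0 2%:R k|have := s 1 1 k|have := s 1 2%:R k];
        move=> hk; apply: Ck_ext open_graph_domain _ hk => x _; by rewrite [RHS]mxE.
    * move=> e' _ _ [w Vw h']; split => //=.
      have [_ ->] := OE e' w Vw h'.
      by transitivity (psi (lag_chart w)); [rewrite psiK|rewrite h'].
Qed.

End LagrangianChart.

(** * The big cell as a chart of the flag manifold *)

Section FlagChart.
Context {R : realType}.
Local Notation C := R[i].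
Local Notation M3 := 'M[C]_3.

(** Entries 2k and 2k+1 of the row are the real and imaginary parts of the k-th complex
    coordinate. *)
Definition cell_coord (v : 'rV[R]_6) (k : nat) : C :=
  Complex (v 0 (inord k.*2)) (v 0 (inord k.*2.+1)).

Definition cell_row (x y z : C) : 'rV[R]_6 := \row_j
  nth 0 [:: complex.Re x; complex.Im x; complex.Re y; complex.Im y;
            complex.Re z; complex.Im z] j.

Definition cell_mx (x y z : C) : M3 :=
  mx3 [:: [:: 1; 0; 0]; [:: x; 1; 0]; [:: y; z; 1]].

Definition cell_of (v : 'rV[R]_6) : M3 :=
  cell_mx (cell_coord v 0) (cell_coord v 1) (cell_coord v 2).

Lemma cell_rowK (x y z : C) :
  [/\ cell_coord (cell_row x y z) 0 = x, cell_coord (cell_row x y z) 1 = y &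
      cell_coord (cell_row x y z) 2 = z].
Proof.
case: x y z => [a b] [c d] [e f].
by split; rewrite /cell_coord !mxE !inordK.
Qed.

Lemma cell_coordK (v : 'rV[R]_6) :
  cell_row (cell_coord v 0) (cell_coord v 1) (cell_coord v 2) = v.
Proof.
apply/rowP => -[[|[|[|[|[|[|//]]]]]] hj]; rewrite mxE /=; congr (v 0 _);
  by apply: val_inj; rewrite /= inordK.
Qed.

Lemma cell_mx_unit (x y z : C) : cell_mx x y z \in unitmx.
Proof.
rewrite unitmxE unitfE det3E !mx3E !(mulr0, mul0r, mulr1, mul1r, subr0, addr0).
exact: oner_neq0.
Qed.

Definition minor2 (b : M3) : C := b 0 0 * b 1 1 - b 0 1 * b 1 0.

(** LU factorization: when both leading minors are nonzero, column operations that preserve the flag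
    reduce [b] to unipotent lower triangular form, whose entries are these quotients of minors. *)
Lemma cell_flag (b : M3) : b 0 0 != 0 -> minor2 b != 0 ->
  flag_of b = flag_of (cell_mx (b 1 0 / b 0 0) (b 2%:R 0 / b 0 0)
    ((b 0 0 * b 2%:R 1 - b 2%:R 0 * b 0 1) / minor2 b)).
Proof.
move=> b0 m0; apply: (@flag_of_cols _ _ _ (b 0 0) (b 0 1) (minor2 b / b 0 0)) => //.
- by rewrite mulf_neq0// invr_eq0.
- apply/matrixP => i j; rewrite !mxE {j}; move: i; apply: ord3P; rewrite /=; field => //.
- apply/matrixP => i j; rewrite !mxE {j}; move: m0; rewrite /minor2 => m0.
  by move: i; apply: ord3P; rewrite /=; field; rewrite ?b0 ?m0.
Qed.

(** Writing b as the cell matrix times an upper triangular T, the leading minors of b are those of T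
    and cancel in the quotients, so the coordinates depend only on the flag. *)
Lemma flag_of_cell (b : M3) (x y z : C) : b \in unitmx ->
  flag_of b = flag_of (cell_mx x y z) ->
  [/\ b 0 0 != 0, minor2 b != 0, x = b 1 0 / b 0 0, y = b 2%:R 0 / b 0 0 &
      z = (b 0 0 * b 2%:R 1 - b 2%:R 0 * b 0 1) / minor2 b].
Proof.
move=> bu e; have lu := cell_mx_unit x y z.
pose T := invmx (cell_mx x y z) *m b.
have uT : upper3 T by exact: flag_of_eq.
have Tu : T \in unitmx by rewrite unitmx_mul unitmx_inv lu.
have bE : b = cell_mx x y z *m T by rewrite /T (mulKVmx lu).
clearbody T; have [t0 t1] := upper3_unit uT Tu; have [h1 h2 h3] := uT.
have m : minor2 b = T 0 0 * T 1 1.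
  by rewrite /minor2 bE !mulmx3E !mx3E h1 h2 h3; ring.
have b0 : b 0 0 = T 0 0 by rewrite bE mulmx3E !mx3E h1 h2; ring.
rewrite m b0; split => //; first by rewrite mulf_neq0.
- by rewrite bE mulmx3E !mx3E h1 h2; field.
- by rewrite bE mulmx3E !mx3E h1 h2; field.
- by rewrite bE !mulmx3E !mx3E h1 h2 h3; field; rewrite t0 t1.
Qed.

Lemma csmooth_cell_coord (U : set 'rV[R]_6) k : csmooth U (fun v => cell_coord v k).
Proof. by split; exact: Cinfty_coord. Qed.

Lemma chart_Fl2 : @chart_at R (base_space (Fl2 R)) (@carrier R (Fl2 R)) (flag_of 1%:M) 6.
Proof.
pose phi v := flag_of (cell_of v).
have phi_inj v w : phi v = phi w -> v = w.
  move=> e; have [|_ _ x1 y1 z1] := flag_of_cell _ e; first exact: cell_mx_unit.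
  have [|_ _ x2 y2 z2] := flag_of_cell _ (esym e); first exact: cell_mx_unit.
  rewrite -(cell_coordK v) -(cell_coordK w) x1 y1 z1 /cell_of.
  by rewrite /minor2 !mx3E; congr cell_row; field.
have ev0 : cell_of 0 = 1%:M.
  by apply: matrix3P; rewrite mx3E !mxE//; apply/eqP; rewrite eq_complex /= !mxE eqxx.
pose W := [set e : M3R R | setT e /\ complexify e 0 0 != 0].
pose W' := [set e : M3R R | W e /\ minor2 (complexify e) != 0].
have sE i j (U : set (M3R R)) : csmooth U (fun e => complexify e i j).
  exact: mxsmooth_complexify.
have oW : open W by apply: open_csmooth_neq0 openT _; exact: sE.
have sm (U : set (M3R R)) : open U -> csmooth U (fun e => minor2 (complexify e)).
  by move=> oU; apply: csmoothB => //; apply: csmoothM.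
have oW' : open W' by exact: open_csmooth_neq0 oW (sm _ oW).
pose crd e := let b := complexify e in cell_row (b 1 0 / b 0 0) (b 2%:R 0 / b 0 0)
    ((b 0 0 * b 2%:R 1 - b 2%:R 0 * b 0 1) / minor2 b).
have crdP e : W' e -> flag_of (complexify e) = phi (crd e).
  move=> [[_ e0] m0]; rewrite [LHS]cell_flag// /phi /cell_of /crd.
  by have [-> -> ->] := cell_rowK (complexify e 1 0 / complexify e 0 0)
    (complexify e 2%:R 0 / complexify e 0 0)
    ((complexify e 0 0 * complexify e 2%:R 1 - complexify e 2%:R 0 * complexify e 0 1)
     / minor2 (complexify e)).
have WP e v : complexify e \in unitmx -> flag_of (complexify e) = phi v -> W' e.
  by move=> eu h; have [] := flag_of_cell eu h.
exists (range phi), setT, phi; split.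
- by exists 0; rewrite // /phi ev0.
- split=> [_ [v _ <-]|]; first by apply: flag_dims; exact: cell_mx_unit.
  exists W'; split => // e eu _; split=> [[v _ h]|h]; first by apply: WP (esym h).
  by exists (crd e) => //; rewrite -crdP.
- exact: openT.
- split.
  + split => [v _|v w _ _|_ [v _ <-]]; [by exists v|exact: phi_inj|by exists v].
  + move=> v _ _; exists setT, (fun v => realify (cell_of v)); split => //.
    * exact: openT.
    * apply: (Cinfty_realify openT (f:=cell_of)).
      by apply: (mxsmooth_mx3 openT); try exact: csmooth_cst; exact: csmooth_cell_coord.
    * by move=> w _ _ _; rewrite /= realifyK; split => //; exact: cell_mx_unit.
  + pose g F := xget 0 [set v | F = phi v].
    have gphi v : g (phi v) = v.
      by rewrite /g; case: xgetP => [w _ e|h]; [exact/esym/phi_inj|case: (h v)].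
    exists g; split=> [v _|e eu [v _ h]]; first exact: gphi.
    exists W', crd; split => //; first exact: WP (esym h).
      have s1 i : csmooth W' (fun e => complexify e i 0 / complexify e 0 0).
        by apply: csmoothM => //; apply: csmoothV => // x [[_]].
      have s2 : csmooth W' (fun e => (complexify e 0 0 * complexify e 2%:R 1
          - complexify e 2%:R 0 * complexify e 0 1) / minor2 (complexify e)).
        apply: csmoothM => //; first by apply: csmoothB => //; apply: csmoothM.
        by apply: csmoothV => //; [move=> x []|exact: sm].
      apply: Cinfty_rV => // -[[|[|[|[|[|[|//]]]]]] hj] k;
        [have := (s1 1).1 k|have := (s1 1).2 k|have := (s1 2%:R).1 k
        |have := (s1 2%:R).2 k|have := s2.1 k|have := s2.2 k];
        move=> hk; apply: Ck_ext hk => // x _; by rewrite [RHS]mxE.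
    by move=> e' We' eu' _; split => //; rewrite /= crdP// gphi.
Qed.

End FlagChart.

(** * The stabilizers as closed subgroups *)

Section ClosedSubgroups.
Context {R : realType}.
Local Notation C := R[i].
Local Notation M3 := 'M[C]_3.

Lemma closed_csmooth_eq0 (f : M3R R -> C) : csmooth setT f -> closed [set e | f e = 0].
Proof.
move=> sf; have o := open_csmooth_neq0 openT sf; rewrite -openC.
congr open : o; apply/seteqP; split=> e /=; first by move=> [_ /eqP].
by move=> /eqP.
Qed.

Lemma closed_mxsmooth_eq0 m n (f : M3R R -> 'M[C]_(m, n)) : mxsmooth setT f ->
  closed [set e | f e = 0].
Proof.
move=> sf; have -> : [set e | f e = 0] =
    \bigcap_(ij in [set: 'I_m * 'I_n]) [set e | f e ij.1 ij.2 = 0].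
  apply/seteqP; split=> e /=; first by move=> h ij _ /=; rewrite h mxE.
  by move=> h; apply/matrixP => i j; rewrite mxE; exact: (h (i, j)).
by apply: closed_bigI => ij _; apply: closed_csmooth_eq0; exact: sf.
Qed.

Lemma realify_image (K : set M3) : @realify R @` K = [set e | K (complexify e)].
Proof.
apply/seteqP; split=> [_ [g Kg <-]|e Ke]; first by rewrite /= realifyK.
by exists (complexify e) => //; rewrite complexifyK.
Qed.

Lemma closed_SU3_eq (f : M3R R -> M3) : mxsmooth setT f ->
  closed (@realify R @` [set g | SU3 g /\ f (realify g) = 0]).
Proof.
move=> sf; rewrite realify_image.
have oT := @openT (M3R R); have sc := @mxsmooth_complexify R setT.
have -> : [set e | SU3 (complexify e) /\ f (realify (complexify e)) = 0] =
    [set e | complexify e *m (complexify e)^t* + (-1)%:M = 0] `&`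
    [set e | \det (complexify e) + -1 = 0] `&` [set e | f e = 0].
  apply/seteqP; split=> e /=; rewrite complexifyK.
    move=> [/SU3P [h1 h2] h3]; split => //; split; last by rewrite h2 subrr.
    by rewrite h1 -raddfD subrr raddf0.
  move=> [[h1 h2] h3]; split => //; apply/SU3P; split; last exact: subr0_eq.
  by apply: subr0_eq; rewrite -[RHS]h1 raddfN.
apply: closedI; last exact: closed_mxsmooth_eq0.
apply: closedI.
  apply: closed_mxsmooth_eq0; apply: mxsmoothD => //; last exact: mxsmooth_cst.
  by apply: mxsmoothM => //; apply: mxsmooth_conj => //; exact: mxsmooth_tr.
apply: closed_csmooth_eq0; apply: csmoothD => //; last exact: csmooth_cst.
exact: csmooth_det.
Qed.

Lemma closed_SO_group : closed (@realify R @` SO_group).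
Proof.
pose f (e : M3R R) := complexify e *m swapmx *m (complexify e)^T + - swapmx.
have := @closed_SU3_eq f; rewrite (_ : [set g | _] = SO_group); first apply.
  apply: mxsmoothD; [exact: openT| |exact: mxsmooth_cst].
  apply: mxsmoothM; [exact: openT|exact: mxsmooth_complexify_mull openT|].
  by apply: mxsmooth_tr; [exact: openT|exact: mxsmooth_complexify].
apply/seteqP; split=> g [gU]; rewrite /f /= realifyK => h; split => //.
  exact: subr0_eq.
by rewrite h subrr.
Qed.

Lemma closed_D3 : closed (@realify R @` D3 R).
Proof.
pose f (e : M3R R) := complexify e *m @Dmx R + - 1 *: (@Dmx R *m complexify e).
have := @closed_SU3_eq f; rewrite (_ : [set g | _] = D3 R); first apply.
  apply: mxsmoothD; [exact: openT|exact: mxsmooth_complexify_mull openT|].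
  apply: mxsmoothZ; [exact: openT|exact: csmooth_cst|].
  by apply: mxsmoothM; [exact: openT|exact: mxsmooth_cst|exact: mxsmooth_complexify].
apply/seteqP; split=> g [gU]; rewrite /f /= realifyK => h; split => //.
  by apply/commute_Dmx/subr0_eq; rewrite -scaleN1r.
by move/commute_Dmx: h => ->; rewrite scaleN1r subrr.
Qed.

End ClosedSubgroups.

Section SineSmooth.
Context {R : realType}.

(** Differentiation only adds pi/2 to the phase, so the family over all [b] is closed under it and
    the induction is run with [b] general. The cosine is the case b = pi/2. *)
Lemma Cinfty_sin (U : set R) (a b : R) : open U -> Cinfty U (fun t : R => sin (a * t + b)).
Proof.
move=> oU; have d (c t : R) : is_derive t 1 (fun t : R => sin (a * t + c)) (a * sin (a * t + (c + pi / 2))).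
  have -> : sin (a * t + (c + pi / 2)) = cos (a * t + c).
    by rewrite addrA sinDpihalf.
  have h : is_derive t 1 (fun t : R => a * t + c) a.
    by apply: is_derive_eq; rewrite addr0 /GRing.scale /= mulr1.
  have := @is_derive1_comp R (@sin R) (fun t => a * t + c) t _ _ (is_derive_sin _) h.
  by rewrite mulrC.
have df (c t : R) : differentiable (fun t : R => sin (a * t + c)) t.
  by apply/derivable1_diffP; have [] := d c t.
move=> k; elim: k b => [|k IH] b; first by move=> t _; exact: differentiable_continuous.
split=> [t _|v]; first exact: df.
have -> : (fun t => 'D_v (fun t : R => sin (a * t + b)) t) =
    (fun t => (v * a) *: sin (a * t + (b + pi / 2))).
  apply/funext => t; rewrite deriveE// diff1E// derive1E.
  by rewrite (@derive_val _ _ _ _ _ _ _ (d b t)) /GRing.scale /= mulrA.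
by apply: Ck_scale => //; exact: Ck_cst.
Qed.

End SineSmooth.

(** * Rotations and Euler angles *)

Section Rotations.
Context {R : realType}.
Local Notation toC := (map_mx (real_complex R)).

Definition rmx3 (a b c d e f g h k : R) : 'M[R]_3 := \matrix_(i, j)
  nth 0 (nth [::] [:: [:: a; b; c]; [:: d; e; f]; [:: g; h; k]] i) j.

Definition rot12 (c s : R) := rmx3 c (- s) 0 s c 0 0 0 1.
Definition rot13 (c s : R) := rmx3 c 0 (- s) 0 1 0 s 0 c.
Definition rot23 (c s : R) := rmx3 1 0 0 0 c (- s) 0 s c.

(** acos p has the right cosine and the sine |q|; the sign of q selects the angle or its
    opposite. *)
Lemma circle_angle (p q : R) : p ^+ 2 + q ^+ 2 = 1 ->
  exists t, p = cos t /\ q = sin t.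
Proof.
move=> pq; have p1 : -1 <= p <= 1.
  rewrite -ler_norml -(@ler_sqr _ `|p|) ?nnegrE// real_normK ?num_real// expr1n -pq.
  by rewrite lerDl sqr_ge0.
have ca : cos (acos p) = p by rewrite acosK// in_itv.
have sa : sin (acos p) = `|q|.
  by rewrite sin_acos// -sqrtr_sqr -pq addrC addKr.
have [q0|q0] := leP 0 q.
  by exists (acos p); rewrite ca sa ger0_norm.
by exists (- acos p); rewrite cosN sinN ca sa ltr0_norm// opprK.
Qed.

Lemma polar_angle (x y : R) : exists t, [/\ x = Num.sqrt (x ^+ 2 + y ^+ 2) * cos t &
  y = Num.sqrt (x ^+ 2 + y ^+ 2) * sin t].
Proof.
set r := Num.sqrt _; have r2 : r ^+ 2 = x ^+ 2 + y ^+ 2.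
  by rewrite sqr_sqrtr// addr_ge0// sqr_ge0.
have [r0|r0] := eqVneq r 0.
  move: r2; rewrite r0 expr0n /= => /esym/eqP.
  rewrite paddr_eq0 ?sqr_ge0// !sqrf_eq0 => /andP[/eqP -> /eqP ->].
  by exists 0; rewrite !mul0r.
have [|t [ct st]] := @circle_angle (x / r) (y / r).
  by rewrite !exprMn -mulrDl -r2 exprVn divff// expf_neq0.
by exists t; rewrite -ct -st; split; rewrite mulrC divfK.
Qed.

Lemma rot12K (c s : R) : c ^+ 2 + s ^+ 2 = 1 -> rot12 c s *m (rot12 c s)^T = 1%:M.
Proof. by move=> h; apply: matrix3P; rewrite mulmx3E !mxE /=; first [by ring|by rewrite -[RHS]h; ring]. Qed.

Lemma rot13K (c s : R) : c ^+ 2 + s ^+ 2 = 1 -> rot13 c s *m (rot13 c s)^T = 1%:M.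
Proof. by move=> h; apply: matrix3P; rewrite mulmx3E !mxE /=; first [by ring|by rewrite -[RHS]h; ring]. Qed.

Lemma rot23K (c s : R) : c ^+ 2 + s ^+ 2 = 1 -> rot23 c s *m (rot23 c s)^T = 1%:M.
Proof. by move=> h; apply: matrix3P; rewrite mulmx3E !mxE /=; first [by ring|by rewrite -[RHS]h; ring]. Qed.

Lemma det_rot12 (c s : R) : c ^+ 2 + s ^+ 2 = 1 -> \det (rot12 c s) = 1.
Proof. by move=> h; rewrite det3E !mxE /= -[RHS]h; ring. Qed.

Lemma det_rot13 (c s : R) : c ^+ 2 + s ^+ 2 = 1 -> \det (rot13 c s) = 1.
Proof. by move=> h; rewrite det3E !mxE /= -[RHS]h; ring. Qed.

Lemma det_rot23 (c s : R) : c ^+ 2 + s ^+ 2 = 1 -> \det (rot23 c s) = 1.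
Proof. by move=> h; rewrite det3E !mxE /= -[RHS]h; ring. Qed.

Definition rotation (A : 'M[R]_3) : Prop := A *m A^T = 1%:M /\ \det A = 1.

Lemma rotation_mul (A A' : 'M[R]_3) : rotation A -> rotation A' -> rotation (A *m A').
Proof.
move=> [h1 h2] [h3 h4]; split; last by rewrite det_mulmx h2 h4 mulr1.
by rewrite trmx_mul mulmxA -[A *m _ *m _]mulmxA h3 mulmx1.
Qed.

Lemma rotation_tr (A : 'M[R]_3) : rotation A -> rotation A^T.
Proof. by move=> [h1 h2]; split; rewrite ?det_tr// trmxK; exact: mulmx1C. Qed.

(** Orthogonality to the first column clears the first row, leaving a 2 x 2 orthogonal block of
    determinant 1. *)
Lemma rotation_fix_e1 (N : 'M[R]_3) : rotation N ->
  N 0 0 = 1 -> N 1 0 = 0 -> N 2%:R 0 = 0 ->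
  exists t, N = rot23 (cos t) (sin t).
Proof.
move=> [/mulmx1C NN dN] n00 n10 n20.
have G i j : N 0 i * N 0 j + N 1 i * N 1 j + N 2%:R i * N 2%:R j = (i == j)%:R.
  by have /matrixP/(_ i j) := NN; rewrite mulmx3E !mxE.
have n01 : N 0 1 = 0 by have := G 0 1; rewrite n00 n10 n20 mul1r !mul0r !addr0.
have n02 : N 0 2%:R = 0 by have := G 0 2%:R; rewrite n00 n10 n20 mul1r !mul0r !addr0.
have g11 := G 1 1; have g12 := G 1 2%:R.
rewrite n01 n02 !mul0r !add0r /= in g11 g12.
have d : N 1 1 * N 2%:R 2%:R - N 1 2%:R * N 2%:R 1 = 1.
  by rewrite -dN det3E n00 n10 n20 n01 n02; ring.
have e22 : N 2%:R 2%:R = N 1 1.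
  (* Multiply by the unit length of the middle column, then regroup into the determinant and
     orthogonality relations of the block. *)
  transitivity (N 2%:R 2%:R * (N 1 1 * N 1 1 + N 2%:R 1 * N 2%:R 1)).
    by rewrite g11 mulr1.
  transitivity (N 1 1 * (N 1 1 * N 2%:R 2%:R - N 1 2%:R * N 2%:R 1)
    + N 2%:R 1 * (N 1 1 * N 1 2%:R + N 2%:R 1 * N 2%:R 2%:R)); first by ring.
  by rewrite d g12 mulr1 mulr0 addr0.
have e12 : N 1 2%:R = - N 2%:R 1.
  transitivity (N 1 2%:R * (N 1 1 * N 1 1 + N 2%:R 1 * N 2%:R 1)).
    by rewrite g11 mulr1.
  transitivity (N 1 1 * (N 1 1 * N 1 2%:R + N 2%:R 1 * N 2%:R 2%:R)
    - N 2%:R 1 * (N 1 1 * N 2%:R 2%:R - N 1 2%:R * N 2%:R 1)); first by ring.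
  by rewrite d g12 mulr1 mulr0 add0r.
have [|t [ct st]] := @circle_angle (N 1 1) (N 2%:R 1); first by rewrite !expr2.
by exists t; apply: matrix3P; rewrite [RHS]mxE /= -?ct -?st.
Qed.

Lemma rotation_rot12 t : rotation (rot12 (cos t) (sin t)).
Proof. by split; [exact/rot12K/cos2Dsin2|exact/det_rot12/cos2Dsin2]. Qed.

Lemma rotation_rot13 t : rotation (rot13 (cos t) (sin t)).
Proof. by split; [exact/rot13K/cos2Dsin2|exact/det_rot13/cos2Dsin2]. Qed.

Lemma rotation_rot23 t : rotation (rot23 (cos t) (sin t)).
Proof. by split; [exact/rot23K/cos2Dsin2|exact/det_rot23/cos2Dsin2]. Qed.

(** Two rotations bring the first column to e1: the angle a clears its second entry, b its third.
    The remaining rotation N fixes e1. *)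
Lemma euler_angles (A : 'M[R]_3) : rotation A -> exists a b c : R,
  A = rot12 (cos a) (sin a) *m rot13 (cos b) (sin b) *m rot23 (cos c) (sin c).
Proof.
move=> AO; have [/mulmx1C AA _] := AO.
have [a [xa ya]] := polar_angle (A 0 0) (A 1 0).
set rho := Num.sqrt _ in xa ya.
have rho2 : rho ^+ 2 = A 0 0 ^+ 2 + A 1 0 ^+ 2.
  by rewrite sqr_sqrtr// addr_ge0// sqr_ge0.
have [|b [rb zb]] := @circle_angle rho (A 2%:R 0).
  rewrite rho2; have /matrixP/(_ 0 0) := AA; rewrite mulmx3E !mxE /= => h; by apply: etrans h; ring.
have cs (t : R) : cos t ^+ 2 + sin t ^+ 2 = 1 by exact: cos2Dsin2.
have R1 := rotation_rot12 a; have R2 := rotation_rot13 b.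
set M1 := rot12 _ _ in R1 *; set M2 := rot13 _ _ in R2 *.
pose N := M2^T *m (M1^T *m A).
have NR : rotation N.
  by do 2! (apply: rotation_mul; first exact: rotation_tr).
have NE : A = M1 *m M2 *m N.
  by rewrite /N mulmxA -[M1 *m M2 *m _]mulmxA R2.1 mulmx1 mulmxA R1.1 mul1mx.
have c0 : (M1^T *m A) 0 0 = rho.
  by rewrite mulmx3E !mxE /= mul0r addr0 xa ya -[RHS]mulr1 -(cs a); ring.
have c1 : (M1^T *m A) 1 0 = 0.
  by rewrite mulmx3E !mxE /= mul0r addr0 xa ya; ring.
have c2 : (M1^T *m A) 2%:R 0 = A 2%:R 0.
  by rewrite mulmx3E !mxE /=; ring.
have [|||c cE] := rotation_fix_e1 NR.
- by rewrite mulmx3E c0 c1 c2 rb zb !mxE /= -[RHS](cs b); ring.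
- by rewrite mulmx3E c0 c1 c2 !mxE /=; ring.
- by rewrite mulmx3E c0 c1 c2 rb zb !mxE /=; ring.
by exists a, b, c; rewrite NE cE.
Qed.

End Rotations.

Section Connectedness.
Context {R : realType}.
Local Notation C := R[i].
Local Notation M3 := 'M[C]_3.
Local Notation B := (frame0 R).
Local Notation toC := (map_mx (real_complex R)).

Definition embed_rotation (A : 'M[R]_3) : M3 := B *m toC A *m B^t*.

Lemma SO_groupP (g : M3) : SO_group g <-> exists2 A, rotation A & g = embed_rotation A.
Proof.
have BL := @frame0_lagrangian R; split=> [[gU gQ]|[A [AA dA] ->]].
  have gL := lagrangian_frame_mul gU BL.
  have [|A [AA dA gA]] := real_transition gL BL.
    by rewrite -act_swap gQ frame0_swap.
  by exists A; [split|rewrite /embed_rotation -gA frame0_adjK].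
have AL : lagrangian_frame (B *m toC A).
  split; last by rewrite det_mulmx BL.2 det_toC dA mulr1.
  apply: unitary_gram_mul; first exact: BL.1.
  rewrite /unitary_gram trmx_toC map_conj_real -map_real_mul.
  by rewrite (mulmx1C AA) map_mx1.
split; first exact: lagrangian_frame_SU3.
by rewrite act_swap /embed_rotation frame0K (frame_square _ AA) frame0_swap.
Qed.

Definition euler_path (a b c t : R) : 'M[R]_3 :=
  rot12 (cos (a * t)) (sin (a * t)) *m rot13 (cos (b * t)) (sin (b * t)) *m
  rot23 (cos (c * t)) (sin (c * t)).

Lemma Cinfty_cos_sin (a : R) :
  Cinfty setT (fun t => cos (a * t)) /\ Cinfty setT (fun t => sin (a * t)).
Proof.
split=> k.
  by apply: Ck_ext (Cinfty_sin a (pi / 2) openT k) => [|t _]; [exact: openT|exact: sinDpihalf].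
by apply: Ck_ext (Cinfty_sin a 0 openT k) => [|t _]; [exact: openT|rewrite addr0].
Qed.

Lemma mxsmooth_rmx3 (U : set R) (a b c d e f g h k : R -> R) : open U ->
  Cinfty U a -> Cinfty U b -> Cinfty U c -> Cinfty U d -> Cinfty U e ->
  Cinfty U f -> Cinfty U g -> Cinfty U h -> Cinfty U k ->
  mxsmooth U (fun x => toC (rmx3 (a x) (b x) (c x) (d x) (e x) (f x) (g x) (h x) (k x))).
Proof.
move=> oU *.
have ext (m : R -> C) (u : R -> R) : Cinfty U u -> (forall x, (u x)%:C%C = m x) -> csmooth U m.
  by move=> hu um; apply: (csmooth_ext oU _ (csmooth_real hu)) => x _.
apply: ord3P; apply: ord3P;
  [apply: (ext _ a)|apply: (ext _ b)|apply: (ext _ c)|apply: (ext _ d)|apply: (ext _ e)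
  |apply: (ext _ f)|apply: (ext _ g)|apply: (ext _ h)|apply: (ext _ k)] => //;
  by move=> x; rewrite !mxE.
Qed.

Lemma mxsmooth_euler_path (a b c : R) : mxsmooth setT (fun t => toC (euler_path a b c t)).
Proof.
have oT := @openT R; have z (x : R) : Cinfty setT (fun _ : R => x) by exact: Cinfty_cst.
have cs x := (Cinfty_cos_sin x).1; have sn x := (Cinfty_cos_sin x).2.
have ns (x : R) : Cinfty setT (fun t : R => - sin (x * t)) by apply: (CinftyN oT); exact: sn.
apply: (mxsmooth_ext oT (f := fun t => toC (rot12 (cos (a * t)) (sin (a * t)))
    *m toC (rot13 (cos (b * t)) (sin (b * t))) *m toC (rot23 (cos (c * t)) (sin (c * t))))).
  by move=> t _; rewrite -!map_real_mul.
apply: mxsmoothM => //; first apply: mxsmoothM => //.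
- exact: (mxsmooth_rmx3 oT (cs a) (ns a) (z 0) (sn a) (cs a) (z 0) (z 0) (z 0) (z 1)).
- exact: (mxsmooth_rmx3 oT (cs b) (z 0) (ns b) (z 0) (z 1) (z 0) (sn b) (z 0) (cs b)).
- exact: (mxsmooth_rmx3 oT (z 1) (z 0) (z 0) (z 0) (cs c) (ns c) (z 0) (sn c) (cs c)).
Qed.

Lemma connected_SO_group : connected (@realify R @` SO_group).
Proof.
have BL := @frame0_lagrangian R.
pose F (p : R * R * R) (t : R) : M3R R := realify (embed_rotation (euler_path p.1.1 p.1.2 p.2 t)).
have rotP p t : rotation (euler_path p.1.1 p.1.2 p.2 t).
  by apply: rotation_mul; [apply: rotation_mul|]; [exact: rotation_rot12
    |exact: rotation_rot13|exact: rotation_rot23].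
(* Scaling the three Euler angles by t joins the identity at t = 0 to a given element at t = 1, so
   the group is a union of connected curves through the identity. *)
have -> : @realify R @` SO_group = \bigcup_(p in [set: R * R * R]) (F p @` setT).
  apply/seteqP; split=> [_ [g /SO_groupP [A AR ->] <-]|_ [p _ [t _ <-]]].
    have [a [b [c ->]]] := euler_angles AR; exists (a, b, c); first by [].
    exists 1; first by [].
    by rewrite /F /euler_path !mulr1.
  exists (embed_rotation (euler_path p.1.1 p.1.2 p.2 t)); last by [].
  by apply/SO_groupP; exists (euler_path p.1.1 p.1.2 p.2 t).
apply: bigcup_connected.
  exists (realify 1%:M) => p _; exists 0; first by [].
  rewrite /F /euler_path !mulr0 cos0 sin0.
  have r1 : rot12 1 0 = 1%:M :> 'M[R]_3 by apply: matrix3P; rewrite !mxE /= ?oppr0.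
  have r2 : rot13 1 0 = 1%:M :> 'M[R]_3 by apply: matrix3P; rewrite !mxE /= ?oppr0.
  have r3 : rot23 1 0 = 1%:M :> 'M[R]_3 by apply: matrix3P; rewrite !mxE /= ?oppr0.
  by rewrite r1 r2 r3 !mulmx1 /embed_rotation map_mx1 mulmx1 unitary_gramC//; exact: BL.1.
move=> p _; apply: connected_continuous_connected.
  by apply/connected_intervalP => x y _ _ z _.
apply: continuous_subspaceT => t.
have oT := @openT R.
have sF : Cinfty setT (F p).
  apply: (Cinfty_realify oT (f := fun t => embed_rotation (euler_path p.1.1 p.1.2 p.2 t))).
  apply: mxsmoothM => //; last exact: mxsmooth_cst.
  by apply: mxsmoothM => //; [exact: mxsmooth_cst|exact: mxsmooth_euler_path].
exact: (Cinfty_continuous sF).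
Qed.

End Connectedness.

(** * Lie algebra *)

Section LieAlgebra.
Context {R : realType}.
Local Notation C := R[i].
Local Notation M3 := 'M[C]_3.
Implicit Types X : M3.

Lemma is_derive_linear_comp (V W : normedModType R) (L : {linear V -> W}) (f : R -> V) (t : R) v :
  continuous L -> is_derive t (1 : R) f v -> is_derive t (1 : R) (L \o f) (L v).
Proof.
move=> cL [df <-].
have dff : differentiable f t by apply/derivable1_diffP.
have dL : differentiable L (f t) by exact: linear_differentiable.
have dc : differentiable (L \o f) t by exact: differentiable_comp.
split; first exact/derivable1_diffP.
rewrite deriveE; last exact: dc.
by rewrite (@diff_comp _ _ _ _ f L t dff dL) /= (diff_lin _ cL) deriveE.
Qed.

Lemma is_derive_unique (V : normedModType R) (f : R -> V) (t : R) v w :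
  is_derive t (1 : R) f v -> is_derive t (1 : R) f w -> v = w.
Proof. by move=> [_ <-] [_ <-]. Qed.

Lemma is_derive_reflect (V : normedModType R) (f : R -> V) v :
  is_derive (0 : R) (1 : R) f v -> is_derive (0 : R) (1 : R) (fun t => f (- t)) (- v).
Proof.
move=> [df <-].
have dff : differentiable f (- (0 : R)) by rewrite oppr0; apply/derivable1_diffP.
have dN : differentiable (-%R : R -> R) 0 by exact/derivable1_diffP/derivable_opp.
have dc : differentiable (f \o -%R) 0 by exact: differentiable_comp.
split; first by apply/derivable1_diffP; exact: dc.
rewrite deriveE; last exact: dc.
rewrite (@diff_comp _ _ _ _ (-%R : R -> R) f 0 dN dff) /=.
rewrite -(deriveE _ dN) derive_val oppr0 deriveE ?linearN//.
by apply/derivable1_diffP.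
Qed.

Lemma complexify_linear (a : R) (e f : M3R R) :
  complexify (a *: e + f) = a%:C%C *: complexify e + complexify f.
Proof.
apply/matrixP => i j; rewrite !mxE /=; apply/eqP; rewrite eq_complex /=.
by apply/andP; split; apply/eqP; ring.
Qed.

Lemma realify_linear (a : R) (g h : M3) :
  realify (a%:C%C *: g + h) = a *: realify g + realify h.
Proof. by apply: (can_inj (@complexifyK R)); rewrite complexify_linear !realifyK. Qed.

Lemma map_conj_real_linear m n (a : R) (g h : 'M[C]_(m, n)) :
  map_mx Num.conj (a%:C%C *: g + h) = a%:C%C *: map_mx Num.conj g + map_mx Num.conj h.
Proof. by apply/matrixP => i j; rewrite !mxE rmorphD rmorphM /= conj_realC. Qed.

Lemma SO_group1 : SO_group (1%:M : M3).
Proof. by split; [exact: SU3_1|rewrite trmx1 mul1mx mulmx1]. Qed.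

Lemma hom_path0 (gamma : R -> M3) : (forall t, SO_group (gamma t)) ->
  (forall s t, gamma (s + t) = gamma s *m gamma t) -> gamma 0 = 1%:M.
Proof.
move=> gK gM; have gu := SU3_unit (gK 0).1.
by rewrite -[LHS](mulKmx gu) -gM addr0 mulVmx.
Qed.

(** The two relations are the linearizations of unitarity and of g S g^T = S. The second gives X01 =
    X10 = X22 = 0 and X11 = -X00, the first makes X00 imaginary, and together they tie the last row
    and column to [y]. *)
Lemma so3_of_relations X : X^t* = - X -> swapmx *m X^T = - (X *m swapmx) -> so3 R X.
Proof.
move=> /matrixP h /matrixP k.
have H i j : (X j i)^* = - X i j by have := h i j; rewrite !mxE.
have K i j : swapmx i 0 * X j 0 + swapmx i 1 * X j 1 + swapmx i 2%:R * X j 2%:R =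
    - (X i 0 * swapmx 0 j + X i 1 * swapmx 1 j + X i 2%:R * swapmx 2%:R j).
  by have := k i j; rewrite mulmx3E [RHS]mxE mulmx3E ![X^T _ _]mxE.
have dbl (x : C) : x = - x -> x = 0.
  by move=> /eqP; rewrite -subr_eq0 opprK -mulr2n mulrn_eq0 /= => /eqP.
have K00 := K 0 0; have K11 := K 1 1; have K22 := K 2%:R 2%:R; have K01 := K 0 1.
have K02 := K 0 2%:R; have K12 := K 1 2%:R.
rewrite !mx3E !(mul0r, mulr0, mul1r, mulr1, addr0, add0r) in K00 K11 K22 K01 K02 K12.
have x01 := dbl _ K00; have x10 := dbl _ K11; have x22 := dbl _ K22.
have x12 : X 1 2%:R = (X 0 2%:R)^*.
  by apply: oppr_inj; rewrite -K12 (H 2%:R 0) opprK.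
exists (complex.Im (X 0 0)), (X 0 2%:R).
have x00 : X 0 0 = Complex 0 (complex.Im (X 0 0)).
  have := H 0 0; case: (X 0 0) => a b /= [/esym/eqP].
  rewrite eq_sym -subr_eq0 opprK -mulr2n mulrn_eq0 /= => /eqP ->.
  done.
have K01' : X 1 1 = - X 0 0 by exact: K01.
apply: matrix3P; rewrite mx3E //.
- by rewrite K01' {1}x00; apply/eqP; rewrite eq_complex /= oppr0 !eqxx.
- by rewrite -x12 -K12 ?opprK.
Qed.

(** Both group relations are rewritten with gamma(-t) in place of the inverse. They become linear in
    gamma, so differentiating them takes only linear maps and the reflection t |-> -t. *)
Lemma lie_algebra_sub X : lie_algebra SO_group X -> so3 R X.
Proof.
move=> [gamma [gK gM gD]]; have g0 := hom_path0 gK gM.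
have gV t : gamma (- t) = invmx (gamma t).
  have gu := SU3_unit (gK t).1.
  by rewrite -[LHS](mulKmx gu) -gM subrr g0 mulmx1.
have gA t : (gamma t)^t* = gamma (- t) by rewrite gV SU3_invE//; exact: (gK t).1.
have gQ t : swapmx *m (gamma t)^T = gamma (- t) *m swapmx.
  have gu := SU3_unit (gK t).1.
  by rewrite gV -[in RHS](gK t).2 !mulmxA mulVmx// mul1mx.
have dN := is_derive_reflect gD; rewrite /= in dN.
have oT := @openT (M3R R); have sc := @mxsmooth_complexify R setT.
(* Derivatives pass through maps linear over R only, which covers the conjugate-linear adjoint. *)
have D (L : M3 -> M3) : (forall a g h, L (a%:C%C *: g + h) = a%:C%C *: L g + L h) ->
    mxsmooth setT (fun e : M3R R => L (complexify e)) ->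
    forall f v, is_derive (0 : R) (1 : R) f v ->
    is_derive (0 : R) (1 : R) (fun t => realify (L (complexify (f t)))) (realify (L (complexify v))).
  move=> lL sL f v fv.
  have lin : linear (fun e : M3R R => realify (L (complexify e))).
    by move=> a e e'; rewrite complexify_linear lL realify_linear.
  pose LM := GRing.isLinear.Build _ _ _ _ _ lin.
  pose LL : {linear M3R R -> M3R R} := HB.pack (fun e : M3R R => realify (L (complexify e))) LM.
  apply: (@is_derive_linear_comp _ _ LL f) => //.
  by move=> e; apply: (Cinfty_continuous (Cinfty_realify oT sL)).
have rN (Y : M3) : complexify (- realify Y) = - Y.
  by apply/matrixP => i j; rewrite !mxE; case: (Y i j).
refine (so3_of_relations _ _).
- have lA a (g h : M3) : (a%:C%C *: g + h)^t* = a%:C%C *: g^t* + h^t*.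
    by rewrite linearP /= map_conj_real_linear.
  have sA : mxsmooth setT (fun e : M3R R => (complexify e)^t*).
    by apply: mxsmooth_conj => //; exact: mxsmooth_tr.
  have d1 := D (fun g => g^t*) lA sA _ _ gD.
  have := is_derive_unique d1; rewrite (_ : (fun t => _) = fun t => realify (gamma (- t))).
    by move=> /(_ _ dN) /(congr1 (@complexify R)); rewrite !realifyK rN.
  by apply/funext => t /=; rewrite realifyK gA.
- have lA a (g h : M3) : swapmx *m (a%:C%C *: g + h)^T =
      a%:C%C *: (swapmx *m g^T) + swapmx *m h^T.
    by rewrite linearP /= mulmxDr scalemxAr.
  have lB a (g h : M3) : (a%:C%C *: g + h) *m swapmx =
      a%:C%C *: (g *m swapmx) + h *m swapmx.
    by rewrite mulmxDl scalemxAl.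
  have sA : mxsmooth setT (fun e : M3R R => swapmx *m (complexify e)^T).
    by apply: mxsmoothM => //; [exact: mxsmooth_cst|exact: mxsmooth_tr].
  have sB := mxsmooth_complexify_mull swapmx oT.
  have d1 := D (fun g => swapmx *m g^T) lA sA _ _ gD.
  have d2 := D (fun g => g *m swapmx) lB sB _ _ dN.
  have := is_derive_unique d1; rewrite (_ : (fun t => _) =
    fun t => realify (complexify (realify (gamma (- t))) *m swapmx)).
    by move=> /(_ _ d2) /(congr1 (@complexify R)); rewrite !realifyK rN mulNmx.
  by apply/funext => t /=; rewrite !realifyK gQ.
Qed.

(** As X^3 = -kX, the span of 1, X and X^2 is closed under multiplication. *)
Lemma rodrigues_mul (K : comPzRingType) n (X : 'M[K]_n) (k f h f' h' : K) : X *m X *m X = - k *: X ->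
  (1%:M + f *: X + h *: (X *m X)) *m (1%:M + f' *: X + h' *: (X *m X)) =
  1%:M + (f + f' - k * (f * h' + f' * h)) *: X
    + (h + h' + f * f' - k * h * h') *: (X *m X).
Proof.
move=> X3; pose Y := X *m X.
have YX : Y *m X = - k *: X by exact: X3.
have XY : X *m Y = - k *: X by rewrite mulmxA.
have YY : Y *m Y = - k *: Y by rewrite {2}/Y mulmxA YX -scalemxAl.
have XX : X *m X = Y by [].
rewrite XX; clearbody Y.
rewrite !(mulmxDl, mulmxDr) !mulmx1 !mul1mx -!scalemxAl -!scalemxAr XX YX XY YY.
by apply/matrixP => i j; rewrite !mxE; ring.
Qed.

(** Cayley-Hamilton: trace and determinant of X vanish, and the sum of its principal 2 x 2 minors is
    a^2 + 2|y|^2. *)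
Lemma so3_cube (a : R) (y : C) X :
  X = mx3 [:: [:: Complex 0 a; 0; y]; [:: 0; Complex 0 (- a); y^*]; [:: - y^*; - y; 0]] ->
  X *m X *m X = - (a ^+ 2 + 2 * (complex.Re y ^+ 2 + complex.Im y ^+ 2))%:C%C *: X.
Proof.
move=> ->; set u := Complex 0 a; have -> : Complex 0 (- a) = - u.
  by apply/eqP; rewrite eq_complex /= oppr0 !eqxx.
have -> : - (a ^+ 2 + 2 * (complex.Re y ^+ 2 + complex.Im y ^+ 2))%:C%C =
    u ^+ 2 - 2 * (y * y^*).
  rewrite /u; case: y => p q; apply/eqP; rewrite eq_complex /=.
  by apply/andP; split; apply/eqP; ring.
move: u (y^*) => u z.
by apply: matrix3P; rewrite !mulmx3E [RHS]mxE !mx3E; ring.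
Qed.

Lemma so3_relations X : so3 R X ->
  X^t* = - X /\ swapmx *m X^T = - (X *m swapmx).
Proof.
move=> [a [y ->]]; split.
  by apply: matrix3P; rewrite !mxE /= ?oppr0 ?rmorph0 ?rmorphN /= ?conjCK ?opprK //;
    apply/eqP; rewrite eq_complex /= ?opprK ?oppr0 !eqxx.
by apply: matrix3P; rewrite mulmx3E [RHS]mxE mulmx3E !mxE /=
  !(mul0r, mulr0, mul1r, mulr1, addr0, add0r, oppr0, opprK) //;
  apply/eqP; rewrite eq_complex /= ?opprK ?oppr0 !eqxx.
Qed.

End LieAlgebra.

Section OneParameter.
Context {R : realType}.
Local Notation C := R[i].
Local Notation M3 := 'M[C]_3.
Implicit Types X : M3.

Lemma is_derive_scale_cst (V : normedModType R) (f : R -> R) (t df : R) (A : V) :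
  is_derive t (1 : R) f df -> is_derive t (1 : R) (fun s => f s *: A) (df *: A).
Proof.
move=> [d <-]; have dff : differentiable f t by apply/derivable1_diffP.
have [d2 e] := is_diff_scale_fun dff (differentiable_cst A t).
split; first exact/derivable1_diffP.
by rewrite deriveE// e diff_cst /= scaler0 add0r -deriveE.
Qed.

Lemma realify_expansion X (a b : R) (Y : M3) :
  realify (a%:C%C *: X + b%:C%C *: Y + 1%:M) =
  a *: realify X + (b *: realify Y + realify 1%:M).
Proof.
by rewrite -addrA realify_linear; congr (_ + _); rewrite realify_linear.
Qed.

Lemma lie_algebra_sup X : so3 R X -> lie_algebra SO_group X.
Proof.
move=> sX; have [XA XQ] := so3_relations sX.
have [a [y XE]] := sX; have X3 := so3_cube XE.
set k := a ^+ 2 + 2 * (complex.Re y ^+ 2 + complex.Im y ^+ 2) in X3.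
have k0 : 0 <= k by rewrite addr_ge0 ?sqr_ge0// mulr_ge0// addr_ge0 ?sqr_ge0.
(* The closed formula divides by [k], a sum of squares that vanishes only for X = 0. *)
have [kz|kn] := eqVneq k 0.
  have X0 : X = 0.
    move: kz => /eqP; rewrite /k paddr_eq0 ?sqr_ge0 ?mulr_ge0 ?addr_ge0 ?sqr_ge0//.
    rewrite sqrf_eq0 mulf_eq0 pnatr_eq0 /= paddr_eq0 ?sqr_ge0// !sqrf_eq0.
    move=> /and3P[/eqP a0 /eqP p0 /eqP q0]; rewrite XE a0.
    have -> : y = 0 by apply/eqP; rewrite eq_complex p0 q0 !eqxx.
    by apply: matrix3P; rewrite mx3E !mxE ?oppr0 ?rmorph0 ?oppr0.
  exists (fun _ => 1%:M); split; first by move=> _; exact: SO_group1.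
    by move=> s t; rewrite mulmx1.
  rewrite X0 (_ : realify 0 = 0); last by congr pair; apply/matrixP => i j; rewrite !mxE.
  exact: is_derive_cst.
pose th := Num.sqrt k.
have th2 : th ^+ 2 = k by rewrite sqr_sqrtr.
have th0 : th != 0 by apply: contraNneq kn => e; rewrite -th2 e expr0n.
(* Coefficients of exp(tX): by X^3 = -kX the odd powers sum to sin(th t)/th X and the even ones,
   beyond the identity, to (1 - cos(th t))/k X^2. *)
pose f t : R := sin (th * t) / th.
pose h t : R := (1 - cos (th * t)) / k.
have kE : k = th * th by rewrite -th2 expr2.
pose gamma (t : R) : M3 := 1%:M + (f t)%:C%C *: X + (h t)%:C%C *: (X *m X).
have gM s t : gamma (s + t) = gamma s *m gamma t.
  have fM : f (s + t) = f s + f t - k * (f s * h t + f t * h s).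
    by rewrite /f /h mulrDr sinD kE; field; exact: th0.
  have hM : h (s + t) = h s + h t + f s * f t - k * h s * h t.
    by rewrite /f /h mulrDr cosD kE; field; exact: th0.
  have cf (u v u' v' : R) : (u + v - k * (u * v' + v * u'))%:C%C =
      u%:C%C + v%:C%C - k%:C%C * (u%:C%C * v'%:C%C + v%:C%C * u'%:C%C) :> C.
    by rewrite !(rmorphB, rmorphD, rmorphM).
  have ch (u v u' v' : R) : (u' + v' + u * v - k * u' * v')%:C%C =
      u'%:C%C + v'%:C%C + u%:C%C * v%:C%C - k%:C%C * u'%:C%C * v'%:C%C :> C.
    by rewrite !(rmorphB, rmorphD, rmorphM).
  by rewrite /gamma fM hM cf ch (rodrigues_mul _ _ _ _ X3).
have g0 : gamma 0 = 1%:M.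
  by rewrite /gamma /f /h mulr0 sin0 cos0 subrr !mul0r !scale0r !addr0.
have gN t : gamma t *m gamma (- t) = 1%:M by rewrite -gM subrr g0.
have fN t : f (- t) = - f t by rewrite /f mulrN sinN mulNr.
have hN t : h (- t) = h t by rewrite /h mulrN cosN.
have gNE t : gamma (- t) = 1%:M - (f t)%:C%C *: X + (h t)%:C%C *: (X *m X).
  by rewrite /gamma fN hN rmorphN scaleNr.
have gA t : (gamma t)^t* = gamma (- t).
  rewrite gNE /gamma; move: (f t) (h t) => u v.
  rewrite !linearD /= !map_mxD trmx1 map_mx1 !linearZ /= !map_mxZ /=.
  by rewrite !conj_realC adjmx_mul XA mulNmx mulmxN opprK scalerN.
have gQ t : gamma t *m swapmx *m (gamma t)^T = swapmx.
  have e : swapmx *m (gamma t)^T = gamma (- t) *m swapmx.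
    rewrite gNE /gamma; move: ((f t)%:C%C) ((h t)%:C%C) => u v.
    have XXQ : swapmx *m (X *m X)^T = X *m X *m swapmx.
      by rewrite trmx_mul mulmxA XQ mulNmx -(mulmxA X swapmx) XQ mulmxN opprK mulmxA.
    have -> : (1%:M + u *: X + v *: (X *m X))^T = 1%:M + u *: X^T + v *: (X *m X)^T.
      by apply/matrixP => i j; rewrite !mxE eq_sym.
    rewrite !mulmxDr -!scalemxAr XQ XXQ !mulmxDl mulmx1 mul1mx -!scalemxAl.
    by rewrite scalerN mulNmx -scalemxAl.
  by rewrite -mulmxA e mulmxA gN mul1mx.
(* Preserving S only gives a determinant of square 1; as gamma(t) is the square of gamma(t/2), its
   determinant is 1. *)
have dg t : \det (gamma t) = 1.
  have d2 s : \det (gamma s) ^+ 2 = 1.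
    have sw : \det (@swapmx R) != 0.
      by rewrite det3E !mx3E !(mulr0, mul0r, mulr1, subr0, addr0, sub0r, add0r) oppr_eq0 oner_eq0.
    apply: (mulIf sw); rewrite mul1r -{2}(gQ s) !det_mulmx det_tr expr2.
    by rewrite mulrAC.
  have -> : t = t / 2 + t / 2 by field.
  by rewrite gM det_mulmx -expr2 d2.
exists gamma; split => //.
- move=> t; split => //; apply: SU3_of_unitary => //.
  by rewrite /unitary_gram gA; apply: mulmx1C; exact: gN.
- rewrite (_ : @realify R \o gamma = fun t =>
    f t *: realify X + (h t *: realify (X *m X) + realify 1%:M)); last first.
    apply/funext => t; rewrite /= -realify_expansion; congr (realify _).
    by rewrite /gamma -addrA addrC.
  have lin (c : R) : is_derive (0 : R) (1 : R) (fun t : R => c * t) c.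
    by apply: is_derive_eq; rewrite /GRing.scale /= mulr1.
  have ds : is_derive (0 : R) (1 : R) (fun t : R => sin (th * t)) th.
    have := @is_derive1_comp R (@sin R) (fun t => th * t) 0 _ _ (is_derive_sin _) (lin th).
    by rewrite mulr0 cos0 mul1r.
  have dc : is_derive (0 : R) (1 : R) (fun t : R => cos (th * t)) 0.
    have := @is_derive1_comp R (@cos R) (fun t => th * t) 0 _ _ (is_derive_cos _) (lin th).
    by rewrite mulr0 sin0 oppr0 mul0r.
  have df : is_derive (0 : R) (1 : R) f 1.
    have := is_derive_scale_cst th^-1 ds.
    by rewrite (_ : th *: th^-1 = 1)//; rewrite /GRing.scale /= divff.
  have dh : is_derive (0 : R) (1 : R) h 0.
    have d1 := is_deriveB (is_derive_cst (1 : R) (0 : R) (1 : R)) dc.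
    by have := is_derive_scale_cst k^-1 d1; rewrite subr0 scale0r.
  have := is_deriveD (is_derive_scale_cst (realify X) df)
    (is_deriveD (is_derive_scale_cst (realify (X *m X)) dh) (is_derive_cst (realify (1%:M : M3)) (0 : R) (1 : R))).
  by rewrite scale1r scale0r !addr0.
Qed.

Lemma lie_algebra_SO_group : lie_algebra SO_group = so3 R.
Proof. by apply/seteqP; split=> X; [exact: lie_algebra_sub|exact: lie_algebra_sup]. Qed.

End OneParameter.

(** * The automorphisms *)

Section Automorphisms.
Context {R : realType}.
Local Notation C := R[i].
Local Notation M3 := 'M[C]_3.
Local Notation P := (P R).
Local Notation sigma := (sigma R).
Local Notation Dmx := (@Dmx R).
Implicit Types g h : M3.

Lemma PP : P *m P = 1%:M.
Proof.
have w3 := @omega3 R; rewrite PE; apply: matrix3P; rewrite mulmx3E !mx3E mxE /=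
  !(mul0r, mulr0, mul1r, mulr1, addr0, add0r) //; by rewrite -[RHS]w3; ring.
Qed.

Lemma P_unit : P \in unitmx.
Proof. by have [] := mulmx1_unit PP. Qed.

Lemma invmx_P : invmx P = P.
Proof. by rewrite -[LHS]mulmx1 -PP mulKmx// P_unit. Qed.

Lemma trP_trP : P^T *m P^T = 1%:M.
Proof. by rewrite -trmx_mul PP trmx1. Qed.

Lemma P_trPE : P *m P^T = Dmx.
Proof. exact: P_mul_tr. Qed.

Lemma trP_PE : P^T *m P = invmx Dmx.
Proof.
have Du := @Dmx_unit R; rewrite -[LHS]mulmx1 -(mulmxV Du) mulmxA -{1}P_trPE.
by rewrite -!mulmxA (mulmxA P P) PP mul1mx (mulmxA P^T) trP_trP mul1mx.
Qed.

Lemma SL3_unit g : SL3 g -> g \in unitmx.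
Proof. by rewrite /SL3 /= unitmxE => ->; exact: unitr1. Qed.

Lemma SL3_inv g : SL3 g -> SL3 (invmx g).
Proof. by rewrite /SL3 /= det_inv => ->; rewrite invr1. Qed.

Lemma SL3_tr g : SL3 g -> SL3 g^T.
Proof. by rewrite /SL3 /= det_tr. Qed.

Lemma SL3_P_conj g : SL3 g -> SL3 (P *m g *m P).
Proof. by rewrite /SL3 /= !det_mulmx => ->; rewrite mulr1 -det_mulmx PP det1. Qed.

Lemma SL3_sigma g : SL3 g -> SL3 (sigma g).
Proof. by move=> gS; apply: SL3_P_conj; apply: SL3_inv; exact: SL3_tr. Qed.

Lemma SL3_iter n g : SL3 g -> SL3 (iter n sigma g).
Proof. by move=> gS; elim: n => //= n; exact: SL3_sigma. Qed.

(** Replaces the inverse by a polynomial that is smooth on all matrices, as needed for the lifts of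
    sigma. *)
Lemma SL3_adj_inv g : SL3 g -> invmx g = \adj g.
Proof. by move=> gS; rewrite /invmx SL3_unit// gS invr1 scale1r. Qed.

Lemma sigma_mul g h : SL3 g -> SL3 h -> sigma (g *m h) = sigma g *m sigma h.
Proof.
move=> gS hS; rewrite /sigma trmx_mul invmx_mul ?unitmx_tr ?SL3_unit//.
by move: (P) PP => p pp; rewrite !mulmxA -(mulmxA _ p p) pp mulmx1.
Qed.

Lemma iter_sigma_mul n g h : SL3 g -> SL3 h ->
  iter n sigma (g *m h) = iter n sigma g *m iter n sigma h.
Proof.
by move=> gS hS; elim: n => //= n ->; rewrite sigma_mul//; exact: SL3_iter.
Qed.

(** That P is Hermitian is what makes sigma commute with [tau]. *)
Lemma adj_P : P^t* = P.
Proof.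
have := @Dmx_adj R; rewrite PE => /matrixP h.
have wc : (omega : C)^* = omega ^+ 2.
  by have := h 1 1; rewrite !mxE /=.
have wc2 : (omega ^+ 2 : C)^* = omega by rewrite -wc conjCK.
by apply: matrix3P; rewrite !mxE /= ?rmorph0 ?rmorph1 ?wc2 ?wc.
Qed.

Lemma sigma_tau g : SL3 g -> sigma (tau g) = tau (sigma g).
Proof.
move=> gS; have gu := SL3_unit gS.
have cu : (map_mx Num.conj g) \in unitmx by rewrite map_unitmx.
have l : sigma (tau g) = P *m map_mx Num.conj g *m P.
  by rewrite /sigma /tau trmx_inv invmxK (adj_conj g).
have r : (sigma g)^t* = P *m invmx (map_mx Num.conj g) *m P.
  rewrite /sigma !adjmx_mul adj_P trmx_inv trmxK mulmxA.
  by congr (_ *m _ *m _); exact: (map_invmx Num.conj).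
rewrite l /tau r invmx_mul ?unitmx_mul ?P_unit ?unitmx_inv// invmx_mul ?P_unit ?unitmx_inv//.
by rewrite invmxK invmx_P; move: (P) => p; rewrite mulmxA.
Qed.

Lemma iter_sigma_tau n g : SL3 g -> iter n sigma (tau g) = tau (iter n sigma g).
Proof.
by move=> gS; elim: n => //= n ->; rewrite sigma_tau//; exact: SL3_iter.
Qed.

Lemma sigma2E g : g \in unitmx -> iter 2 sigma g = Dmx *m g *m invmx Dmx.
Proof.
move=> gu; have gtu : g^T \in unitmx by rewrite unitmx_tr.
rewrite /= {1}/sigma {1}/sigma !trmx_mul trmx_inv trmxK.
have ptu : P^T \in unitmx by rewrite unitmx_tr P_unit.
rewrite invmx_mul ?unitmx_mul ?unitmx_inv ?ptu ?gu//.
rewrite invmx_mul ?unitmx_inv ?ptu ?gu// invmxK -trmx_inv invmx_P.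
by rewrite -trP_PE -P_trPE; move: (P) (P^T) => p q; rewrite !mulmxA.
Qed.

Lemma sigma3E g : SL3 g -> iter 3 sigma g = swapmx *m invmx g^T *m swapmx.
Proof.
move=> gS; have gu := SL3_unit gS; have Du := @Dmx_unit R.
have gtu : g^T \in unitmx by rewrite unitmx_tr.
have DT : Dmx^T = Dmx by rewrite -P_trPE trmx_mul trmxK.
rewrite -[iter 3 sigma g]/(sigma (iter 2 sigma g)) sigma2E// /sigma !trmx_mul trmx_inv DT.
rewrite invmx_mul ?unitmx_mul ?unitmx_inv ?gtu ?Du//.
rewrite invmx_mul ?unitmx_inv ?gtu ?Du// invmxK.
have s1 : Dmx *m P = swapmx by rewrite -P_trPE P_tr_P.
have s2 : P *m invmx Dmx = swapmx by rewrite -trP_PE mulmxA P_tr_P.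
by rewrite !mulmxA s2 -mulmxA s1.
Qed.

Lemma Dmx3 : Dmx *m Dmx *m Dmx = 1%:M.
Proof.
have w3 := @omega3 R; rewrite /Dmx !diag3M !mulr1 -[RHS]diag3_1.
have w6 : omega ^+ 2 * omega ^+ 2 * omega ^+ 2 = 1 :> C.
  by rewrite -!exprD (exprD _ 3 3) w3 mulr1.
by rewrite w6 -expr2 -exprSr w3.
Qed.

Lemma sigma4E g : g \in unitmx ->
  iter 4 sigma g = Dmx *m Dmx *m g *m (invmx Dmx *m invmx Dmx).
Proof.
move=> gu; have Du := @Dmx_unit R.
rewrite -[iter 4 sigma g]/(iter 2 sigma (iter 2 sigma g)) sigma2E sigma2E ?unitmx_mul ?gu ?Du ?unitmx_inv//.
by rewrite !mulmxA.
Qed.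

Lemma sigma6E g : SL3 g -> iter 6 sigma g = g.
Proof.
move=> gS; have gu := SL3_unit gS; have Du := @Dmx_unit R.
rewrite -[iter 6 sigma g]/(iter 2 sigma (iter 4 sigma g)) sigma2E; last exact/SL3_unit/SL3_iter.
rewrite sigma4E// !mulmxA Dmx3 mul1mx.
have e : invmx Dmx *m invmx Dmx *m invmx Dmx = 1%:M.
  have D2 : Dmx *m Dmx = invmx Dmx.
    by rewrite -[RHS]mul1mx -Dmx3 mulmxK.
  by rewrite -{1}D2 (mulmxK Du) (mulmxV Du).
by rewrite -!mulmxA (mulmxA (invmx Dmx)) e mulmx1.
Qed.

Lemma smooth_iter_sigma n :
  @smooth_map R (mxspace R) (mxspace R) (@SL3 R) (iter n sigma).
Proof.
have [F [sF FE]] : exists F : M3 -> M3, mxsmooth setT (fun e : M3R R => F (complexify e)) /\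
    forall g, SL3 g -> F g = iter n sigma g.
  have oT := @openT (M3R R).
  elim: n => [|n [F [sF FE]]].
    by exists id; split => //; exact: mxsmooth_complexify.
  exists (fun g => P *m (\adj (F g))^T *m P); split.
    apply: mxsmoothM => //; last exact: mxsmooth_cst.
    apply: mxsmoothM => //; first exact: mxsmooth_cst.
    by apply: mxsmooth_tr => //; exact: mxsmooth_adj.
  move=> g gS; rewrite FE//= /sigma -trmx_inv SL3_adj_inv//; exact: SL3_iter.
move=> e _ eS; exists setT, (fun e => realify (F (complexify e))); split => //.
- exact: openT.
- exact: (Cinfty_realify openT sF).
- by move=> e' _ _ e'S; rewrite /= realifyK FE.
Qed.

(** As sigma^6 = 1, the inverse of a power of sigma is again a power of sigma, and smoothness of
    powers settles both directions. *)
Lemma diffeomorphism_iter_sigma m n : (m + n = 6)%N ->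
  @diffeomorphism R (mxspace R) (mxspace R) (@SL3 R) (@SL3 R) (iter m sigma).
Proof.
move=> mn; have mK g : SL3 g -> iter n sigma (iter m sigma g) = g.
  by move=> gS; rewrite -iterD addnC mn; exact: sigma6E.
have nK g : SL3 g -> iter m sigma (iter n sigma g) = g.
  by move=> gS; rewrite -iterD mn; exact: sigma6E.
split.
- split=> [g gS|g h /set_mem gS /set_mem hS e|g gS].
  + exact: SL3_iter.
  + by rewrite -(mK g gS) e mK.
  + by exists (iter n sigma g); [exact: SL3_iter|exact: nK].
- exact: smooth_iter_sigma.
- by exists (iter n sigma); split; [exact: mK|exact: smooth_iter_sigma].
Qed.

(** A single element moved by sigma^2, sigma^3 and sigma^4, witnessing that the orders are exact: it
    is not diagonal and does not preserve S. *)
Definition shear : M3 := mx3 [:: [:: 1; 1; 0]; [:: 0; 1; 0]; [:: 0; 0; 1]].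

Lemma SL3_shear : SL3 shear.
Proof. by rewrite /SL3 /= det3E !mx3E; ring. Qed.

Lemma sigma3_fixed g : SL3 g -> iter 3 sigma g = g <-> g *m swapmx *m g^T = swapmx.
Proof.
move=> gS; have gu := SL3_unit gS; have gtu : g^T \in unitmx by rewrite unitmx_tr.
have ss : swapmx *m swapmx = 1%:M :> M3.
  by apply: matrix3P; rewrite mulmx3E !mx3E mxE /= !(mul0r, mulr0, mulr1, addr0, add0r).
rewrite sigma3E//; split=> e.
  by rewrite -{1}e -(mulmxA _ swapmx swapmx) ss mulmx1 (mulmxKV gtu).
by rewrite -[X in X *m invmx _]e (mulmxK gtu) -mulmxA ss mulmx1.
Qed.

Lemma sigma2_fixed g : SL3 g -> iter 2 sigma g = g <-> is_diag_mx g.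
Proof.
move=> gS; have Du := @Dmx_unit R; rewrite sigma2E ?SL3_unit//.
apply: iff_trans (commute_Dmx g); split=> e; first by rewrite -{1}e mulmxKV.
by rewrite -e mulmxK.
Qed.

Lemma shear_sigma3 : iter 3 sigma shear <> shear.
Proof.
move/(sigma3_fixed SL3_shear)/matrixP/(_ 0 0); rewrite !mulmx3E !mxE /=.
rewrite !(mul0r, mulr0, mulr1, addr0, add0r) -mulr2n => /eqP.
by rewrite pnatr_eq0.
Qed.

Lemma shear_sigma2 : iter 2 sigma shear <> shear.
Proof.
move/(sigma2_fixed SL3_shear)/is_diag_mxP/(_ 0 1 isT); rewrite mx3E => /eqP.
by rewrite oner_eq0.
Qed.

(** If sigma^4 fixed the shear, so would sigma^2, because sigma^2 after sigma^4 is the identity. *)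
Lemma shear_sigma4 : iter 4 sigma shear <> shear.
Proof.
move=> e; apply: shear_sigma2.
by rewrite -{1}e -[LHS]/(iter 6 sigma shear) sigma6E//; exact: SL3_shear.
Qed.

Lemma automorphism_sigma3 : automorphism_of_order 2 (iter 3 sigma).
Proof.
split.
- exact: (@diffeomorphism_iter_sigma 3 3).
- exact: iter_sigma_mul.
- by move=> g gS; rewrite -(iterM 2 3); exact: sigma6E.
- move=> [|[|//]] // _; exists shear; first exact: SL3_shear.
  by rewrite -(iterM 1 3); exact: shear_sigma3.
- exact: iter_sigma_tau.
Qed.

Lemma automorphism_sigma2 : automorphism_of_order 3 (iter 2 sigma).
Proof.
split.
- exact: (@diffeomorphism_iter_sigma 2 4).
- exact: iter_sigma_mul.
- by move=> g gS; rewrite -(iterM 3 2); exact: sigma6E.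
- move=> [|[|[|//]]] // _; exists shear; try exact: SL3_shear.
    by rewrite -(iterM 1 2); exact: shear_sigma2.
  by rewrite -(iterM 2 2); exact: shear_sigma4.
- exact: iter_sigma_tau.
Qed.

Lemma Fix_sigma3 : Fix (iter 3 sigma) = SO_group.
Proof.
apply/seteqP; split=> g [gU h]; split => //; first exact/(sigma3_fixed gU.2).
by case: (sigma3_fixed gU.2) => _; exact.
Qed.

Lemma Fix_sigma2 : Fix (iter 2 sigma) = D3 R.
Proof.
apply/seteqP; split=> g [gU h]; split => //; first exact/(sigma2_fixed gU.2).
by case: (sigma2_fixed gU.2) => _; exact.
Qed.

Lemma identity_component_sub (H : set M3) : identity_component H `<=` H.
Proof.
move=> g /connected_component_sub [h Hh].
by move/(can_inj (@realifyK R)) => <-.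
Qed.

Lemma k_symmetric k (kappa : M3 -> M3) (X : SU3_space R) : (2 <= k)%N ->
  automorphism_of_order k kappa -> represented_as X (Fix kappa) ->
  k_symmetric_space k kappa X.
Proof.
move=> k2 ak rX; split => //; exists (Fix kappa); split => //.
exact: identity_component_sub.
Qed.

End Automorphisms.

Theorem theorem3p5 (R : realType) :
  (* (1) *)
  ((exists f : pt (base_space (SLGr R)) -> pt (base_space (SLGr_tilde R)),
      @equivariant_diffeo R (SLGr R) (SLGr_tilde R) f
      /\ f (V0 R) = P R *m (P R)^T *m P R)
   /\ symmetric_space (iter 3 (sigma R)) (SLGr R)
   /\ symmetric_space (iter 3 (sigma R)) (SLGr_tilde R)
   /\ has_dim (SLGr R) 5
   /\ has_dim (SLGr_tilde R) 5)
  (* (2) *)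
  /\ ((exists f : pt (base_space (Fl2 R)) -> pt (base_space (Fl2_tilde R)),
         @equivariant_diffeo R (Fl2 R) (Fl2_tilde R) f
         /\ f (flag_of 1%:M) = P R *m (P R)^T)
      /\ k_symmetric_space 3 (iter 2 (sigma R)) (Fl2 R)
      /\ k_symmetric_space 3 (iter 2 (sigma R)) (Fl2_tilde R)
      /\ has_dim (Fl2 R) 6
      /\ has_dim (Fl2_tilde R) 6)
  (* (3) *)
  /\ (exists SO3 : set 'M[R[i]]_3,
        connected_subgroup_with_lie_algebra SO3 (so3 R)
        /\ represented_as (SLGr R) SO3
        /\ represented_as (SLGr_tilde R) SO3)
  /\ represented_as (Fl2 R) (D3 R)
  /\ represented_as (Fl2_tilde R) (D3 R).
Proof.
have hG := @homogeneous_SLGr R; have hGt := @homogeneous_SLGr_tilde R.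
have hF := @homogeneous_Fl2 R; have hFt := @homogeneous_Fl2_tilde R.
have sG := @stabilizer_SLGr R; have sGt := @stabilizer_SLGr_tilde R.
have sF := @stabilizer_Fl2 R; have sFt := @stabilizer_Fl2_tilde R.
have cO := @closed_SO_group R; have cD := @closed_D3 R.
have rG := homogeneous_represented hG sG cO.
have rGt := homogeneous_represented hGt sGt cO.
have rF := homogeneous_represented hF sF cD.
have rFt := homogeneous_represented hFt sFt cD.
have eG := etrans sG (esym sGt); have eF := etrans sF (esym sFt).
have rG3 : represented_as (SLGr R) (Fix (iter 3 (sigma R))) by rewrite Fix_sigma3.
have rGt3 : represented_as (SLGr_tilde R) (Fix (iter 3 (sigma R))) by rewrite Fix_sigma3.
have rF2 : represented_as (Fl2 R) (Fix (iter 2 (sigma R))) by rewrite Fix_sigma2.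
have rFt2 : represented_as (Fl2_tilde R) (Fix (iter 2 (sigma R))) by rewrite Fix_sigma2.
have fd := @finite_dimensional_M3R R.
split; [|split; [|split; [|split => //]]].
- split; first exact: homogeneous_equivariant_diffeo hG hGt eG.
  split; first exact: (k_symmetric (leqnn 2) (@automorphism_sigma3 R) rG3).
  split; first exact: (k_symmetric (leqnn 2) (@automorphism_sigma3 R) rGt3).
  split; first exact: (@homogeneous_has_dim R (SLGr R) (SLGr R) _ _ 5 fd hG hG erefl (@chart_SLGr R)).
  (* The chart at [V0] is carried to the matrix model through the common stabilizer. *)
  exact: (@homogeneous_has_dim R (SLGr R) _ _ _ 5 fd hG hGt eG (@chart_SLGr R)).
- split; first exact: homogeneous_equivariant_diffeo hF hFt eF.
  split; first exact: (k_symmetric (leqnSn 2) (@automorphism_sigma2 R) rF2).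
  split; first exact: (k_symmetric (leqnSn 2) (@automorphism_sigma2 R) rFt2).
  split; first exact: (@homogeneous_has_dim R (Fl2 R) (Fl2 R) _ _ 6 fd hF hF erefl (@chart_Fl2 R)).
  exact: (@homogeneous_has_dim R (Fl2 R) _ _ _ 6 fd hF hFt eF (@chart_Fl2 R)).
- exists SO_group; split => //; split.
  + by case: rG.
  + exact: connected_SO_group.
  + exact: lie_algebra_SO_group.
Qed.
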